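(* Let $\mathbf{k}$ be a field, $G$ an abelian group, $\lambda:G\times G\to\mathbf{k}^*$ a bicharacter, and $H$ a $(G,\lambda)$-graded Hopf algebra over $\mathbf{k}$ generated as an algebra by homogeneous primitive elements $a_1,\ldots,a_n$ with fixed positive integer degrees $d_1,\ldots,d_n$. Assume that $H$ has only a finite number of hard super-letters. If all these hard super-letters have infinite height, then $H$ has no zero divisors and has a classical (skew) field of quotients.
   Context: $(G,\lambda)$-graded Hopf algebra. $H=\bigoplus_{g\in G}H_g$ is a $G$-graded algebra and a $G$-graded coalgebra such that $\Delta:H\to H\otimes H$ and $\varepsilon:H\to\mathbf{k}$ are algebra homomorphisms, where $H\otimes H$ carries the multiplication $(a\otimes b)(c\otimes d)=\lambda(g_b,g_c)\,ac\otimes bd$ for homogeneous $b\in H_{g_b}$, $c\in H_{g_c}$, and such that there is a grading-preserving antipode (convolution inverse of the identity). An element $a$ is primitive if $\Delta(a)=a\otimes1+1\otimes a$. Words. Consider words in the alphabet $a_1,\ldots,a_n$, where $a_i\in H_{g_i}$, ordered lexicographically with $a_1>a_2>\cdots>a_n$: two words are compared from left to right at the first distinct letter, and a proper beginning of a word is greater than that word. For a word $u$ let $g_u\in G$ be obtained from $u$ by replacing each letter $a_i$ by $g_i$, and put $p_{uv}=\lambda(g_v,g_u)^{-1}$. A word $u$ with $m_i$ occurrences of $a_i$ has constitution $(m_1,\ldots,m_n)$ and degree $\deg(u)=m_1d_1+\cdots+m_nd_n$. Standard words. A nonempty word $u$ is standard if $u>u_2u_1$ for each factorization $u=u_1u_2$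 into nonempty words. A nonassociative (fully bracketed) word $[u]$ is standard if: (1) the word $u$ obtained by erasing brackets is standard; (2) if $[u]=[[v][w]]$ then $[v]$, $[w]$ are standard nonassociative words; (3) if $[u]=[[[v_1][v_2]][w]]$ then $v_2\le w$. By a theorem of Shirshov each standard word has a unique bracketing that is a standard nonassociative word (for $u$ of length $\ge 2$ it is $[[v][w]]$ with $u=vw$, $v,w$ standard and $v$ of least possible length). Super-letters and super-words. For a standard word $u$, the super-letter $[u]$ is the polynomial obtained from the standard nonassociative word $[u]$ by interpreting brackets as the skew commutator, defined on polynomials homogeneous in each variable by $[f,h]=fh-p_{uv}hf$, where $u,v$ are any words having the constitutions of $f,h$. It is evaluated as an element of $H$. Super-letters are indexed by standard words and ordered by $[u]>[v]\iff u>v$. A super-word is a (formal) word in super-letters; its degree is the sum of the degrees of its super-letters, with $\deg[u]=\deg(u)$. Hard super-letters and heights. A super-letter $[u]$ is hard if in $H$ it is not a linear combination of super-words of degree $\deg(u)$ in super-letters less than $[u]$ and of super-words of degree less than $\deg(u)$. The height of $[u]$ (of degree $d$) is the least natural number $h$ such that (1) $p_{uu}$ is a primitive $t$-th root of unity for some $t\ge1$, and either $h=t$ or $h=tl^k$ where $l>0$ is the characteristic of $\mathbf{k}$; and (2) $[u]^h$ is in $H$ a linear combination of super-words of degree $hd$ in super-letters less than $[u]$ and of super-words of degree less than $hd$. If no such $h$ exists, the height is infinite. *)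

(* Defs.v *)
From HB Require Import structures.
From mathcomp Require Import all_boot all_order all_algebra all_classical.

Set Implicit Arguments.
Unset Strict Implicit.
Unset Printing Implicit Defensive.

Import GRing.Theory.
Local Open Scope ring_scope.

(* The tensor product of V and W: formal finite sums of pairs, two of them
   being identified when every bilinear map gives them the same value. This is
   the quotient of the free space on V * W by the bilinear relations; the
   universal property is tens_bilinear, tlift_linear, tlift_tens, tensor_ext. *)

Notation is_bilinear B := (bilinear_for *:%R *:%R B).

Section Tensor.
Variables (k : fieldType) (V W : lmodType k).

Definition formal_sum := seq (V * W).

Definition bil_eval (U : lmodType k) (B : V -> W -> U) (s : formal_sum) : U :=
  \sum_(p <- s) B p.1 p.2.

Definition tens_rel (s t : formal_sum) : bool :=
  `[< forall (U : lmodType k) (B : V -> W -> U),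
        is_bilinear B -> bil_eval B s = bil_eval B t >].

Lemma tens_rel_refl : reflexive tens_rel.
Proof. by move=> s; apply/asboolP. Qed.

Lemma tens_rel_sym : symmetric tens_rel.
Proof.
by move=> s t; apply/asboolP/asboolP => h U B hB; rewrite (h U B hB).
Qed.

Lemma tens_rel_trans : transitive tens_rel.
Proof.
move=> t s u /asboolP h1 /asboolP h2; apply/asboolP => U B hB.
by rewrite (h1 U B hB) (h2 U B hB).
Qed.

Canonical tens_equiv := EquivRel tens_rel tens_rel_refl tens_rel_sym
  tens_rel_trans.

Definition tensor := {eq_quot tens_equiv}%qT.

HB.instance Definition _ := EqQuotient.on tensor.
HB.instance Definition _ := Choice.on tensor.

Definition tproj (s : formal_sum) : tensor := (\pi_(tensor) s)%qT.

Definition tens (v : V) (w : W) : tensor := tproj [:: (v, w)].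

(* Meaningful when B is bilinear: the linear map induced by B *)
Definition tlift (U : lmodType k) (B : V -> W -> U) (x : tensor) : U :=
  bil_eval B (repr x).

Lemma tlift_proj (U : lmodType k) (B : V -> W -> U) s :
  is_bilinear B -> tlift B (tproj s) = bil_eval B s.
Proof.
move=> hB; have : (repr (tproj s) = s %[mod_eq tens_equiv])%qT.
  by rewrite reprK.
by move/eqmodP/asboolP; apply.
Qed.

Lemma tensor_eqP (x y : tensor) :
  (forall (U : lmodType k) (B : V -> W -> U),
     is_bilinear B -> tlift B x = tlift B y) -> x = y.
Proof.
move=> h; rewrite -[x]reprK -[y]reprK; apply/eqmodP/asboolP => U B hB.
exact: h.
Qed.

Definition tadd (x y : tensor) : tensor := tproj (repr x ++ repr y).
Definition tscale (c : k) (x : tensor) : tensor :=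
  tproj [seq (c *: p.1, p.2) | p <- repr x].

Lemma tlift_add (U : lmodType k) (B : V -> W -> U) x y :
  is_bilinear B -> tlift B (tadd x y) = tlift B x + tlift B y.
Proof. by move=> hB; rewrite tlift_proj // /bil_eval big_cat. Qed.

Lemma tlift_scale (U : lmodType k) (B : V -> W -> U) c x :
  is_bilinear B -> tlift B (tscale c x) = c *: tlift B x.
Proof.
move=> hB; rewrite tlift_proj // /bil_eval big_map scaler_sumr.
apply: eq_bigr => -[v w] _ /=; have B0 : B 0 w = 0.
  by have /= := hB.1 w (-1) 0 0; rewrite scaler0 addr0 scaleN1r addNr.
by have /= := hB.1 w c v 0; rewrite !addr0 B0 addr0.
Qed.

Lemma tlift_0 (U : lmodType k) (B : V -> W -> U) :
  is_bilinear B -> tlift B (tproj [::]) = 0.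
Proof. by move=> hB; rewrite tlift_proj // /bil_eval big_nil. Qed.

Lemma taddA : associative tadd.
Proof. by move=> x y z; apply: tensor_eqP => U B hB; rewrite !tlift_add ?addrA. Qed.
Lemma taddC : commutative tadd.
Proof. by move=> x y; apply: tensor_eqP => U B hB; rewrite !tlift_add // addrC. Qed.
Lemma tadd0 : left_id (tproj [::]) tadd.
Proof.
by move=> x; apply: tensor_eqP => U B hB; rewrite tlift_add // tlift_0 // add0r.
Qed.
Lemma taddN : left_inverse (tproj [::]) (tscale (-1)) tadd.
Proof.
move=> x; apply: tensor_eqP => U B hB.
by rewrite tlift_add // tlift_0 // tlift_scale // scaleN1r addNr.
Qed.

HB.instance Definition _ := GRing.isZmodule.Build tensor taddA taddC tadd0 taddN.

Lemma tscaleA (a b : k) x : tscale a (tscale b x) = tscale (a * b) x.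
Proof. by apply: tensor_eqP => U B hB; rewrite !tlift_scale // scalerA. Qed.
Lemma tscale1 : left_id 1 tscale.
Proof. by move=> x; apply: tensor_eqP => U B hB; rewrite !tlift_scale // scale1r. Qed.
Lemma tscaleDr : right_distributive tscale +%R.
Proof.
move=> a x y; apply: tensor_eqP => U B hB.
by rewrite tlift_scale // !tlift_add // !tlift_scale // scalerDr.
Qed.
Lemma tscaleDl x : {morph tscale^~ x : a b / a + b}.
Proof.
move=> a b; apply: tensor_eqP => U B hB.
by rewrite tlift_scale // tlift_add // !tlift_scale // scalerDl.
Qed.

HB.instance Definition _ := GRing.Zmodule_isLmodule.Build k tensor
  tscaleA tscale1 tscaleDr tscaleDl.

Lemma tlift_linear (U : lmodType k) (B : V -> W -> U) :
  is_bilinear B -> linear (tlift B).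
Proof. by move=> hB a x y; rewrite [LHS]tlift_add // tlift_scale. Qed.

Lemma tlift_tens (U : lmodType k) (B : V -> W -> U) v w :
  is_bilinear B -> tlift B (tens v w) = B v w.
Proof. by move=> hB; rewrite tlift_proj // /bil_eval big_seq1. Qed.

Lemma tens_bilinear : is_bilinear tens.
Proof.
by split=> [w|v] a x y; apply: tensor_eqP => U B hB;
  rewrite [RHS]tlift_add // tlift_scale // !tlift_tens // ?hB.1 ?hB.2.
Qed.

Lemma tensor_sum (x : tensor) : x = \sum_(p <- repr x) tens p.1 p.2.
Proof.
suff E s : tproj s = \sum_(p <- s) tens p.1 p.2 by rewrite -E /tproj reprK.
elim: s => [|p s IHs]; first by rewrite big_nil.
rewrite big_cons -IHs; apply: tensor_eqP => U B hB.
rewrite [RHS]tlift_add // !tlift_proj // /bil_eval big_cons big_seq1 /=.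
by [].
Qed.

Lemma tensor_ext (U : lmodType k) (f h : {linear tensor -> U}) :
  (forall v w, f (tens v w) = h (tens v w)) -> f =1 h.
Proof.
by move=> E x; rewrite (tensor_sum x) !linear_sum; apply: eq_bigr => p _.
Qed.

End Tensor.

Definition tmap (k : fieldType) (V W V' W' : lmodType k)
    (f : V -> V') (h : W -> W') : tensor V W -> tensor V' W' :=
  tlift (fun v w => tens (f v) (h w)).

(* (v (x) w) (x) u |-> v (x) (w (x) u) *)
Definition tassoc (k : fieldType) (V W U : lmodType k) :
    tensor (tensor V W) U -> tensor V (tensor W U) :=
  tlift (fun t u => tlift (fun v w => tens v (tens w u)) t).

(* The abelian group G is written additively. *)

Record bicharacter (k : fieldType) (G : zmodType) (lam : G -> G -> k) : Prop :=
  Bicharacter {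
    bichar_neq0 : forall g h, lam g h != 0;
    bichar_Dl : forall g1 g2 h, lam (g1 + g2) h = lam g1 h * lam g2 h;
    bichar_Dr : forall g h1 h2, lam g (h1 + h2) = lam g h1 * lam g h2 }.

(* Internal direct sum decomposition V = \bigoplus_g V_g *)
Record grading (k : fieldType) (G : zmodType) (V : lmodType k) := Grading {
  gpart :> G -> V -> Prop;
  gpart0 : forall g, gpart g 0;
  gpart_lin : forall g (c : k) x y,
    gpart g x -> gpart g y -> gpart g (c *: x + y);
  gpart_span : forall x, exists s : seq G, exists f : G -> V,
    [/\ uniq s, forall g, gpart g (f g) & x = \sum_(g <- s) f g];
  gpart_direct : forall (s : seq G) (f : G -> V),
    uniq s -> (forall g, gpart g (f g)) -> \sum_(g <- s) f g = 0 ->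
    forall g, g \in s -> f g = 0 }.

Section Twist.
Variables (k : fieldType) (G : zmodType) (V : lmodType k) (gr : grading G V).

Lemma gdec_ex x : exists l : seq (G * V),
  (forall p, p \in l -> gr p.1 p.2) /\ x = \sum_(p <- l) p.2.
Proof.
have [s [f [_ fh ->]]] := gpart_span gr x.
exists [seq (g, f g) | g <- s]; split; last by rewrite big_map.
by move=> _ /mapP[g _ ->].
Qed.

(* Some decomposition of x into homogeneous terms, listed with their degrees *)
Definition gdec (x : V) : seq (G * V) := projT1 (cid (gdec_ex x)).

Lemma gdec_homog x p : p \in gdec x -> gr p.1 p.2.
Proof. by rewrite /gdec; case: cid => l /= [h _]; apply: h. Qed.

Lemma gdec_sum x : \sum_(p <- gdec x) p.2 = x.
Proof. by rewrite /gdec; case: cid => l /= [_ <-]. Qed.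

Lemma gpart_sum (I : Type) (r : seq I) (P : pred I) (F : I -> V) g :
  (forall i, P i -> gr g (F i)) -> gr g (\sum_(i <- r | P i) F i).
Proof.
move=> h; elim/big_rec: _ => [|i x Pi hx]; first exact: gpart0.
by rewrite -[F i]scale1r; apply: gpart_lin => //; apply: h.
Qed.

Section Additive.
Variables (U : zmodType) (Phi : G -> V -> U).
Hypothesis PhiD : forall g, {morph Phi g : x y / x + y}.

Let Phi0 g : Phi g 0 = 0.
Proof. by apply: (addrI (Phi g 0)); rewrite -PhiD !addr0. Qed.

Lemma homog_sum_eq0 (l : seq (G * V)) :
  (forall p, p \in l -> gr p.1 p.2) -> \sum_(p <- l) p.2 = 0 ->
  \sum_(p <- l) Phi p.1 p.2 = 0.
Proof.
move=> hl l0; pose s := undup [seq p.1 | p <- l].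
have regroup (A : nmodType) (F : G * V -> A) :
    \sum_(p <- l) F p = \sum_(g <- s) \sum_(p <- l | p.1 == g) F p.
  rewrite (exchange_big_dep predT) //=; rewrite big_seq [RHS]big_seq.
  apply: eq_bigr => p pl.
  rewrite big_mkcond (bigD1_seq p.1) ?undup_uniq ?mem_undup ?map_f //=.
  rewrite eqxx big1 ?addr0 // => g; rewrite eq_sym => /negPf ->.
  by [].
pose f g : V := \sum_(p <- l | p.1 == g) p.2.
have fh g : gr g (f g).
  rewrite /f big_seq_cond; apply: gpart_sum => p /andP[pl /eqP <-].
  exact: hl.
rewrite regroup big_seq big1 // => g gs.
have -> : \sum_(p <- l | p.1 == g) Phi p.1 p.2 = Phi g (f g).
  rewrite /f (big_morph (Phi g) (PhiD g) (Phi0 g)).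
  by apply: eq_bigr => p /eqP ->.
rewrite (@gpart_direct _ _ _ gr s f) ?undup_uniq //.
by rewrite -(regroup _ (fun p => p.2)).
Qed.

Lemma gdec_indep x (l : seq (G * V)) :
  (forall p, p \in l -> gr p.1 p.2) -> \sum_(p <- l) p.2 = x ->
  \sum_(p <- gdec x) Phi p.1 p.2 = \sum_(p <- l) Phi p.1 p.2.
Proof.
have PhiN g v : Phi g (- v) = - Phi g v.
  by apply: (addrI (Phi g v)); rewrite -PhiD !subrr Phi0.
move=> hl lx; apply/eqP; rewrite -subr_eq0; apply/eqP.
have := @homog_sum_eq0 (gdec x ++ [seq (p.1, - p.2) | p <- l]).
rewrite !big_cat !big_map /= !sumrN gdec_sum lx subrr.
under [X in _ + X]eq_bigr do rewrite PhiN.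
rewrite sumrN; apply=> // p; rewrite mem_cat => /orP[/gdec_homog //|].
case/mapP=> q /hl hq -> /=; rewrite -[- _]addr0 -scaleN1r.
exact: gpart_lin (gpart0 _ _).
Qed.

End Additive.
End Twist.

Section TwistedMul.
Variables (k : fieldType) (G : zmodType) (lam : G -> G -> k).
Variables (H : algType k) (gr : grading G H).

(* lam(g_b, g_c) a c (x) b d, extended to arbitrary b, c through their
   homogeneous components *)
Definition tmul4 (a b c d : H) : tensor H H :=
  \sum_(p <- gdec gr b) \sum_(q <- gdec gr c)
     lam p.1 q.1 *: tens (a * q.2) (p.2 * d).

Definition tmul (x y : tensor H H) : tensor H H :=
  tlift (fun a b => tlift (fun c d => tmul4 a b c d) y) x.

Let tbil := @tens_bilinear k H H.

Let tDl (u v w : H) : tens (u + v) w = tens u w + tens v w.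
Proof. by have /= := tbil.1 w 1 u v; rewrite !scale1r. Qed.
Let tDr (u v w : H) : tens w (u + v) = tens w u + tens w v.
Proof. by have /= := tbil.2 w 1 u v; rewrite !scale1r. Qed.
Let t0l (w : H) : tens (0 : H) w = 0.
Proof. by apply: (addrI (tens 0 w)); rewrite -tDl !addr0. Qed.
Let t0r (w : H) : tens w (0 : H) = 0.
Proof. by apply: (addrI (tens w 0)); rewrite -tDr !addr0. Qed.
Let tZl (c : k) (v w : H) : tens (c *: v) w = c *: tens v w.
Proof. by have /= := tbil.1 w c v 0; rewrite t0l !addr0. Qed.
Let tZr (c : k) (v w : H) : tens w (c *: v) = c *: tens w v.
Proof. by have /= := tbil.2 w c v 0; rewrite t0r !addr0. Qed.

Let tmul4_eq a b c d (lb lc : seq (G * H)) :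
  (forall p, p \in lb -> gr p.1 p.2) -> \sum_(p <- lb) p.2 = b ->
  (forall p, p \in lc -> gr p.1 p.2) -> \sum_(p <- lc) p.2 = c ->
  tmul4 a b c d = \sum_(p <- lb) \sum_(q <- lc)
     lam p.1 q.1 *: tens (a * q.2) (p.2 * d).
Proof.
move=> hb eb hc ec; rewrite /tmul4.
rewrite (@gdec_indep _ _ _ gr _ (fun g v => \sum_(q <- gdec gr c)
  lam g q.1 *: tens (a * q.2) (v * d)) _ b lb) //; last first.
  move=> g x y; rewrite -big_split; apply: eq_bigr => q _ /=.
  by rewrite mulrDl tDr scalerDr.
apply: eq_bigr => p _.
rewrite (@gdec_indep _ _ _ gr _
  (fun h v => lam p.1 h *: tens (a * v) (p.2 * d)) _ c lc) //.
by move=> g x y; rewrite mulrDr tDl scalerDr.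
Qed.

Let gscale (z : k) (l : seq (G * H)) := [seq (p.1, z *: p.2) | p <- l].

Let gcomb z x y : let l := gscale z (gdec gr x) ++ gdec gr y in
  (forall p, p \in l -> gr p.1 p.2) /\ \sum_(p <- l) p.2 = z *: x + y.
Proof.
split=> [p|]; last by rewrite big_cat big_map /= -scaler_sumr !gdec_sum.
rewrite mem_cat => /orP[|/gdec_homog //].
case/mapP=> q /gdec_homog hq -> /=; rewrite -[_ *: _]addr0.
exact: gpart_lin (gpart0 _ _).
Qed.

Let tmul4_bil_in a b : is_bilinear (tmul4 a b).
Proof.
split=> [d|c] z x y /=; last first.
  rewrite /tmul4 scaler_sumr -big_split; apply: eq_bigr => p _ /=.
  rewrite scaler_sumr -big_split; apply: eq_bigr => q _ /=.
  by rewrite mulrDr -scalerAr tDr tZr scalerDr !scalerA [z * _]mulrC.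
have [h1 h2] := gcomb z x y.
rewrite (tmul4_eq a d (@gdec_homog _ _ _ gr b) (gdec_sum _ _) h1 h2).
rewrite /tmul4 scaler_sumr -big_split; apply: eq_bigr => p _ /=.
rewrite scaler_sumr big_cat big_map /=; congr (_ + _).
apply: eq_bigr => q _ /=.
by rewrite -scalerAr tZl !scalerA [z * _]mulrC.
Qed.

Let tmul4_lin_l b c d z x y :
  tmul4 (z *: x + y) b c d = z *: tmul4 x b c d + tmul4 y b c d.
Proof.
rewrite /tmul4 scaler_sumr -big_split; apply: eq_bigr => p _ /=.
rewrite scaler_sumr -big_split; apply: eq_bigr => q _ /=.
by rewrite mulrDl -scalerAl tDl tZl scalerDr !scalerA [z * _]mulrC.
Qed.

Let tmul4_lin_r a c d z x y :
  tmul4 a (z *: x + y) c d = z *: tmul4 a x c d + tmul4 a y c d.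
Proof.
have [h1 h2] := gcomb z x y.
rewrite (tmul4_eq a d h1 h2 (@gdec_homog _ _ _ gr c) (gdec_sum _ _)).
rewrite big_cat big_map /= scaler_sumr; congr (_ + _).
apply: eq_bigr => p _; rewrite scaler_sumr; apply: eq_bigr => q _ /=.
by rewrite -scalerAl tZr !scalerA [z * _]mulrC.
Qed.

Let tmul_bil_out y : is_bilinear (fun a b => tlift (fun c d => tmul4 a b c d) y).
Proof.
split=> [w|v] z s t /=; rewrite /tlift /bil_eval scaler_sumr -big_split.
  by apply: eq_bigr => p _ /=; rewrite tmul4_lin_l.
by apply: eq_bigr => p _ /=; rewrite tmul4_lin_r.
Qed.

Lemma tmul_bilinear : is_bilinear tmul.
Proof.
split=> [y|x] z s t /=; first exact: tlift_linear.
rewrite /tmul /tlift /bil_eval scaler_sumr -big_split.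
by apply: eq_bigr => p _ /=; apply: tlift_linear.
Qed.

Lemma tmul_homog (g h : G) (a b c d : H) : gr g b -> gr h c ->
  tmul (tens a b) (tens c d) = lam g h *: tens (a * c) (b * d).
Proof.
move=> hb hc; rewrite /tmul tlift_tens // tlift_tens //.
rewrite (@tmul4_eq a b c d [:: (g, b)] [:: (h, c)]) ?big_seq1 //.
- by move=> p; rewrite inE => /eqP ->.
- by move=> p; rewrite inE => /eqP ->.
Qed.

End TwistedMul.

(* The g-component of V (x) V *)
Definition tensor_gpart (k : fieldType) (G : zmodType) (V : lmodType k)
    (gr : grading G V) (g : G) (x : tensor V V) : Prop :=
  exists l : seq (V * V),
    (forall p, p \in l -> exists g1 g2, [/\ gr g1 p.1, gr g2 p.2 & g1 + g2 = g])
    /\ x = \sum_(p <- l) tens p.1 p.2.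

(* cop1, copM, cou1, couM: the comultiplication and the counit are algebra
   morphisms, H (x) H carrying tmul, whose defining formula is tmul_homog. *)
Record graded_hopf (k : fieldType) (G : zmodType) (lam : G -> G -> k)
    (H : algType k) := GradedHopf {
  hgr :> grading G H;
  hgr1 : hgr 0 1;
  hgrM : forall g h x y, hgr g x -> hgr h y -> hgr (g + h) (x * y);

  cop : {linear H -> tensor H H};
  cou : {linear H -> k^o};
  copA : forall x, tassoc (tmap cop id (cop x)) = tmap id cop (cop x);
  coul : forall x, tlift (fun u v : H => cou u *: v) (cop x) = x;
  cour : forall x, tlift (fun u v : H => cou v *: u) (cop x) = x;
  cop_gr : forall g x, hgr g x -> tensor_gpart hgr g (cop x);
  cou_gr : forall g x, hgr g x -> g != 0 -> cou x = 0;

  cop1 : cop 1 = tens 1 1;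
  copM : forall x y, cop (x * y) = tmul lam hgr (cop x) (cop y);
  cou1 : cou 1 = 1;
  couM : forall x y, cou (x * y) = cou x * cou y;

  antipode : {linear H -> H};
  antipode_gr : forall g x, hgr g x -> hgr g (antipode x);
  antipodel : forall x,
    tlift (fun u v : H => antipode u * v) (cop x) = cou x *: (1 : H);
  antipoder : forall x,
    tlift (fun u v : H => u * antipode v) (cop x) = cou x *: (1 : H) }.

Definition primitive (k : fieldType) (G : zmodType) (lam : G -> G -> k)
    (H : algType k) (hopf : graded_hopf lam H) (x : H) : Prop :=
  cop hopf x = tens x 1 + tens 1 x.

(* The only subalgebra of H containing all the a_i is H itself *)
Definition generates (k : fieldType) (H : algType k) (n : nat) (a : 'I_n -> H) :=
  forall S : {pred H}, GRing.subalg_closed S -> (forall i, a i \in S) ->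
  forall x, x \in S.

(* The letter a_i is represented by its index i, so a_i > a_j iff i < j. *)

Definition word n := seq 'I_n.

(* wgt u v: u > v. A proper beginning of a word is greater than the word. *)
Fixpoint wgt n (u v : word n) : bool :=
  match u, v with
  | _, [::] => false
  | [::], _ :: _ => true
  | i :: u', j :: v' => (i < j)%N || ((i == j) && wgt u' v')
  end.

Definition wge n (u v : word n) : bool := (u == v) || wgt u v.

(* rot i u = u2 ++ u1 for the factorization u = u1 ++ u2 with size u1 = i *)
Definition standard n (u : word n) : bool :=
  (u != [::]) && [forall i : 'I_(size u), (0 < i)%N ==> wgt u (rot i u)].

Lemma standardP n (u : word n) :
  reflect (u <> [::] /\ forall u1 u2, u1 <> [::] -> u2 <> [::] ->
             u = u1 ++ u2 -> wgt u (u2 ++ u1)) (standard u).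
Proof.
apply: (iffP andP) => -[/eqP u0 h]; split=> //.
  move=> u1 u2 /eqP n1 /eqP n2 E; move: h; rewrite E => /forallP h.
  have lt1 : (size u1 < size (u1 ++ u2))%N.
    by rewrite size_cat -[X in (X < _)%N]addn0 ltn_add2l lt0n size_eq0.
  have := h (Ordinal lt1); rewrite /= lt0n size_eq0 n1 /=.
  by rewrite rot_size_cat.
apply/forallP => i; apply/implyP => i0; apply: h.
- by move/(congr1 size)/eqP; rewrite size_take ltn_ord /= gtn_eqF.
- by move/(congr1 size)/eqP; rewrite size_drop subn_eq0 leqNgt ltn_ord.
- by rewrite cat_take_drop.
Qed.

Inductive naword n := NALeaf of 'I_n | NANode of naword n & naword n.

Fixpoint erase n (t : naword n) : word n :=
  match t with
  | NALeaf i => [:: i]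
  | NANode v w => erase v ++ erase w
  end.

Fixpoint standard_na n (t : naword n) : bool :=
  standard (erase t) &&
  match t with
  | NALeaf _ => true
  | NANode v w =>
      [&& standard_na v, standard_na w &
          match v with
          | NALeaf _ => true
          | NANode _ v2 => wge (erase w) (erase v2)
          end]
  end.

(* By Shirshov's theorem sword is a bijection from super-letters to standard
   words. *)
Definition superletter n := {t : naword n | standard_na t}.
Definition sword n (t : superletter n) : word n := erase (sval t).
Definition superword n := seq (superletter n).

Definition slt n (s t : superletter n) : bool := wgt (sword t) (sword s).

(* m_i = count_mem i u *)
Definition wdeg n (d : 'I_n -> nat) (u : word n) : nat :=
  (\sum_(i < n) count_mem i u * d i)%N.

Definition swdeg n (d : 'I_n -> nat) (w : superword n) : nat :=
  (\sum_(t <- w) wdeg d (sword t))%N.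

Section SuperLetters.
Variables (k : fieldType) (G : zmodType) (lam : G -> G -> k) (H : algType k).
Variables (n : nat) (a : 'I_n -> H) (g : 'I_n -> G) (d : 'I_n -> nat).

Definition wgrade (u : word n) : G := \sum_(i <- u) g i.

Definition pcoef (u v : word n) : k := (lam (wgrade v) (wgrade u))^-1.

Fixpoint na_eval (t : naword n) : H :=
  match t with
  | NALeaf i => a i
  | NANode v w => na_eval v * na_eval w
                  - pcoef (erase v) (erase w) *: (na_eval w * na_eval v)
  end.

Definition sl_eval (t : superletter n) : H := na_eval (sval t).

Definition sw_eval (w : superword n) : H := \prod_(t <- w) sl_eval t.

Definition lin_comb (P : superword n -> Prop) (x : H) : Prop :=
  exists m (c : 'I_m -> k) (w : 'I_m -> superword n),
    (forall i, P (w i)) /\ x = \sum_(i < m) c i *: sw_eval (w i).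

(* The super-words of degree m in super-letters less than [u], together with
   all super-words of degree less than m *)
Definition lower_superword (t : superletter n) (m : nat) (w : superword n) : Prop :=
  (swdeg d w = m /\ all (fun s => slt s t) w) \/ (swdeg d w < m)%N.

Definition hard (t : superletter n) : Prop :=
  ~ lin_comb (lower_superword t (wdeg d (sword t))) (sl_eval t).

Definition height_cond (t : superletter n) (h : nat) : Prop :=
  (exists m : nat, m.-primitive_root (pcoef (sword t) (sword t)) /\
     (h = m \/ exists l e : nat, l \in [pchar k] /\ h = (m * l ^ e)%N)) /\
  lin_comb (lower_superword t (h * wdeg d (sword t))%N) (sl_eval t ^+ h).

(* None stands for infinite height *)
Definition height (t : superletter n) : option nat :=
  if pselect (exists h, `[< height_cond t h >]) is left ex
  then Some (ex_minn ex) else None.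

End SuperLetters.

Definition no_zero_divisors (R : nzRingType) : Prop :=
  forall x y : R, x * y = 0 -> x = 0 \/ y = 0.

(* Two-sided: every element of Q is both a right fraction and a left fraction *)
Definition has_classical_skew_field_of_quotients (R : nzRingType) : Prop :=
  exists (Q : unitRingType) (f : {rmorphism R -> Q}),
    [/\ forall q : Q, q != 0 -> q \is a GRing.unit,
        injective f,
        forall q : Q, exists x y : R, y != 0 /\ q = f x * (f y)^-1
      & forall q : Q, exists x y : R, y != 0 /\ q = (f y)^-1 * f x].

(* Main.v *)
Require Import Defs.
From HB Require Import structures.
From mathcomp Require Import all_boot all_order all_algebra all_classical zify ring.

(* By Kharchenko's PBW argument, monotone words in the hard super-letters form
   a basis when all heights are infinite. They span, since the skew commutator
   of super-letters [u] > [v] involves only super-letters below [u]. They are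
   independent, since Delta [u] is [u] (x) 1 + 1 (x) [u] up to terms with left
   legs below [u]: contracting a relation with leading power [u]^s against
   [u]^j on the left lowers its degree, and a pure power [u]^s survives only if
   all Gaussian binomials (s choose j) vanish, that is, if s is a possible
   height of [u]. Ordering words by degree and then by the multiplicities of
   the hard super-letters, greatest first, products multiply leading words up
   to nonzero scalars, so H is a domain. With finitely many hard super-letters
   H has polynomial growth, which forces the two-sided Ore condition. *)

Set Implicit Arguments.
Unset Strict Implicit.
Unset Printing Implicit Defensive.

Import GRing.Theory.
Local Open Scope ring_scope.

(** * Linear spans *)

(** The degree only filters H, since relations may mix degrees; hence every statement holds modulo
    smaller terms ([below], [short]). Words in hard super-letters are not kept sorted: they are
    compared by a key invariant under permutation, and permuted words agree up to a nonzero scalar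
    and smaller words. Independence thus reads [~ below w (xev w)], without normal forms of
    products.

    Contraction by [u^j] needs a functional that is 1 on [u^j] and kills everything below it. Such a
    functional exists because [u^j] is not spanned by what lies below it, which is the induction
    hypothesis in smaller degree. Out of its reach is a pure power [u^s], whose own functional is
    not yet available; infinite height enters only there. If all inner Gaussian binomials of [s]
    vanish, the product of the [X - q^i] for [i < s] is [X^s - 1], and this is what forces the
    exponents [t] and [t l^k] in the definition of height. The exponent [s = 1] is excluded by
    hardness itself. *)

Inductive spanned (k : fieldType) (V : lmodType k) (X : V -> Prop) : V -> Prop :=
| spanned_zero : spanned X 0
| spanned_cons c x y : X x -> spanned X y -> spanned X (c *: x + y).

Section Span.
Variables (k : fieldType) (V : lmodType k).
Implicit Types (X Y : V -> Prop) (x y : V).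

Lemma spanned_gen X x : X x -> spanned X x.
Proof. by move=> Xx; rewrite -[x]addr0 -[x]scale1r; apply: spanned_cons => //; apply: spanned_zero. Qed.

Lemma spanned_lin X c x y : spanned X x -> spanned X y -> spanned X (c *: x + y).
Proof.
move=> hx hy; elim: hx => [|b z t Xz _ IH]; first by rewrite scaler0 add0r.
by rewrite scalerDr scalerA -addrA; apply: spanned_cons.
Qed.

Lemma spannedD X x y : spanned X x -> spanned X y -> spanned X (x + y).
Proof. by move=> hx hy; rewrite -[x]scale1r; apply: spanned_lin. Qed.

Lemma spannedZ X c x : spanned X x -> spanned X (c *: x).
Proof. by move=> hx; rewrite -[_ *: _]addr0; apply: spanned_lin => //; apply: spanned_zero. Qed.

Lemma spannedN X x : spanned X x -> spanned X (- x).
Proof. by move=> hx; rewrite -scaleN1r; apply: spannedZ. Qed.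

Lemma spannedB X x y : spanned X x -> spanned X y -> spanned X (x - y).
Proof. by move=> hx hy; apply: spannedD => //; apply: spannedN. Qed.

Lemma spanned_sum X (I : Type) (r : seq I) (P : pred I) (F : I -> V) :
  (forall i, P i -> spanned X (F i)) -> spanned X (\sum_(i <- r | P i) F i).
Proof.
move=> h; elim/big_rec: _ => [|i x Pi hx]; first exact: spanned_zero.
by apply: spannedD => //; apply: h.
Qed.

Lemma spannedBE X x y : spanned X (x - y) -> spanned X y -> spanned X x.
Proof. by move=> h1 h2; rewrite -[x](subrK y); apply: spannedD. Qed.

Lemma spannedZE X c x : c != 0 -> spanned X (c *: x) -> spanned X x.
Proof. by move=> c0 h; rewrite -[x]scale1r -(mulVf c0) -scalerA; apply: spannedZ. Qed.

Lemma spanned_trans X Y x : (forall z, X z -> spanned Y z) -> spanned X x -> spanned Y x.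
Proof.
move=> h; elim=> [|c z y Xz _ IH]; first exact: spanned_zero.
by apply: spanned_lin => //; apply: h.
Qed.

Lemma sub_spanned X Y x : (forall z, X z -> Y z) -> spanned X x -> spanned Y x.
Proof. by move=> h; apply: spanned_trans => z /h; apply: spanned_gen. Qed.

End Span.

Lemma spanned_map (k : fieldType) (V U : lmodType k) (f : V -> U) X Y x :
  linear f -> (forall z, X z -> spanned Y (f z)) -> spanned X x -> spanned Y (f x).
Proof.
move=> lf h; elim=> [|c z y Xz _ IH]; last by rewrite lf; apply: spanned_lin => //; apply: h.
have := lf (-1) 0 0; rewrite scaler0 addr0 scaleN1r addNr => ->.
exact: spanned_zero.
Qed.

Lemma spanned_bilinear (k : fieldType) (V W U : lmodType k) (B : V -> W -> U) X Y Z x y :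
  is_bilinear B -> (forall v w, X v -> Y w -> spanned Z (B v w)) ->
  spanned X x -> spanned Y y -> spanned Z (B x y).
Proof.
move=> hB h hx hy; apply: (spanned_map (hB.1 y) _ hx) => v Xv.
by apply: (spanned_map (hB.2 v) _ hy) => w Yw; apply: h.
Qed.

(** * Standard words *)

Section Words.
Variable n : nat.
Implicit Types u v w : word n.

Lemma wgtxx u : wgt u u = false.
Proof. by elim: u => //= i u ->; rewrite ltnn eqxx. Qed.

Lemma wgt_trans v u w : wgt u v -> wgt v w -> wgt u w.
Proof.
elim: u v w => [|i u IH] [|j v] [|l w] //=.
case/orP=> [ij|/andP[/eqP<- uv]] /orP[jl|/andP[/eqP<- vw]].
- by rewrite (ltn_trans ij jl).
- by rewrite ij.
- by rewrite jl.
- by rewrite eqxx (IH v w) ?orbT.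
Qed.

Lemma wgt_total u v : [\/ u = v, wgt u v | wgt v u].
Proof.
elim: u v => [|i u IH] [|j v] /=; try by [constructor 1|constructor 2|constructor 3].
case: (ltngtP i j) => [ij|ji|/ord_inj <-]; [by constructor 2|by constructor 3|].
by rewrite !eqxx /=; case: (IH v) => [->|h|h]; [constructor 1|constructor 2|constructor 3].
Qed.

Lemma wgtN u v : wgt u v -> wgt v u = false.
Proof. by move=> uv; apply/negP => /(wgt_trans uv); rewrite wgtxx. Qed.

Lemma wge_refl u : wge u u.
Proof. by rewrite /wge eqxx. Qed.

Lemma wgtW u v : wgt u v -> wge u v.
Proof. by rewrite /wge => ->; rewrite orbT. Qed.

Lemma wge_gt_trans v u w : wge u v -> wgt v w -> wgt u w.
Proof. by case/orP=> [/eqP->|] //; apply: wgt_trans. Qed.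

Lemma wgt_ge_trans v u w : wgt u v -> wge v w -> wgt u w.
Proof. by move=> uv /orP[/eqP<-|] //; apply: wgt_trans. Qed.

Lemma wge_trans v u w : wge u v -> wge v w -> wge u w.
Proof. by move=> uv /orP[/eqP<-|vw] //; apply/wgtW/(wge_gt_trans uv). Qed.

Lemma wgeN u v : ~~ wge u v -> wgt v u.
Proof.
by case: (wgt_total u v) => [->|h|//]; rewrite ?wge_refl // wgtW.
Qed.

Lemma wgt_cat2l u v w : wgt (u ++ v) (u ++ w) = wgt v w.
Proof. by elim: u => //= i u ->; rewrite ltnn eqxx. Qed.

Lemma wge_cat2l u v w : wge (u ++ v) (u ++ w) = wge v w.
Proof. by rewrite /wge wgt_cat2l eqseq_cat // eqxx. Qed.

Lemma wgt_prefix u v : v <> [::] -> wgt u (u ++ v).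
Proof. by elim: u => [|i u IH] /= h; [case: v h | rewrite eqxx IH ?orbT]. Qed.

Lemma wgt_cat u v a b : wgt u v -> ~~ prefix u v -> wgt (u ++ a) (v ++ b).
Proof.
elim: u v => [|i u IH] [|j v] //= /orP[->//|/andP[/eqP <- uv]].
by rewrite eqxx /= => /(IH _ uv) ->; rewrite orbT.
Qed.

Lemma standard_neq0 u : standard u -> u <> [::].
Proof. by case/standardP. Qed.

(* The two rotations at a border contradict each other, so a standard word has
   no border: the comparison with a proper suffix is decided by a letter. *)
Lemma standard_unbordered u u1 u2 : standard u -> u = u1 ++ u2 ->
  u1 <> [::] -> u2 <> [::] -> ~~ prefix u2 u.
Proof.
move=> /standardP[_ h] E n1 n2; apply/negP => /prefixP[u3 E3].
have n3 : u3 <> [::].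
  move=> e; have := congr1 size E3; rewrite e E !size_cat.
  by case: (u1) n1 => [|? ?] //= _; lia.
have gt1 := h _ _ n1 n2 E; have gt2 := h _ _ n2 n3 E3.
move: gt1; rewrite {1}E3 wgt_cat2l => gt31.
have sz : size u1 = size u3.
  by have := congr1 size E3; rewrite E !size_cat addnC => /addnI.
have np : ~~ prefix u3 u1.
  apply/negP => /prefixP[x e]; move: gt31; move: (congr1 size e).
  rewrite size_cat sz => /eqP; rewrite -[X in X == _]addn0 eqn_add2l => /eqP s0.
  by rewrite e; case: x s0 {e} => // _; rewrite cats0 wgtxx.
have := wgt_cat u2 u2 gt31 np; rewrite -E => gt.
by rewrite (wgtN gt) in gt2.
Qed.

(** Were [u2] greater, a letter would decide this, as [u] has no border, and the rotation [u2 ++ u1]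
    would exceed [u]. *)
Lemma standard_gt_suffix u u1 u2 : standard u -> u = u1 ++ u2 ->
  u1 <> [::] -> u2 <> [::] -> wgt u u2.
Proof.
move=> su E n1 n2; have nb := standard_unbordered su E n1 n2.
case: (wgt_total u u2) => // [e|gt].
  by rewrite -e prefix_refl in nb.
have /standardP[_ h] := su; have := h _ _ n1 n2 E.
by have := wgt_cat u1 [::] gt nb; rewrite cats0 => /wgtN ->.
Qed.

(** Converse of [standard_gt_suffix]: [u] is too long to be a beginning of [u2], so a letter decides
    and the rotation is smaller too. *)
Lemma suffix_gt_standard u : u <> [::] ->
  (forall u1 u2, u = u1 ++ u2 -> u1 <> [::] -> u2 <> [::] -> wgt u u2) ->
  standard u.
Proof.
move=> n0 h; apply/standardP; split=> // u1 u2 n1 n2 E.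
have gt := h _ _ E n1 n2.
rewrite -[u]cats0; apply: wgt_cat => //; apply/negP => /prefixP[u3 E2].
have := congr1 size E2; rewrite E !size_cat.
by case: (u1) n1 => [|? ?] //= _; lia.
Qed.

(** If [v = u v'], the claim reduces to [v > v'], a comparison of [v] with its own suffix. *)
Lemma standard_wgt_cat u v : standard u -> wgt u v -> standard v -> wgt (u ++ v) v.
Proof.
move=> su uv sv; have [/prefixP[v' E]|np] := boolP (prefix u v).
  have n' : v' <> [::] by move=> e; move: uv; rewrite E e cats0 wgtxx.
  by rewrite {2}E wgt_cat2l; apply: (standard_gt_suffix sv E) => //; apply: standard_neq0.
by rewrite -[X in wgt _ X]cats0; apply: wgt_cat.
Qed.

(** A suffix starting inside [u] is settled by a letter of [u]; one inside [v] is at most [v], which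
    is below [u ++ v]. *)
Lemma standard_cat u v : standard u -> standard v -> wgt u v -> standard (u ++ v).
Proof.
move=> su sv uv; have nu := standard_neq0 su; have nv := standard_neq0 sv.
apply: suffix_gt_standard => [|u1 u2 E n1 n2].
  by move=> /(congr1 size); rewrite size_cat; case: (u) nu.
have uvv := standard_wgt_cat su uv sv.
have [lt|ge] := ltnP (size u1) (size u).
  have E1 : u = u1 ++ drop (size u1) u.
    have := congr1 (take (size u1)) E; rewrite take_cat lt take_size_cat // => e.
    by rewrite -{1}(cat_take_drop (size u1) u) e.
  have E2 : u2 = drop (size u1) u ++ v.
    by have := congr1 (drop (size u1)) E; rewrite drop_cat lt drop_size_cat.
  have nd : drop (size u1) u <> [::].
    by move=> /(congr1 size)/eqP; rewrite size_drop subn_eq0 leqNgt lt.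
  rewrite E2; apply: wgt_cat; first exact: (standard_gt_suffix su E1).
  apply/negP => /prefixP[x /(congr1 size)]; rewrite size_cat size_drop.
  by case: (u1) n1 lt => [|? ?] //= _; lia.
have E2 : v = drop (size u) u1 ++ u2.
  have := congr1 (drop (size u)) E; rewrite drop_size_cat // drop_cat.
  case: ltnP => // ge' ->; have e : size u = size u1 by apply/eqP; rewrite eqn_leq ge.
  by rewrite e subnn drop0 drop_size.
have [d0|dn] := eqVneq (drop (size u) u1) [::].
  by rewrite d0 /= in E2; rewrite -E2.
apply: wgt_trans uvv _; apply: (standard_gt_suffix sv E2) => //.
exact/eqP.
Qed.

(* Order-preserving on words of length at most D; end of word is the largest
   digit, since a proper beginning is greater. *)
Fixpoint wrank D u : nat :=
  match D, u with
  | D'.+1, i :: u' => ((n.-1 - i) * n.+1 ^ D' + wrank D' u')%N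
  | _, _ => (n.+1 ^ D)%N
  end.

Lemma wrank_bounds D u : (0 < wrank D u <= n.+1 ^ D)%N.
Proof.
elim: D u => [|D IH] [|i u] //=; rewrite ?expn_gt0 ?leqnn //.
have /andP[h1 h2] := IH u; rewrite addn_gt0 h1 orbT /=.
rewrite expnS mulSn addnC leq_add // leq_mul2r; apply/orP; right.
by have := ltn_ord i; lia.
Qed.

Lemma wrank_lt D u v : (size u <= D)%N -> (size v <= D)%N -> wgt u v ->
  (wrank D v < wrank D u)%N.
Proof.
elim: D u v => [|D IH] [|i u] [|j v] //= su sv.
- move=> _; have /andP[_ h2] := wrank_bounds D v.
  have := expn_gt0 n.+1 D; rewrite expnS mulSn; have := ltn_ord j.
  move: h2; move: (_ ^ _)%N (wrank _ _) => K r; nia.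
- case/orP=> [ij|/andP[/eqP<- uv]]; last by rewrite ltn_add2l IH.
  have /andP[_ h2] := wrank_bounds D v; have /andP[h1 _] := wrank_bounds D u.
  have := ltn_ord j; move: h1 h2; move: (_ ^ _)%N (wrank _ _) (wrank _ _) => K r s; nia.
Qed.

End Words.

(** * Uniqueness of the standard bracketing *)

Section Shirshov.
Variable n : nat.
Implicit Types (u v w : word n) (t : naword n).

(** The greatest nonempty suffix exceeds its own proper suffixes, hence is standard. *)
Lemma max_suffix u : u <> [::] ->
  exists p m, [/\ u = p ++ m, standard m &
    forall q s, u = q ++ s -> s <> [::] -> wge m s].
Proof.
elim: u => // i u IH _; have [u0|/eqP/IH[p [m [E sm hm]]]] := eqVneq u [::].
  exists [::], [:: i]; split=> //; first by rewrite u0.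
    by apply: suffix_gt_standard => // -[|j [|? ?]] //= [|? ?].
  move=> [|j q] s /=; rewrite u0; first by move=> <- _; apply: wge_refl.
  by case=> _ /(congr1 size) /=; rewrite size_cat; case: s => //= ? ?; rewrite addnS.
have [le|/wgeN gt] := boolP (wge m (i :: u)).
  exists (i :: p), m; split=> //; first by rewrite E.
  by move=> [|j q] s /= => [<- //|[_]]; apply: hm.
exists [::], (i :: u); split=> //.
  apply: suffix_gt_standard => // -[|j q] s //= [_ e] _ ns.
  exact: wgt_ge_trans gt (hm _ _ e ns).
move=> [|j q] s /= => [<- _|[_ e] ns]; first exact: wge_refl.
exact/wgtW/(wgt_ge_trans gt)/(hm _ _ e ns).
Qed.

Lemma standard_na_erase t : standard_na t -> standard (erase t).
Proof. by case: t => [i|v w] /= /andP[]. Qed.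

Lemma erase_neq0 t : erase t <> [::].
Proof. by elim: t => //= v _ w IH /(congr1 size)/eqP; rewrite size_cat addn_eq0 !size_eq0 => /andP[_ /eqP]. Qed.

Lemma cat_suffix (T : eqType) (p q r s : seq T) : p ++ q = r ++ s ->
  (size s <= size q)%N -> exists2 x, q = x ++ s & r = p ++ x.
Proof.
move=> E le; have lp : (size p <= size r)%N.
  by move: (congr1 size E); rewrite !size_cat => /eqP; lia.
exists (drop (size p) r).
  have := congr1 (drop (size p)) E; rewrite drop_size_cat // drop_cat.
  case: ltnP => // ge ->; have e : size p = size r by apply/eqP; rewrite eqn_leq lp.
  by rewrite e subnn drop0 drop_size.
have := congr1 (take (size p)) E; rewrite take_size_cat // take_cat.
case: ltnP => [_|ge]; first by move=> {1}->; rewrite cat_take_drop.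
have e : size p = size r by apply/eqP; rewrite eqn_leq lp.
by rewrite e subnn take0 cats0 drop_size => ->; rewrite cats0.
Qed.

(* The right factor of a standard bracketing is the longest proper standard
   suffix. *)
Lemma standard_na_longest t1 t2 p s : standard_na (NANode t1 t2) ->
  erase t1 ++ erase t2 = p ++ s -> p <> [::] -> standard s ->
  (size s <= size (erase t2))%N.
Proof.
elim: t1 t2 p s => [i|v1 IH v2 _] t2 p s.
  move=> _ /= E np _; have := congr1 size E; rewrite /= size_cat.
  by case: (p) np => [|? ?] //= _; rewrite addSn => -[->]; rewrite leq_addl.
set t1 := NANode v1 v2 => st E np ss; rewrite leqNgt; apply/negP => lt.
have [q Es Eq] := cat_suffix (esym E) (ltnW lt).
have nq : q <> [::] by move=> q0; rewrite Es q0 ltnn in lt.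
(* Here [s = q t2]. The greatest suffix [m] of [q] is standard, so by induction a suffix of [v2];
   then [t2 >= v2 >= m >= q > s] contradicts [s > t2]. *)
have [r [m [Em sm hm]]] := max_suffix nq.
case/and4P: st => _ st1 st2 w2.
have le : (size m <= size (erase v2))%N.
  by apply: (IH v2 (p ++ r) m); rewrite // -?catA -?Em //; case: (p) np.
have Ev : erase v1 ++ erase v2 = (p ++ r) ++ m by rewrite -catA -Em -Eq.
have [x Ex _] := cat_suffix Ev le.
have v2m : wge (erase v2) m.
  have [x0|/eqP nx] := eqVneq x [::]; first by rewrite Ex x0 wge_refl.
  apply/wgtW/(standard_gt_suffix _ Ex) => //; last exact: standard_neq0.
  by move: st1 => /= /and4P[_ _ /standard_na_erase].
have mq : wge m q by apply: (hm [::]).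
have : wgt (erase t2) s.
  apply: wge_gt_trans w2 _; apply: wge_gt_trans v2m _; apply: wge_gt_trans mq _.
  by rewrite Es; apply/wgt_prefix/erase_neq0.
by apply/negP; rewrite wgtN //; apply: (standard_gt_suffix ss Es) => //; apply: erase_neq0.
Qed.

(** The uniqueness half of Shirshov's theorem: both right factors are the longest proper standard
    suffix of one word. *)
Lemma erase_inj t t' : standard_na t -> standard_na t' -> erase t = erase t' -> t = t'.
Proof.
elim: t t' => [i|v IHv w IHw] [j|v' w'].
- by move=> _ _ [->].
- move=> _ _ /(congr1 size) /=; rewrite size_cat.
  by move: (@erase_neq0 v') (@erase_neq0 w'); case: erase => //= ? ?; case: erase => //= ? ?; lia.
- move=> _ _ /(congr1 size) /=; rewrite size_cat.
  by move: (@erase_neq0 v) (@erase_neq0 w); case: erase => //= ? ?; case: erase => //= ? ?; lia.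
move=> st st' E.
have [sw sw'] : standard (erase w) /\ standard (erase w').
  by move: st st' => /= /and4P[_ _ /standard_na_erase ? _] /and4P[_ _ /standard_na_erase ? _].
have le1 := standard_na_longest st E (@erase_neq0 v') sw'.
have le2 := standard_na_longest st' (esym E) (@erase_neq0 v) sw.
have es : size (erase w) = size (erase w') by apply/eqP; rewrite eqn_leq le1 le2.
have [x Ex1 Ex2] := cat_suffix E le1.
have x0 : x = [::].
  have := congr1 size Ex1; rewrite size_cat es => /eqP.
  by rewrite -[X in X == _]add0n eqn_add2r eq_sym size_eq0 => /eqP.
rewrite x0 cats0 /= in Ex1 Ex2.
move: st st' => /= /and4P[_ ? ? _] /and4P[_ ? ? _].
by rewrite (IHv v') // (IHw w').
Qed.

Lemma sword_inj : injective (@sword n).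
Proof.
move=> [t st] [t' st'] /(erase_inj st st') /= e; move: st'; rewrite -e => st'.
by congr exist; apply: bool_irrelevance.
Qed.

End Shirshov.

(** * Commutators of super-letters *)

Lemma mul_bilinear (k : fieldType) (H : algType k) : is_bilinear (fun x y : H => x * y).
Proof.
by split=> [y|x] c u v /=; rewrite (mulrDl, mulrDr) -(scalerAl, scalerAr).
Qed.

Section Bicharacter.
Variables (k : fieldType) (G : zmodType) (lam : G -> G -> k).
Hypothesis lamP : bicharacter lam.

Lemma bichar0l h : lam 0 h = 1.
Proof.
apply: (mulfI (bichar_neq0 lamP 0 h)).
by rewrite -(bichar_Dl lamP) addr0 mulr1.
Qed.

Lemma bichar0r h : lam h 0 = 1.
Proof.
apply: (mulfI (bichar_neq0 lamP h 0)).
by rewrite -(bichar_Dr lamP) addr0 mulr1.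
Qed.

Variable H : algType k.
Implicit Types x y z : H.

(** The degrees are arguments, so the bracket is defined and linear on all of H, without homogeneity
    assumptions. *)
Definition skew_comm (g h : G) x y : H := x * y - (lam h g)^-1 *: (y * x).

Lemma skew_comm_linear g h x : linear (skew_comm g h x).
Proof.
move=> c y z; rewrite /skew_comm mulrDr mulrDl -scalerAr -scalerAl scalerDr scalerBr.
by rewrite !scalerA [_^-1 * c]mulrC opprD addrACA.
Qed.

(** Bracketing with [x] is a skew derivation: passing [y] costs the scalar of the pair. *)
Lemma skew_commM g h1 h2 x y z :
  skew_comm g (h1 + h2) x (y * z) =
  skew_comm g h1 x y * z + (lam h1 g)^-1 *: (y * skew_comm g h2 x z).
Proof.
rewrite /skew_comm (bichar_Dl lamP) invfM mulrBl mulrBr scalerBr.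
by rewrite -scalerAr -scalerAl scalerA !mulrA addrA subrK.
Qed.

(** The skew Jacobi identity; it trades a bracket with [[x, y]] for brackets with [x] and with
    [y]. *)
Lemma skew_comm_jacobi g1 g2 h x y z :
  skew_comm (g1 + g2) h (skew_comm g1 g2 x y) z =
  skew_comm g1 (g2 + h) x (skew_comm g2 h y z)
  - (lam g2 g1)^-1 *: (y * skew_comm g1 h x z)
  + (lam h g2)^-1 *: (skew_comm g1 h x z * y).
Proof.
rewrite /skew_comm (bichar_Dl lamP) (bichar_Dr lamP) !invfM.
rewrite !mulrBl !mulrBr !scalerBr -!scalerAr -!scalerAl !scalerA !mulrA.
rewrite !opprB [_ / lam g2 g1]mulrC mulrA [_^-1 / lam h g1]mulrC.
rewrite [(lam h g2)^-1 / lam h g1]mulrC [(lam h g1)^-1 / lam g2 g1]mulrC.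
have AC (V : zmodType) (A B C D E F : V) :
    A - B + (C - D) = A - E + (C - F) + (F - B) + (E - D).
  rewrite -(addrA (A - E)) [C - F + _]addrA subrK [RHS]addrAC [A - E + _]addrA subrK.
  by rewrite [RHS]addrAC !addrA [A - B + C]addrAC.
exact: AC.
Qed.

End Bicharacter.

(** * Constitution and degree of super-words *)

Definition flat n (W : superword n) : word n := flatten [seq sword z | z <- W].

(* [perm_eq]-equal words are exactly the words of the same constitution. *)
Definition constit n (c : word n) (Q : pred (word n)) (W : superword n) : bool :=
  perm_eq (flat W) c && all (fun z => Q (sword z)) W.

Section Constitution.
Variables (n : nat).

Lemma flat_cat (W1 W2 : superword n) : flat (W1 ++ W2) = flat W1 ++ flat W2.
Proof. by rewrite /flat map_cat flatten_cat. Qed.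

Lemma constit_cat c1 c2 Q (W1 W2 : superword n) : constit c1 Q W1 -> constit c2 Q W2 ->
  constit (c1 ++ c2) Q (W1 ++ W2).
Proof.
move=> /andP[p1 q1] /andP[p2 q2]; rewrite /constit flat_cat all_cat q1 q2 !andbT.
exact: perm_cat.
Qed.

Lemma sub_constit c c' (Q Q' : pred (word n)) W : perm_eq c c' -> {subset Q <= Q'} ->
  constit c Q W -> constit c' Q' W.
Proof.
move=> cc QQ /andP[p q]; rewrite /constit (perm_trans p cc) /=.
by elim: (W) q => //= z V IH /andP[/QQ q /IH ->]; rewrite andbT; exact: q.
Qed.

Lemma wgrade_cat (G : zmodType) (g : 'I_n -> G) u v :
  wgrade g (u ++ v) = wgrade g u + wgrade g v.
Proof. by rewrite /wgrade big_cat. Qed.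

Lemma wgrade_perm (G : zmodType) (g : 'I_n -> G) u v :
  perm_eq u v -> wgrade g u = wgrade g v.
Proof. by move=> p; rewrite /wgrade (perm_big v). Qed.

Variable d : 'I_n -> nat.

Lemma wdeg_cat u v : wdeg d (u ++ v) = (wdeg d u + wdeg d v)%N.
Proof. by rewrite /wdeg -big_split; apply: eq_bigr => i _; rewrite count_cat mulnDl. Qed.

Lemma wdeg_perm u v : perm_eq u v -> wdeg d u = wdeg d v.
Proof. by move=> /permP p; rewrite /wdeg; apply: eq_bigr => i _; rewrite p. Qed.

Lemma swdeg_flat (W : superword n) : swdeg d W = wdeg d (flat W).
Proof.
elim: W => [|z W IH]; rewrite /swdeg.
  by rewrite big_nil /wdeg big1.
by rewrite big_cons wdeg_cat -IH.
Qed.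

Lemma swdeg_cat (W1 W2 : superword n) : swdeg d (W1 ++ W2) = (swdeg d W1 + swdeg d W2)%N.
Proof. by rewrite /swdeg big_cat. Qed.

Lemma wdeg_size u : (forall i, 0 < d i)%N -> (size u <= wdeg d u)%N.
Proof.
move=> d0; rewrite -count_predT; elim: u => //= i u IH.
rewrite -cat1s wdeg_cat leq_add // /wdeg (bigD1 i) //= eqxx mul1n.
by rewrite (leq_trans (d0 i)) // leq_addr.
Qed.

End Constitution.

Section Superwords.
Variables (k : fieldType) (G : zmodType) (lam : G -> G -> k).
Hypothesis lamP : bicharacter lam.
Variables (H : algType k) (n : nat) (a : 'I_n -> H) (g : 'I_n -> G).

Notation ev := (sl_eval lam a g).
Notation evw := (sw_eval lam a g).
Notation gr := (wgrade g).
Notation comm := (skew_comm lam).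
Implicit Types Q : pred (word n).

Definition swspan (P : superword n -> Prop) : H -> Prop :=
  spanned (fun x => exists2 W, P W & x = evw W).

Lemma evw_cat W1 W2 : evw (W1 ++ W2) = evw W1 * evw W2.
Proof. by rewrite /sw_eval big_cat. Qed.

Lemma evw1 z : evw [:: z] = ev z.
Proof. by rewrite /sw_eval big_seq1. Qed.

Lemma swspan_gen (P : superword n -> Prop) W : P W -> swspan P (evw W).
Proof. by move=> PW; apply: spanned_gen; exists W. Qed.

Lemma sub_swspan (P P' : superword n -> Prop) x : (forall W, P W -> P' W) ->
  swspan P x -> swspan P' x.
Proof. by move=> s; apply: sub_spanned => _ [W /s PW ->]; exists W. Qed.

Lemma swspanM (P1 P2 P : superword n -> Prop) x y :
  (forall W1 W2, P1 W1 -> P2 W2 -> P (W1 ++ W2)) ->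
  swspan P1 x -> swspan P2 y -> swspan P (x * y).
Proof.
move=> h; apply: (spanned_bilinear (mul_bilinear H)) => _ _ [W1 h1 ->] [W2 h2 ->].
by rewrite -evw_cat; apply/swspan_gen/h.
Qed.

Lemma constit_spanM c1 c2 c Q x y : perm_eq (c1 ++ c2) c ->
  swspan (constit c1 Q) x -> swspan (constit c2 Q) y -> swspan (constit c Q) (x * y).
Proof.
move=> p; apply: swspanM => W1 W2 h1 h2.
exact: (sub_constit p _ (constit_cat h1 h2)).
Qed.

Lemma constit_span1 Q z : Q (sword z) -> swspan (constit (sword z) Q) (ev z).
Proof.
by move=> q; rewrite -evw1; apply: swspan_gen; rewrite /constit /flat /= cats0 q perm_refl.
Qed.

(** By the skew derivation rule each term brackets [x] with one letter of [W] and keeps the others,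
    so the kept letters must satisfy [Q] as well. *)
Lemma skew_comm_superword c Q x W :
  all (fun z => `[< swspan (constit (c ++ sword z) Q) (comm (gr c) (gr (sword z)) x (ev z)) >]) W ->
  all (fun z => Q (sword z)) W ->
  swspan (constit (c ++ flat W) Q) (comm (gr c) (gr (flat W)) x (evw W)).
Proof.
elim: W => [_ _|z W IH /= /andP[/asboolP h1 h2] /andP[q1 q2]].
  rewrite /sw_eval big_nil /skew_comm /wgrade [X in lam X _]big_nil (bichar0l lamP).
  by rewrite invr1 scale1r mulr1 mul1r subrr; apply: spanned_zero.
have -> : evw (z :: W) = ev z * evw W by rewrite /sw_eval big_cons.
have -> : flat (z :: W) = sword z ++ flat W by [].
rewrite wgrade_cat (skew_commM lamP); apply: spannedD.
  apply: (constit_spanM _ h1 (c2 := flat W)); first by rewrite -catA.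
  by apply: swspan_gen; rewrite /constit perm_refl.
apply: spannedZ; apply: (constit_spanM _ (constit_span1 q1) (IH h2 q2)).
by rewrite !catA perm_cat2r perm_catC.
Qed.

(* Induction on the length, then downwards on the larger word: for a
   nonstandard bracketing [[u1][u2]],[v] the Jacobi identity produces
   commutators that are shorter or have the greater first entry [u1]. *)
Lemma skew_comm_span (s t : superletter n) : wgt (sword s) (sword t) ->
  swspan (constit (sword s ++ sword t) (wge (sword s ++ sword t)))
    (comm (gr (sword s)) (gr (sword t)) (ev s) (ev t)).
Proof.
have [L] := ubnP (size (sword s ++ sword t)); elim: L s t => // L IHL s t.
(* [wrank L] is bounded by [n.+1 ^ L], so this measure drops when the first entry grows. *)
have [M] := ubnP (n.+1 ^ L - wrank L (sword s)); elim: M s t => // M IHM.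
move=> [s ss] t; rewrite /sword /sl_eval /= -/(sword t) -/(sl_eval lam a g t).
move=> hM hL gt.
have st : standard (sword t) by apply: standard_na_erase (svalP t).
(* Under condition (3) the bracketing of [s] and [t] is itself standard, and the commutator is a
   single super-letter. *)
have base : (match s with NALeaf _ => true | NANode _ v2 => wge (sword t) (erase v2) end) ->
    swspan (constit (erase s ++ sword t) (wge (erase s ++ sword t)))
      (comm (gr (erase s)) (gr (sword t)) (na_eval lam a g s) (ev t)).
  move=> cnd; have sn : standard_na (NANode s (sval t)).
    rewrite /= ss (svalP t) cnd /= !andbT.
    by apply: standard_cat => //; apply: standard_na_erase.
  exact: (@constit_span1 _ (exist _ (NANode s (sval t)) sn) (wge_refl _)).
case: s ss hM hL gt base => [i|s1 s2] ss hM hL gt base; first exact: base.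
have [/base //|{base}] := boolP (wge (sword t) (erase s2)).
move=> /wgeN gt2; rewrite -[erase (NANode s1 s2)]/(erase s1 ++ erase s2) in hM hL gt *.
have su : standard (erase s1 ++ erase s2) by apply: standard_na_erase ss.
have [ss1 ss2] : standard_na s1 /\ standard_na s2 by case/and4P: ss.
pose z1 : superletter n := exist _ s1 ss1; pose z2 : superletter n := exist _ s2 ss2.
have [n1 n2] := (@erase_neq0 _ s1, @erase_neq0 _ s2).
have nt : sword t <> [::] := @erase_neq0 _ (sval t).
set u1 := erase s1 in su gt gt2 hM hL n1 *; set u2 := erase s2 in su gt gt2 hM hL n2 *.
set v := sword t in st gt gt2 hL nt *.
have sz1 : (0 < size u1)%N by case: (u1) n1.
have sz2 : (0 < size u2)%N by case: (u2) n2.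
have u_u2 : wgt (u1 ++ u2) u2 := standard_gt_suffix su erefl n1 n2.
have nb : ~~ prefix u2 (u1 ++ u2) by apply: standard_unbordered su _ n1 n2.
have u1_u : wgt u1 (u1 ++ u2) by apply: wgt_prefix.
have np : ~~ prefix (u1 ++ u2) u2.
  apply/negP => /size_prefix; rewrite size_cat -[X in (_ <= X)%N]add0n leq_add2r.
  by rewrite leqNgt sz1.
have uv_u2 : wgt ((u1 ++ u2) ++ v) u2 by rewrite -[X in wgt _ X]cats0; apply: wgt_cat.
have uv_u2v : wgt ((u1 ++ u2) ++ v) (u2 ++ v) by apply: wgt_cat.
have u2v_v : wgt (u2 ++ v) v.
  by apply: standard_wgt_cat => //; apply: standard_na_erase ss2.
have gt1 : wgt u1 v := wgt_trans u1_u gt.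
have [lt1 lt2] : (size (u1 ++ v) < L)%N /\ (size (u2 ++ v) < L)%N.
  rewrite ltnS in hL; split; apply: leq_trans hL; rewrite !size_cat.
    by rewrite addnAC -addn1 leq_add2l.
  by rewrite -addnA -add1n leq_add2r.
have b1 : swspan (constit (u1 ++ v) (wge ((u1 ++ u2) ++ v)))
    (comm (gr u1) (gr v) (ev z1) (ev t)).
  apply: sub_swspan (IHL z1 t lt1 gt1).
  move=> W; apply: sub_constit => // w; rewrite -!topredE /= => h.
  by apply: wge_trans h; rewrite -catA wge_cat2l; apply: wgtW.
have b2 : swspan (constit (u2 ++ v) (wge (u2 ++ v))) (comm (gr u2) (gr v) (ev z2) (ev t)).
  exact: (IHL z2 t lt2 gt2).
have -> : comm (gr (u1 ++ u2)) (gr v) (na_eval lam a g (NANode s1 s2)) (ev t) =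
    comm (gr u1 + gr u2) (gr v) (comm (gr u1) (gr u2) (ev z1) (ev z2)) (ev t).
  by rewrite wgrade_cat.
rewrite (skew_comm_jacobi lamP); apply: spannedD; first apply: spannedB.
- rewrite -wgrade_cat; apply: (spanned_map _ _ b2); first exact: skew_comm_linear.
  move=> _ [W /andP[pW qW] ->]; rewrite -(wgrade_perm g pW).
  apply: sub_swspan (skew_comm_superword _ _).
  + move=> V; apply: sub_constit; last by move=> w; exact.
    by rewrite -catA perm_cat2l.
  + have szW : all (fun z => size (sword z) <= size (u2 ++ v))%N W.
      rewrite -(perm_size pW); elim: (W) => //= z V IH; rewrite size_cat leq_addr /=.
      by apply: sub_all IH => w /leq_trans; apply; apply: leq_addl.
    elim: (W) qW szW => //= z V IH /andP[qz qV] /andP[sz sV].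
    rewrite IH // andbT; apply/asboolP.
    (* A letter [z] of [[u2, v]] is at most [u2 v], hence below [u1]; the bracket [[u1, z]] has the
       greater first entry [u1] and is no longer than [[u1 u2, v]]. *)
    have gz : wgt u1 (sword z).
      apply: wgt_ge_trans qz; apply: wgt_trans u1_u _.
      by apply: wgt_trans u_u2 _; apply: wgt_prefix.
    have ltM : (n.+1 ^ L - wrank L u1 < M)%N.
      have lt : (wrank L (u1 ++ u2) < wrank L u1)%N.
        apply: wrank_lt => //; rewrite ltnS size_cat in hL; apply: leq_trans hL.
          by rewrite size_cat -addnA leq_addr.
        by rewrite leq_addr.
      have /andP[_ le] := wrank_bounds L u1; move: hM lt le; clear.
      by rewrite -/u1; move: (wrank _ _) (wrank _ _) (_ ^ _)%N => *; lia.
    have leL : (size (u1 ++ sword z) < L.+1)%N by rewrite (leq_ltn_trans _ hL) // size_cat -catA [size (u1 ++ _)]size_cat leq_add2l.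
    apply: sub_swspan (IHM z1 z ltM leL gz).
    move=> V'; apply: sub_constit => // w; rewrite -!topredE /= => h.
    by apply: wge_trans h; rewrite -catA wge_cat2l.
  + by apply: sub_all qW => z; apply: wge_trans; apply: wgtW.
- apply: spannedZ; apply: (constit_spanM _ (constit_span1 _) b1); last exact: wgtW.
  by rewrite -catA perm_catCA.
- apply: spannedZ; apply: (constit_spanM _ b1 (constit_span1 _)); last exact: wgtW.
  by rewrite -!catA perm_cat2l perm_catC.
Qed.

End Superwords.

(** * Coproducts of super-letters *)

Section Tens.
Variables (k : fieldType) (V W : lmodType k).

Lemma tensDl (x y : V) (z : W) : tens (x + y) z = tens x z + tens y z.
Proof. by have := (tens_bilinear V W).1 z 1 x y; rewrite /= !scale1r. Qed.

Lemma tensDr (x : V) (y z : W) : tens x (y + z) = tens x y + tens x z.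
Proof. by have := (tens_bilinear V W).2 x 1 y z; rewrite /= !scale1r. Qed.

Lemma tens0l (z : W) : tens (0 : V) z = 0.
Proof. by apply: (addrI (tens 0 z)); rewrite -tensDl !addr0. Qed.

Lemma tens0r (x : V) : tens x (0 : W) = 0.
Proof. by apply: (addrI (tens x 0)); rewrite -tensDr !addr0. Qed.

Lemma tensZl c (x : V) (z : W) : tens (c *: x) z = c *: tens x z.
Proof. by have := (tens_bilinear V W).1 z c x 0; rewrite /= tens0l !addr0. Qed.

Lemma tensZr c (x : V) (z : W) : tens x (c *: z) = c *: tens x z.
Proof. by have := (tens_bilinear V W).2 x c z 0; rewrite /= tens0r !addr0. Qed.

Lemma tensBl (x y : V) (z : W) : tens (x - y) z = tens x z - tens y z.
Proof. by rewrite tensDl -scaleN1r tensZl scaleN1r. Qed.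

Lemma tensBr (x : V) (y z : W) : tens x (y - z) = tens x y - tens x z.
Proof. by rewrite tensDr -scaleN1r tensZr scaleN1r. Qed.

End Tens.

Section Coproduct.
Variables (k : fieldType) (G : zmodType) (lam : G -> G -> k).
Hypothesis lamP : bicharacter lam.
Variables (H : algType k) (hopf : graded_hopf lam H).
Variables (n : nat) (a : 'I_n -> H) (g : 'I_n -> G).
Hypotheses (a_homog : forall i, hopf (g i) (a i)) (a_prim : forall i, primitive hopf (a i)).

Notation ev := (sl_eval lam a g).
Notation evw := (sw_eval lam a g).
Notation gr := (wgrade g).
Notation comm := (skew_comm lam).
Notation T := (tmul lam hopf).
Notation swspan := (swspan lam a g).
Implicit Types Q : pred (word n).

Definition tspan (P : superword n -> superword n -> Prop) : tensor H H -> Prop :=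
  spanned (fun x => exists W1 W2, P W1 W2 /\ x = tens (evw W1) (evw W2)).

Lemma hopf_lin h c x y : hopf h x -> hopf h y -> hopf h (c *: x + y).
Proof. exact: gpart_lin. Qed.

Lemma na_eval_homog t : hopf (gr (erase t)) (na_eval lam a g t).
Proof.
elim: t => [i|v hv w hw] /=; first by rewrite /wgrade big_seq1.
rewrite wgrade_cat -scaleNr [X in hopf _ X]addrC; apply: hopf_lin; last exact: hgrM.
by rewrite addrC; apply: hgrM.
Qed.

Lemma superword_homog W : hopf (gr (flat W)) (evw W).
Proof.
elim: W => [|z W IH]; first by rewrite /sw_eval /wgrade !big_nil; apply: hgr1.
rewrite /sw_eval big_cons wgrade_cat; apply: hgrM => //; exact: na_eval_homog.
Qed.

Lemma tmul_superword W1 W2 W3 W4 :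
  T (tens (evw W1) (evw W2)) (tens (evw W3) (evw W4)) =
  lam (gr (flat W2)) (gr (flat W3)) *: tens (evw (W1 ++ W3)) (evw (W2 ++ W4)).
Proof. by rewrite !evw_cat; apply: tmul_homog; apply: superword_homog. Qed.

Lemma evw0 : evw [::] = 1.
Proof. by rewrite /sw_eval big_nil. Qed.

Lemma tspan_gen (P : superword n -> superword n -> Prop) W1 W2 :
  P W1 W2 -> tspan P (tens (evw W1) (evw W2)).
Proof. by move=> h; apply: spanned_gen; exists W1, W2. Qed.

Lemma sub_tspan (P P' : superword n -> superword n -> Prop) x :
  (forall W1 W2, P W1 W2 -> P' W1 W2) -> tspan P x -> tspan P' x.
Proof. by move=> s; apply: sub_spanned => _ [W1 [W2 [/s h ->]]]; exists W1, W2. Qed.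

Lemma tspanM (P1 P2 P : superword n -> superword n -> Prop) x y :
  (forall W1 W2 W3 W4, P1 W1 W2 -> P2 W3 W4 -> P (W1 ++ W3) (W2 ++ W4)) ->
  tspan P1 x -> tspan P2 y -> tspan P (T x y).
Proof.
move=> h; apply: (spanned_bilinear (tmul_bilinear lam hopf)).
move=> _ _ [W1 [W2 [h1 ->]]] [W3 [W4 [h2 ->]]].
by rewrite tmul_superword; apply/spannedZ/tspan_gen/h.
Qed.

Definition cop_pair (c : word n) Q (W1 W2 : superword n) : bool :=
  [&& perm_eq (flat W1 ++ flat W2) c, all (fun z => Q (sword z)) W1,
      ~~ nilp W1 & ~~ nilp W2].

(** The nonempty right leg uses up at least one letter of [c]. *)
Lemma cop_pair_size c Q W1 W2 : cop_pair c Q W1 W2 ->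
  all (fun z => size (sword z) < size c)%N W1.
Proof.
case/and4P=> /perm_size <- _ _; rewrite size_cat.
case: W2 => // z2 W2 _; have : (0 < size (flat (z2 :: W2)))%N.
  rewrite /flat /= size_cat; have := @erase_neq0 _ (sval z2).
  by rewrite /sword; case: (erase _).
move: (flat _) => f f0; elim: W1 => //= z W1 IH.
rewrite [flat _]/(sword z ++ flat W1) size_cat; apply/andP; split.
  by rewrite -addnA -addn1 leq_add2l (leq_trans f0) // leq_addl.
by apply: sub_all IH => y /leq_trans; apply; rewrite -addnA leq_addl.
Qed.

(* The left legs stay below [u]: in [J (y (x) 1)] with [u = vw], a left leg
   [z < v] of [J] is shorter than [v], so [z < v] is decided by a letter and
   [z < vw]. *)
Lemma cop_superletter (s : superletter n) :
  tspan (cop_pair (sword s) (wgt (sword s)))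
    (cop hopf (ev s) - (tens (ev s) 1 + tens 1 (ev s))).
Proof.
case: s => t; elim: t => [i|v IHv w IHw] st.
  rewrite /sl_eval /= (a_prim i) subrr; exact: spanned_zero.
have su := standard_na_erase st; rewrite /= in su.
have [sv sw] : standard_na v /\ standard_na w by case/and4P: st.
pose zv : superletter n := exist _ v sv; pose zw : superletter n := exist _ w sw.
have := IHw sw; have := IHv sv; rewrite -/zv -/zw => {IHv IHw} hJ hK.
have [nv nw] := (@erase_neq0 _ v, @erase_neq0 _ w).
change (tspan (cop_pair (sword zv ++ sword zw) (wgt (sword zv ++ sword zw)))
  (cop hopf (comm (gr (sword zv)) (gr (sword zw)) (ev zv) (ev zw)) -
   (tens (comm (gr (sword zv)) (gr (sword zw)) (ev zv) (ev zw)) 1 +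
    tens 1 (comm (gr (sword zv)) (gr (sword zw)) (ev zv) (ev zw))))).
rewrite -[erase v]/(sword zv) -[erase w]/(sword zw) in su nv nw.
move: zv zw su nv nw hJ hK => {v w sv sw st} v w su nv nw.
set x := ev v; set y := ev w; set z := comm _ _ x y; set p := (lam (gr (sword w)) (gr (sword v)))^-1.
have uw : wgt (sword v ++ sword w) (sword w) := standard_gt_suffix su erefl nv nw.
have vu : wgt (sword v) (sword v ++ sword w) by apply: wgt_prefix.
set A1 := tens x 1; set A2 := tens 1 x; set B1 := tens y 1; set B2 := tens 1 y.
set J := _ - (A1 + A2); set K := _ - (B1 + B2) => hJ hK.
pose D X Y := T X Y - p *: T Y X.
have bT := tmul_bilinear lam hopf.
have TDl X X' Y : T (X + X') Y = T X Y + T X' Y.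
  by have := bT.1 Y 1 X X'; rewrite /= !scale1r.
have TDr X X' Y : T Y (X + X') = T Y X + T Y X'.
  by have := bT.2 Y 1 X X'; rewrite /= !scale1r.
have DDl X X' Y : D (X + X') Y = D X Y + D X' Y.
  by rewrite /D TDl TDr scalerDr opprD addrACA.
have DDr X X' Y : D Y (X + X') = D Y X + D Y X'.
  by rewrite /D TDl TDr scalerDr opprD addrACA.
have -> : cop hopf z = D (A1 + A2 + J) (B1 + B2 + K).
  have -> : A1 + A2 + J = cop hopf x by rewrite addrC subrK.
  have -> : B1 + B2 + K = cop hopf y by rewrite addrC subrK.
  by rewrite /z /skew_comm linearB linearZ /= !copM.
have [x1 y1] : A1 = tens (evw [:: v]) (evw [::]) /\ B1 = tens (evw [:: w]) (evw [::]).
  by rewrite !evw1 evw0.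
have [x2 y2] : A2 = tens (evw [::]) (evw [:: v]) /\ B2 = tens (evw [::]) (evw [:: w]).
  by rewrite !evw1 evw0.
have f1 (s : superletter n) : flat [:: s] = sword s by rewrite /flat /= cats0.
have f0 : gr (flat ([::] : superword n)) = 0 by rewrite /wgrade big_nil.
have e11 : D A1 B1 = tens z 1.
  rewrite /D x1 y1 !tmul_superword /= f0 !(bichar0l lamP) !scale1r evw0.
  by rewrite /sw_eval !big_cons big_nil !mulr1 /z /skew_comm -/x -/y -/p tensBl tensZl.
have e22 : D A2 B2 = tens 1 z.
  rewrite /D x2 y2 !tmul_superword /= f0 !(bichar0r lamP) !scale1r evw0.
  by rewrite /sw_eval !big_cons big_nil !mulr1 /z /skew_comm -/x -/y -/p tensBr tensZr.
(* [T B2 A1] is [tens x y] times the scalar inverted by [p]; so the terms with left leg [x], which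
   exceeds [u], cancel. *)
have e12 : D A1 B2 = 0.
  rewrite /D x1 y2 !tmul_superword /= f0 !(bichar0r lamP) scale1r scalerA !f1.
  by rewrite /p mulVf ?bichar_neq0 // scale1r subrr.
clearbody J K.
rewrite !DDl !DDr e11 e22 e12 addr0.
set u := sword v ++ sword w in uw vu su *.
(* The flags say which leg is known to be nonempty; in a product it suffices that one factor
   provides the leg. *)
pose PP b1 b2 c W1 W2 := [&& perm_eq (flat W1 ++ flat W2) c,
  all (fun z => wgt u (sword z)) W1, b1 ==> ~~ nilp W1 & b2 ==> ~~ nilp W2].
have PPM b1 b2 b3 b4 c1 c2 X Y : perm_eq (c1 ++ c2) u -> tspan (PP b1 b2 c1) X ->
    tspan (PP b3 b4 c2) Y -> tspan (PP (b1 || b3) (b2 || b4) u) (T X Y).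
  move=> pc; apply: tspanM => W1 W2 W3 W4 /and4P[p1 q1 r1 s1] /and4P[p2 q2 r2 s2].
  have nc (W W' : superword n) : ~~ nilp (W ++ W') = ~~ nilp W || ~~ nilp W'.
    by case: W.
  apply/and4P; split; last 2 first.
  - by rewrite nc; apply/implyP => /orP[/(implyP r1)|/(implyP r2)] ->; rewrite ?orbT.
  - by rewrite nc; apply/implyP => /orP[/(implyP s1)|/(implyP s2)] ->; rewrite ?orbT.
  - rewrite !flat_cat; apply: perm_trans pc; rewrite perm_catACA.
    exact: perm_cat.
  - by rewrite all_cat q1 q2.
have DS b1 b2 b3 b4 X Y : b1 || b3 -> b2 || b4 -> tspan (PP b1 b2 (sword v)) X ->
    tspan (PP b3 b4 (sword w)) Y -> tspan (PP true true u) (D X Y).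
  move=> h13 h24 hX hY; apply: spannedB.
    by have := PPM _ _ _ _ _ _ _ _ (perm_refl _) hX hY; rewrite h13 h24.
  apply: spannedZ; have := PPM _ _ _ _ _ _ _ _ (_ : perm_eq _ u) hY hX.
  by rewrite orbC h13 orbC h24; apply; rewrite perm_catC.
have hA2 : tspan (PP false true (sword v)) A2.
  by rewrite x2; apply: tspan_gen; rewrite /PP f1 /= perm_refl.
have hB1 : tspan (PP true false (sword w)) B1.
  by rewrite y1; apply: tspan_gen; rewrite /PP f1 cats0 /= uw perm_refl.
have hB2 : tspan (PP false true (sword w)) B2.
  by rewrite y2; apply: tspan_gen; rewrite /PP f1 /= perm_refl.
have hJ' : tspan (PP true true (sword v)) J.
  apply: sub_tspan hJ => W1 W2 h; have := cop_pair_size h.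
  case/and4P: h => p1 q1 r1 s1 sz; apply/and4P; split=> //.
  elim: (W1) q1 sz => //= z' W IH /andP[q1 /IH{}IH] /andP[sz /IH ->]; rewrite andbT.
  rewrite -[sword z']cats0; apply: wgt_cat => //.
  by apply/negP => /size_prefix; rewrite leqNgt sz.
have hK' : tspan (PP true true (sword w)) K.
  apply: sub_tspan hK => W1 W2 /and4P[p1 q1 r1 s1]; apply/and4P; split=> //.
  by apply: sub_all q1 => z'; apply: wgt_trans.
(* Separately the two products keep the left letter [v > u]. Together they form [[v, W1]] in the
   left leg, as the grade of [W2] accounts for the difference of scalars; its letters come from [W1]
   or are at most [v z < v w] with [z] in [W1]. *)
have hA1K : tspan (PP true true u) (D A1 K).
  apply: (spanned_map _ _ hK) => [c X Y /=|_ [W1 [W2 [h ->]]]].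
    rewrite /D; have /= -> := bT.2 A1 c X Y; have /= -> := bT.1 A1 c X Y.
    by rewrite !scalerBr !scalerDr !scalerA [p * c]mulrC opprD addrACA.
  case/and4P: h => p1 q1 r1 s1.
  have -> : D A1 (tens (evw W1) (evw W2)) =
      tens (comm (gr (sword v)) (gr (flat W1)) x (evw W1)) (evw W2).
    rewrite /D x1 !tmul_superword f0 (bichar0l lamP) scale1r scalerA cats0 f1.
    rewrite !evw_cat evw1 -/x /skew_comm tensBl tensZl; congr (_ - _ *: _).
    rewrite /p -(wgrade_perm g p1) wgrade_cat (bichar_Dl lamP) invfM -mulrA.
    by rewrite mulVf ?bichar_neq0 // mulr1.
  have h1 : swspan (constit (sword v ++ flat W1) (wgt u))
      (comm (gr (sword v)) (gr (flat W1)) x (evw W1)).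
    apply: (skew_comm_superword lamP); last by apply: sub_all q1 => z'; apply: wgt_trans.
    apply: sub_all q1 => z' wz; apply/asboolP.
    have vz : wgt (sword v) (sword z') by apply: wgt_trans vu (wgt_trans uw wz).
    apply: sub_swspan (skew_comm_span lamP a g vz) => V.
    apply: sub_constit => // z''; rewrite -!topredE /=; apply: wgt_ge_trans.
    by rewrite /u wgt_cat2l.
  apply: (spanned_map (f := fun t => tens t (evw W2)) _ _ h1) => [c X Y /=|_ [V [hV ->]]].
    by rewrite tensDl tensZl.
  apply: tspan_gen; case/andP: hV => pV qV; apply/and4P; split=> //=.
    rewrite -(perm_cat2r (flat W2)) in pV; apply: perm_trans pV _.
    by rewrite -catA perm_cat2l.
  apply/negP => /nilP V0; move: pV; rewrite V0.
  by rewrite perm_sym => /perm_nilP; case: (sword v) nv.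
have -> (t1 t2 b c e f : tensor H H) :
    t1 + b + (c + t2 + e) + f - (t1 + t2) = b + (c + e) + f.
  by rewrite [c + t2]addrC -(addrA t2) addrACA -(addrA (t1 + t2)) [t1 + t2 + _]addrC addrK.
apply: spannedD; first apply: spannedD => //; last apply: spannedD.
- by apply: spannedD; [apply: DS hA2 hB1 | apply: DS hA2 hK'].
- by apply: spannedD; [apply: DS hJ' hB1 | apply: DS hJ' hB2].
- exact: DS hJ' hK'.
Qed.

End Coproduct.

(** * Hard super-letters *)

Section Hard.
Variables (k : fieldType) (G : zmodType) (lam : G -> G -> k).
Variables (H : algType k) (n : nat) (a : 'I_n -> H) (g : 'I_n -> G) (d : 'I_n -> nat).
Hypothesis d_gt0 : forall i, (0 < d i)%N.

Notation ev := (sl_eval lam a g).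
Notation evw := (sw_eval lam a g).
Implicit Types Q : pred (word n).

Lemma lin_comb_swspan (P : superword n -> Prop) x :
  lin_comb lam a g P x <-> swspan lam a g P x.
Proof.
split=> [[m [c [w [h ->]]]]|].
  by apply: spanned_sum => i _; apply: spannedZ; apply: swspan_gen.
have : swspan lam a g P x -> exists s : seq (k * superword n),
    (forall i, (i < size s)%N -> P (nth (0, [::]) s i).2)
    /\ x = \sum_(p <- s) p.1 *: evw p.2.
  elim=> [|c y z [W PW ->] _ [s [hs ->]]]; first by exists [::]; rewrite big_nil.
  by exists ((c, W) :: s); rewrite big_cons; split=> // -[|i] //= /hs.
move=> h /h[s [hs ->]]; exists (size s), (fun i => (nth (0, [::]) s i).1),
  (fun i => (nth (0, [::]) s i).2); split=> [i|]; first exact: hs.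
by rewrite (big_nth (0, [::])) big_mkord.
Qed.

Variables (N : nat) (X : 'I_N -> superletter n).
Hypothesis X_hard : forall t, hard lam a g d t -> exists i, X i = t.

(** Letters are restricted only in top degree, matching the two kinds of terms in the definition of
    hardness. *)
Definition hard_word m Q (w : seq 'I_N) : bool :=
  (swdeg d (map X w) == m) && all (fun i => Q (sword (X i))) w
  || (swdeg d (map X w) < m)%N.

Definition hspan m Q : H -> Prop :=
  spanned (fun x => exists2 w, hard_word m Q w & x = evw (map X w)).

Lemma hspan_gen m Q w : hard_word m Q w -> hspan m Q (evw (map X w)).
Proof. by move=> h; apply: spanned_gen; exists w. Qed.

Lemma hspanM m1 m2 Q x y : hspan m1 Q x -> hspan m2 Q y -> hspan (m1 + m2) Q (x * y).
Proof.
apply: (spanned_bilinear (mul_bilinear H)) => _ _ [w1 h1 ->] [w2 h2 ->].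
rewrite -evw_cat -map_cat; apply: hspan_gen.
move: h1 h2; rewrite /hard_word map_cat swdeg_cat all_cat.
case/orP=> [/andP[/eqP-> ->]|lt1] /orP[/andP[/eqP-> ->]|lt2]; first by rewrite eqxx.
- by rewrite ltn_add2l lt2 orbT.
- by rewrite ltn_add2r lt1 orbT.
- by rewrite -addnS leq_add ?orbT // ltnW.
Qed.

Lemma sub_hspan m m' Q Q' x : (m < m')%N || (m == m') && `[< {subset Q <= Q'} >] ->
  hspan m Q x -> hspan m' Q' x.
Proof.
move=> h; apply: sub_spanned => _ [w hw ->]; exists w => //; move: hw; rewrite /hard_word.
case/orP: h => [lt|/andP[/eqP<- /asboolP s]].
  by case/orP=> [/andP[/eqP-> _]|/ltn_trans->]; rewrite ?lt ?orbT.
case/orP=> [/andP[-> q]|->]; rewrite ?orbT //=.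
by rewrite (sub_all _ q) // => i /s.
Qed.

Lemma hspan_letters Q W :
  all (fun z => `[< hspan (wdeg d (sword z)) Q (ev z) >]) W -> hspan (swdeg d W) Q (evw W).
Proof.
elim: W => [_|z W IH /= /andP[/asboolP h /IH hW]].
  by apply: (@hspan_gen _ _ [::]); rewrite /hard_word eqxx.
rewrite [evw _]big_cons [swdeg _ _]big_cons; exact: hspanM.
Qed.

(** A letter that is not hard expands into smaller letters or smaller degree: induction on the
    degree, then on the rank. Positive degrees bound the length of the words, so [wrank] orders them
    faithfully. *)
Lemma harden_letter z : hspan (wdeg d (sword z)) (wge (sword z)) (ev z).
Proof.
have [D] := ubnP (wdeg d (sword z)); elim: D z => // D IHD z.
have [M] := ubnP (wrank D.+1 (sword z)); elim: M z => // M IHM z hM hD.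
have [/X_hard[i <-]|/contrapT/lin_comb_swspan] := pselect (hard lam a g d z).
  rewrite -evw1; apply: (@hspan_gen _ _ [:: i]).
  by rewrite /hard_word /swdeg /= big_seq1 eqxx wge_refl.
apply: spanned_trans => _ [W [[dW lW]|dW] ->].
  rewrite -dW; apply: hspan_letters.
  have : all (fun y => wdeg d (sword y) <= wdeg d (sword z))%N W.
    rewrite -dW; elim: (W) => //= y V IH; rewrite [swdeg _ _]big_cons leq_addr /=.
    by apply: sub_all IH => y' /leq_trans; apply; apply: leq_addl.
  elim: (W) lW => //= y V IH /andP[ly lV] /andP[dy dV]; rewrite IH // andbT.
  apply/asboolP; apply: sub_hspan (IHM y _ _).
  - rewrite eqxx orbC; apply/orP; left; apply/asboolP => v; rewrite -!topredE /=.
    by apply: wge_trans; apply: wgtW.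
  - rewrite ltnS in hM; apply: leq_trans hM; apply: wrank_lt ly; apply: leq_trans (wdeg_size _ d_gt0) _.
      exact: ltnW.
    exact: leq_trans dy (ltnW hD).
  - exact: leq_ltn_trans hD.
apply: (sub_hspan (m := swdeg d W) (Q := xpredT)); first by rewrite dW.
apply: hspan_letters.
have : all (fun y => wdeg d (sword y) <= swdeg d W)%N W.
  elim: (W) => //= y V IH; rewrite [swdeg _ _]big_cons leq_addr /=.
  by apply: sub_all IH => y' /leq_trans; apply; apply: leq_addl.
apply: sub_all => y dy; apply/asboolP; apply: sub_hspan (IHD y _).
  by rewrite eqxx orbC; apply/orP; left; apply/asboolP.
exact: leq_ltn_trans dy (leq_trans dW hD).
Qed.

Lemma harden Q W : (forall u v, Q u -> wge u v -> Q v) ->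
  all (fun z => Q (sword z)) W -> hspan (swdeg d W) Q (evw W).
Proof.
move=> Qd qW; apply: hspan_letters; apply: sub_all qW => z qz; apply/asboolP.
apply: sub_hspan (harden_letter z); rewrite eqxx orbC; apply/orP; left.
by apply/asboolP => v; rewrite -!topredE /=; apply: Qd.
Qed.

End Hard.

(** * Leading terms *)

(* Lexicographic comparison of the first [b] values, the last one being the
   most significant. *)
Fixpoint lexn b (f h : nat -> nat) : bool :=
  if b is b'.+1 then (f b' < h b')%N || (f b' == h b') && lexn b' f h else false.

Section Lexn.
Implicit Types f h r : nat -> nat.

Lemma lexn_ext b f f' h h' : (forall i, (i < b)%N -> f i = f' i) ->
  (forall i, (i < b)%N -> h i = h' i) -> lexn b f h = lexn b f' h'.
Proof.
elim: b => //= b IH e1 e2; rewrite e1 // e2 // IH // => i lt.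
- by rewrite e1 // ltnW.
- by rewrite e2 // ltnW.
Qed.

Lemma lexn_irr b f : lexn b f f = false.
Proof. by elim: b => //= b ->; rewrite ltnn eqxx. Qed.

Lemma lexn_trans b h f r : lexn b f h -> lexn b h r -> lexn b f r.
Proof.
elim: b => //= b IH /orP[l1|/andP[/eqP e1 h1]] /orP[l2|/andP[/eqP e2 h2]].
- by rewrite (ltn_trans l1 l2).
- by rewrite -e2 l1.
- by rewrite e1 l2.
- by rewrite e1 e2 eqxx IH ?orbT.
Qed.

Lemma lexn_total b f h :
  [\/ lexn b f h, lexn b h f | forall i, (i < b)%N -> f i = h i].
Proof.
elim: b => [|b IH] /=; first by constructor 3.
case: (ltngtP (f b) (h b)) => [|_|e]; [by constructor 1|by constructor 2|].
case: IH => [||h3]; [by constructor 1|by constructor 2|constructor 3 => i].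
by rewrite ltnS leq_eqVlt => /orP[/eqP->//|]; apply: h3.
Qed.

Lemma lexnD2r b f h r :
  lexn b (fun i => f i + r i)%N (fun i => h i + r i)%N = lexn b f h.
Proof. by elim: b => //= b ->; rewrite ltn_add2r eqn_add2r. Qed.

Lemma lexn_wf b : well_founded (fun f h => lexn b f h).
Proof.
elim: b => [|b IH]; first by move=> f; constructor.
suff h m f : f b = m -> Acc (fun f h => lexn b.+1 f h) f by move=> f; apply: (h (f b)).
elim/ltn_ind: m f => m IHm f; elim/(well_founded_ind IH): f => f IHf hf.
constructor=> h /= /orP[lt|/andP[/eqP e lt]]; first by apply: (IHm (h b)); rewrite // -hf.
by apply: IHf => //; rewrite e.
Qed.

Lemma lexnP b f h : reflect
  (exists2 j, (j < b)%N && (f j < h j)%N & forall i, (j < i < b)%N -> f i = h i)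
  (lexn b f h).
Proof.
apply: (iffP idP).
  elim: b => //= b IH /orP[lt|/andP[/eqP e /IH[j /andP[jb lt] h1]]].
    by exists b; rewrite ?ltnSn // => i /andP[b1 b2]; lia.
  exists j; first by rewrite lt ltnW.
  move=> i; rewrite ltnS [(i <= b)%N]leq_eqVlt andb_orr => /orP[/andP[_ /eqP->]//|].
  exact: h1.
case=> j; elim: b => //= b IH /andP[jb lt] h1.
move: jb; rewrite ltnS leq_eqVlt => /orP[/eqP<-|jb]; first by rewrite lt.
rewrite h1 ?jb ?ltnSn // eqxx IH ?orbT ?jb // => i /andP[h2 h3].
by rewrite h1 // h2 ltnW.
Qed.

End Lexn.

Section Leading.
Variables (k : fieldType) (H : algType k) (N : nat) (x : 'I_N -> H) (dg : 'I_N -> nat).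
Implicit Types (w : seq 'I_N) (y z : H).

Definition xev w : H := \prod_(i <- w) x i.
Definition wd w : nat := \sum_(i <- w) dg i.
(** Slot [N], the most significant one for [klt], holds the degree, slot [i < N] the multiplicity of
    the letter [i]; the order of the letters is forgotten. *)
Definition key w (i : nat) : nat :=
  if i == N then wd w else count (fun j : 'I_N => j == i :> nat) w.
Definition klt w w' : bool := lexn N.+1 (key w) (key w').

Lemma xev_cat w1 w2 : xev (w1 ++ w2) = xev w1 * xev w2.
Proof. by rewrite /xev big_cat. Qed.

Lemma wd_cat w1 w2 : wd (w1 ++ w2) = (wd w1 + wd w2)%N.
Proof. by rewrite /wd big_cat. Qed.

Lemma wd_perm w1 w2 : perm_eq w1 w2 -> wd w1 = wd w2.
Proof. by move=> p; rewrite /wd (perm_big w2). Qed.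

Lemma key_cat w1 w2 i : key (w1 ++ w2) i = (key w1 i + key w2 i)%N.
Proof. by rewrite /key wd_cat count_cat; case: ifP. Qed.

Lemma key_perm w1 w2 : perm_eq w1 w2 -> key w1 =1 key w2.
Proof.
by move=> p i; rewrite /key (wd_perm p); move/permP: p => ->.
Qed.

Lemma klt_trans w2 w1 w3 : klt w1 w2 -> klt w2 w3 -> klt w1 w3.
Proof. exact: lexn_trans. Qed.

Lemma klt_irr w : klt w w = false.
Proof. exact: lexn_irr. Qed.

Lemma klt_perml w1 w1' w2 : perm_eq w1 w1' -> klt w1 w2 = klt w1' w2.
Proof. by move=> p; apply: lexn_ext => // i _; apply: key_perm. Qed.

Lemma klt_permr w1 w2 w2' : perm_eq w2 w2' -> klt w1 w2 = klt w1 w2'.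
Proof. by move=> p; apply: lexn_ext => // i _; apply: key_perm. Qed.

Lemma klt_cat2r w w1 w2 : klt (w1 ++ w) (w2 ++ w) = klt w1 w2.
Proof. by rewrite -[RHS](lexnD2r _ _ _ (key w)); apply: lexn_ext => i _; rewrite key_cat. Qed.

Lemma klt_cat2l w w1 w2 : klt (w ++ w1) (w ++ w2) = klt w1 w2.
Proof.
rewrite (klt_perml _ (permEl (perm_catC w w1))).
by rewrite (klt_permr _ (permEl (perm_catC w w2))) klt_cat2r.
Qed.

Lemma count_val (i : 'I_N) w : count (fun j : 'I_N => j == i :> nat) w = count_mem i w.
Proof. exact: eq_count. Qed.

Lemma klt_total w1 w2 : [\/ klt w1 w2, klt w2 w1 | perm_eq w1 w2].
Proof.
case: (lexn_total N.+1 (key w1) (key w2)) => [||h];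
  [by constructor 1|by constructor 2|constructor 3].
apply/allP => i _ /=; have := h i (ltnW (ltn_ord i)).
by rewrite /key ltn_eqF // !count_val => ->.
Qed.

Lemma klt_wf : well_founded (fun w w' => klt w w').
Proof.
suff h f : Acc (fun f h => lexn N.+1 f h) f -> forall w, key w = f -> Acc (fun w w' => klt w w') w.
  by move=> w; apply: (h _ (lexn_wf N.+1 (key w))).
by elim=> {}f _ IH w e; constructor=> w' lt; apply: (IH (key w')); rewrite // -e.
Qed.

Lemma klt_wd w1 w2 : (wd w1 < wd w2)%N -> klt w1 w2.
Proof. by rewrite /klt /= /key eqxx => ->. Qed.

Lemma klt_le_wd w1 w2 : klt w1 w2 -> (wd w1 <= wd w2)%N.
Proof. by rewrite /klt /= /key eqxx => /orP[/ltnW//|/andP[/eqP->]]. Qed.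

Lemma klt_count w1 w2 (j : 'I_N) : wd w1 = wd w2 ->
  (count_mem j w1 < count_mem j w2)%N ->
  (forall i : 'I_N, (j < i)%N -> count_mem i w1 = count_mem i w2) -> klt w1 w2.
Proof.
move=> ed lt h; apply/lexnP; exists j.
  by rewrite ltnW ?ltnS //= /key ltn_eqF // !count_val.
move=> i /andP[ji]; rewrite ltnS leq_eqVlt /key => /orP[->//|iN].
by rewrite ltn_eqF // !(count_val (Ordinal iN)) h.
Qed.

Definition below w : H -> Prop := spanned (fun y => exists2 w', klt w' w & y = xev w').

Lemma below_gen w w' : klt w' w -> below w (xev w').
Proof. by move=> h; apply: spanned_gen; exists w'. Qed.

Lemma sub_below w w' y : klt w w' -> below w y -> below w' y.
Proof. by move=> h; apply: sub_spanned => _ [w1 h1 ->]; exists w1 => //; apply: klt_trans h. Qed.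

Lemma below_perm w w' y : perm_eq w w' -> below w y -> below w' y.
Proof. by move=> p; apply: sub_spanned => _ [w1 h1 ->]; exists w1; rewrite // -(klt_permr _ p). Qed.

Lemma below_mulr w w' y : below w y -> below (w ++ w') (y * xev w').
Proof.
apply: (spanned_map ((mul_bilinear H).1 _)) => _ [w1 h1 ->].
by rewrite -xev_cat; apply: below_gen; rewrite klt_cat2r.
Qed.

Lemma below_mull w w' y : below w y -> below (w' ++ w) (xev w' * y).
Proof.
apply: (spanned_map ((mul_bilinear H).2 _)) => _ [w1 h1 ->].
by rewrite -xev_cat; apply: below_gen; rewrite klt_cat2l.
Qed.

Lemma belowM w w' y z : below w y -> below w' z -> below (w ++ w') (y * z).
Proof.
apply: (spanned_bilinear (mul_bilinear H)) => _ _ [w1 h1 ->] [w2 h2 ->].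
rewrite -xev_cat; apply: below_gen; apply: (klt_trans (w2 := w1 ++ w')).
  by rewrite klt_cat2l.
by rewrite klt_cat2r.
Qed.

Hypothesis x_swap : forall i j : 'I_N, (i < j)%N ->
  exists2 p, p != 0 & below [:: j; i] (x j * x i - p *: (x i * x j)).

Let proportional w w' := perm_eq w w' /\ exists2 c, c != 0 & below w (xev w - c *: xev w').

Let prop_refl w : proportional w w.
Proof. by split=> //; exists 1; rewrite ?oner_eq0 // scale1r subrr; apply: spanned_zero. Qed.

Let prop_trans w1 w2 w3 : proportional w1 w2 -> proportional w2 w3 -> proportional w1 w3.
Proof.
move=> [p1 [c1 n1 h1]] [p2 [c2 n2 h2]]; split; first exact: perm_trans p1 p2.
exists (c1 * c2); first by rewrite mulf_neq0.
rewrite -scalerA -[X in below _ X](subrKA (c1 *: xev w2)) -scalerBr.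
apply: spannedD => //; apply: spannedZ; apply: below_perm h2.
by rewrite perm_sym.
Qed.

Let prop_cat w w1 w2 : proportional w1 w2 -> proportional (w ++ w1) (w ++ w2).
Proof.
move=> [p [c n h]]; split; first by rewrite perm_cat2l.
by exists c => //; rewrite !xev_cat scalerAr -mulrBr; apply: below_mull.
Qed.

Let prop_swap (i j : 'I_N) w : proportional [:: i, j & w] [:: j, i & w].
Proof.
suff [p [c n h]] : proportional [:: i; j] [:: j; i].
  split; first by rewrite -[_ :: _]/([:: i; j] ++ w) -[X in perm_eq _ X]/([:: j; i] ++ w) perm_cat2r.
  exists c => //; have e (u v : 'I_N) : xev [:: u, v & w] = xev [:: u; v] * xev w.
    by rewrite -xev_cat.
  by rewrite !e scalerAl -mulrBl -[[:: i, j & w]]/([:: i; j] ++ w); apply: below_mulr.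
have p : perm_eq [:: i; j] [:: j; i] by rewrite (perm_catC [:: i] [:: j]).
split=> //; rewrite /xev !big_cons !big_nil !mulr1.
case: (ltngtP i j) => [/x_swap[c n h]|/x_swap[c n h]|/ord_inj->]; last 2 first.
- by exists c.
- by exists 1; rewrite ?oner_eq0 // scale1r subrr; apply: spanned_zero.
exists c^-1; first by rewrite invr_eq0.
rewrite -[X in X - _]scale1r -(mulVf n) -scalerA -scalerBr -opprB; apply/spannedZ/spannedN.
by apply: below_perm h; rewrite perm_sym.
Qed.

(** Adjacent swaps suffice, each costing a nonzero scalar and an error below. *)
Lemma xev_perm w w' : perm_eq w w' -> exists2 c, c != 0 & below w (xev w - c *: xev w').
Proof.
suff: perm_eq w w' -> proportional w w' by move=> h /h[].
elim: w' w => [|i w' IH] w p; first by rewrite (perm_nilP p); apply: prop_refl.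
have iw : i \in w by rewrite (perm_mem p) mem_head.
case/splitPr: iw p => w1 w2 p.
have front : proportional (w1 ++ i :: w2) (i :: w1 ++ w2).
  elim: w1 {p} => [|j w1 IH1] /=; first exact: prop_refl.
  by apply: (prop_trans (prop_cat [:: j] IH1)); apply: prop_swap.
apply: (prop_trans front); apply: (prop_cat [:: i]); apply: IH.
by rewrite -(perm_cons i); apply: perm_trans p; rewrite perm_sym front.1.
Qed.

Definition leading (P : seq 'I_N -> Prop) y :=
  y = 0 \/ exists w c, [/\ P w, c != 0 & below w (y - c *: xev w)].

(** Adding a monomial changes the leading word or, for permuted words, adds coefficients; if these
    cancel, the rest lies below [w1] and [hP] takes over. *)
Let leading_step (P : seq 'I_N -> Prop) :
  (forall w y, P w -> below w y -> leading (fun w' => klt w' w) y) ->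
  (forall w w', P w -> klt w' w -> P w') ->
  forall y, spanned (fun y => exists2 w, P w & y = xev w) y -> leading P y.
Proof.
move=> hP dP y; elim=> [|c _ z [w Pw ->] _ [->|]]; first by left.
  rewrite addr0; have [->|c0] := eqVneq c 0; first by left; rewrite scale0r.
  by right; exists w, c; split=> //; rewrite subrr; apply: spanned_zero.
move=> [w1 [c1 [Pw1 n1 h1]]].
case: (klt_total w w1) => [lt|lt|p]; [right|right|].
- exists w1, c1; split=> //; rewrite -addrA; apply: spannedD h1.
  exact/spannedZ/below_gen.
- have [->|c0] := eqVneq c 0; first by exists w1, c1; rewrite scale0r add0r.
  exists w, c; split=> //; rewrite addrAC subrr add0r -[z](subrK (c1 *: xev w1)).
  by apply: spannedD; [apply: sub_below h1 | apply/spannedZ/below_gen].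
- have [b nb hb] := xev_perm p.
  have hy : below w1 (c *: xev w + z - (c * b + c1) *: xev w1).
    rewrite scalerDl opprD addrACA -scalerA -scalerBr; apply: spannedD h1.
    by apply: spannedZ; apply: below_perm hb.
  have [e|ne] := eqVneq (c * b + c1) 0; last by right; exists w1, (c * b + c1).
  move: hy; rewrite e scale0r subr0 => /(hP _ _ Pw1)[->|[w2 [c2 [lt n2 h2]]]]; first by left.
  by right; exists w2, c2; split=> //; apply: dP lt.
Qed.

Lemma below_leading w y : below w y -> leading (fun w' => klt w' w) y.
Proof.
elim/(well_founded_ind klt_wf): w y => w IH; apply: leading_step => [w1 z h|w1 w2 h1 h2]; first exact: IH.
exact: klt_trans h2 h1.
Qed.

Lemma xev_leading y : spanned (fun y => exists w, y = xev w) y -> leading (fun=> True) y.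
Proof.
move=> h; apply: leading_step => //; first by move=> w z _; apply: below_leading.
by apply: sub_spanned h => _ [w ->]; exists w.
Qed.

(** Passing from a monomial to its preferred arrangement [rep] leaves an error further below,
    removed by well-founded induction. *)
Lemma below_rep (rep : seq 'I_N -> seq 'I_N) w y : (forall w, perm_eq (rep w) w) ->
  below w y -> spanned (fun y => exists2 w', klt w' w & y = xev (rep w')) y.
Proof.
move=> hr; elim/(well_founded_ind klt_wf): w y => w IH y.
apply: spanned_trans => _ [w' lt ->].
have [c _ h] : exists2 c, c != 0 & below w' (xev w' - c *: xev (rep w')).
  by apply: xev_perm; rewrite perm_sym.
apply: (@spannedBE _ _ _ _ (c *: xev (rep w'))).
  by apply: sub_spanned (IH w' lt _ h) => _ [w1 h1 ->]; exists w1 => //; apply: klt_trans lt.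
by apply/spannedZ/spanned_gen; exists w'.
Qed.

Hypothesis x_indep : forall w, ~ below w (xev w).
Hypothesis x_span : forall y, spanned (fun y => exists w, y = xev w) y.

Theorem leading_domain : no_zero_divisors H.
Proof.
move=> y z yz; case: (xev_leading (x_span y)) => [|[w1 [c1 [_ n1 h1]]]]; first by left.
case: (xev_leading (x_span z)) => [|[w2 [c2 [_ n2 h2]]]]; first by right.
case: (@x_indep (w1 ++ w2)); apply: (@spannedZE _ _ _ (c1 * c2)); first by rewrite mulf_neq0.
move: h1 (subrK (c1 *: xev w1) y); move: (y - _) => b1 h1 ey.
move: h2 (subrK (c2 *: xev w2) z); move: (z - _) => b2 h2 ez.
move: yz; rewrite -ey -ez mulrDr !mulrDl -!scalerAl -!scalerAr scalerA -xev_cat addrA.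
move/eqP; rewrite addrC addr_eq0 [c1 * c2]mulrC => /eqP->; apply: spannedN.
apply: spannedD; last by apply: spannedZ; apply: below_mulr.
by apply: spannedD; [apply: belowM | apply: spannedZ; apply: below_mull].
Qed.

End Leading.

(** * Vanishing Gaussian binomials *)

Section Gauss.
Variable k : fieldType.

Lemma expr_pchar_sub1 (R : comNzRingType) l e (z : R) : l \in [pchar R] ->
  (z - 1) ^+ (l ^ e) = z ^+ (l ^ e) - 1.
Proof.
move=> ch; elim: e => [|e IH]; first by rewrite !expr1.
rewrite expnSr !exprM IH -(pFrobenius_autE ch) pFrobenius_autB_comm ?pFrobenius_aut1 //.
exact: commr1.
Qed.

(** Cancel [z - 1] and evaluate at 1: one side becomes 0, the geometric sum becomes [r]. *)
Lemma freshman_natr0 (z : {poly k}) r : z != 1 -> z.[1] = 1 -> (1 < r)%N ->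
  (z - 1) ^+ r = z ^+ r - 1 -> r%:R = 0 :> k.
Proof.
move=> z1 e1; case: r => [|[|r]] // _; rewrite subrX1 exprS => /mulfI.
rewrite subr_eq0 => /(_ z1) /(congr1 (horner^~ 1)).
rewrite horner_exp hornerD hornerN hornerC e1 subrr expr0n horner_sum /=.
rewrite [RHS](eq_bigr (fun=> 1)) => [|i _]; last by rewrite horner_exp e1 expr1n.
by rewrite sumr_const card_ord => <-.
Qed.

(** Write [b] as a power [q] of the characteristic times a coprime [r]. Frobenius gives the same
    identity for [z ^+ q] and [r], and [r > 1] would then make [r] vanish in [k]. *)
Lemma freshman_exponent (z : {poly k}) b : z != 1 -> z.[1] = 1 -> (0 < b)%N ->
  (z - 1) ^+ b = z ^+ b - 1 ->
  b = 1%N \/ exists l e, l \in [pchar k] /\ b = (l ^ e)%N.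
Proof.
move=> z1 e1 b0 E; have [b1|b1] := ltnP 1 b; last first.
  by left; apply/eqP; rewrite eqn_leq b1.
right; have /eqP/(natf0_pchar b0)[l ch] := freshman_natr0 z1 e1 b1 E.
have pl := pcharf_prime ch.
have [r cop eb] := pfactor_coprime pl b0.
exists l, (logn l b); split=> //; rewrite {1}eb.
suff -> : r = 1%N by rewrite mul1n.
have ch' : l \in [pchar {poly k}] by rewrite pchar_poly.
set q := (l ^ logn l b)%N in eb; have r0 : (0 < r)%N by case: (r) eb b0 => // ->.
apply/eqP; rewrite eqn_leq r0 andbT leqNgt; apply/negP => r1.
have zq1 : z ^+ q != 1.
  rewrite -subr_eq0 /q -(expr_pchar_sub1 _ _ ch') expf_eq0 negb_and orbC subr_eq0.
  by rewrite z1.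
have ezq : (z ^+ q).[1] = 1 by rewrite horner_exp e1 expr1n.
have E2 : (z ^+ q - 1) ^+ r = (z ^+ q) ^+ r - 1.
  by rewrite -(expr_pchar_sub1 _ _ ch') -!exprM [(_ * r)%N]mulnC -eb.
have := dvdn_pcharf ch r; rewrite (freshman_natr0 zq1 ezq r1 E2) eqxx.
by move: cop; rewrite prime_coprime // => /negbTE ->.
Qed.

Variable q : k.

(** Gaussian binomials, in the form of Pascal's rule that right multiplication by
    [tens U 1 + tens 1 U] produces. *)
Fixpoint qbin (s r : nat) : k :=
  match s, r with
  | _, 0 => 1
  | 0, _.+1 => 0
  | s'.+1, r'.+1 => qbin s' r' + q ^+ r'.+1 * qbin s' r'.+1
  end.

Lemma qbin0 s : qbin s 0 = 1. Proof. by case: s. Qed.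

Lemma qbin_small s r : (s < r)%N -> qbin s r = 0.
Proof.
by elim: s r => [|s IH] [|r] //= lt; rewrite !IH ?mulr0 ?addr0 // ltnW.
Qed.

Lemma qbinn s : qbin s s = 1.
Proof. by elim: s => //= s ->; rewrite qbin_small // mulr0 addr0. Qed.

(** Gauss's binomial formula, which turns vanishing binomials into an identity of polynomials. *)
Lemma gauss_coef s r : (\prod_(0 <= i < s) ('X - (q ^+ i)%:P))`_r =
  (-1) ^+ (s - r) * q ^+ 'C(s - r, 2) * qbin s r.
Proof.
elim: s r => [|s IH] r.
  by rewrite big_nil coef1; case: r => [|r] /=; rewrite ?mulr0 // !mulr1.
rewrite big_nat_recr //= mulrBr coefB coefMX coefMC !IH.
case: r => [|r] /=.
  rewrite !subn0 qbin0 !mulr1 sub0r binS bin1 exprS exprD; ring.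
rewrite subSS; have [lt|ge] := ltnP r s; last first.
  by rewrite (@qbin_small s r.+1) // mulr0 mul0r subr0 mulr0 addr0.
rewrite -(subnSK lt) binS bin1 exprS exprD mulrDr.
rewrite mulrA.
have -> : q ^+ s = q ^+ (s - r.+1) * q ^+ r.+1 by rewrite -exprD subnK.
ring.
Qed.

(** Only the extreme coefficients of the Gauss product remain, so it is [X^s - 1]. With [m] the
    order of [q] and [s = b m], the same product runs through [b] full periods and is [(X^m - 1)^b];
    equality of the two forms restricts [b]. *)
Lemma qbin_vanish s : (1 < s)%N -> (forall r, (0 < r < s)%N -> qbin s r = 0) ->
  exists m, m.-primitive_root q /\
    (s = m \/ exists l e, l \in [pchar k] /\ s = (m * l ^ e)%N).
Proof.
move=> s1 h; have s0 := ltnW s1; set P := \prod_(0 <= i < s) ('X - (q ^+ i)%:P).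
have EP : P = 'X^s - 1.
  have [c Ec] : exists c, P = 'X^s + c%:P.
    exists P`_0; apply/polyP => r; rewrite coefD coefXn coefC.
    case: r => [|r]; first by rewrite eq_sym (gtn_eqF s0) add0r.
    rewrite addr0 gauss_coef; case: ltngtP => [lt|gt|<-].
    - by rewrite h ?mulr0 // lt.
    - by rewrite qbin_small // mulr0.
    - by rewrite subnn qbinn !mulr1.
  have : P.[1] = 0.
    by rewrite /P big_ltn // hornerM hornerXsubC subrr mul0r.
  rewrite Ec hornerD hornerXn expr1n hornerC => /eqP; rewrite addrC addr_eq0 => /eqP->.
  by rewrite polyCN.
(* The factor [i = 1] is present because [s > 1]. *)
have qs : q ^+ s = 1.
  have : P.[q] = 0.
    by rewrite /P big_ltn // big_ltn // !hornerM !hornerXsubC subrr mul0r mulr0.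
  by rewrite EP hornerD hornerN hornerXn hornerC => /eqP; rewrite subr_eq0 => /eqP.
have [m pm /dvdnP[b eb]] := prim_order_exists s0 qs; exists m; split=> //.
have m0 := prim_order_gt0 pm.
have EPb c : \prod_(0 <= i < c * m) ('X - (q ^+ i)%:P) = ('X^m - 1) ^+ c.
  elim: c => [|c IH]; first by rewrite big_nil.
  rewrite mulSnr (@big_cat_nat _ _ _ (c * m)) ?leq_addr //= IH exprSr; congr (_ * _).
  rewrite -(factor_Xn_sub_1 pm) -{1}[(c * m)%N]add0n big_addn addKn.
  apply: eq_bigr => i _; rewrite exprD [(c * m)%N]mulnC exprM (prim_expr_order pm).
  by rewrite expr1n mulr1.
have b0 : (0 < b)%N by case: (b) eb s0 => // ->.
have := @freshman_exponent 'X^m b _ _ b0 _; case.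
- rewrite -subr_eq0 -size_poly_eq0.
  by rewrite size_XnsubC.
- by rewrite hornerXn expr1n.
- by rewrite -EPb -eb -/P EP -exprM mulnC -eb.
- by move=> b1; left; rewrite eb b1 mul1n.
- by move=> [l [e [ch be]]]; right; exists l, e; rewrite eb be mulnC.
Qed.

End Gauss.

(** By Zorn there is a set [A] maximal with [v] outside the span of [X] and [A]. That span is a
    hyperplane complementary to [v], and [phi] reads off the coefficient along [v]. *)
Lemma separating_functional (k : fieldType) (V : lmodType k) (X : V -> Prop) v :
  ~ spanned X v -> exists phi : V -> k,
    [/\ forall c x y, phi (c *: x + y) = c * phi x + phi y, phi v = 1 &
        forall x, X x -> phi x = 0].
Proof.
move=> Xv; pose S (A : set V) := spanned (fun x => X x \/ A x).
have [A [PA mA]] : exists A : set V, ~ S A v /\ forall B, (A `<` B)%classic -> ~ ~ S B v.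
  apply: Zorn_bigcup => F FP tF h.
  suff [/Xv//|[B FB]] : spanned X v \/ exists2 B, F B & S B v by exact: FP.
  elim: h => [|c x y [Xx|[B FB Bx]] _ [hy|[C FC hy]]].
  - by left; apply: spanned_zero.
  - by left; apply: spanned_cons.
  - by right; exists C => //; apply: spanned_cons => //; left.
  - right; exists B => //; apply: spanned_cons; first by right.
    by apply: sub_spanned hy; left.
  - right; case: (tF _ _ FB FC) => sub.
      by exists C => //; apply: spanned_cons => //; right; apply: sub.
    exists B => //; apply: spanned_cons; first by right.
    by apply: sub_spanned hy => z [|/sub]; [left|right].
have dec y : exists c, S A (y - c *: v).
  have [Ay|nAy] := pselect (S A y); first by exists 0; rewrite scale0r subr0.
  have h : S (fun z => A z \/ z = y) v.
    apply: contrapT; apply: mA; split=> [z|sub]; first by left.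
    by apply: nAy; apply: spanned_gen; right; apply: sub; right.
  suff [c hc] : exists c, S A (v - c *: y).
    have c0 : c != 0 by apply/eqP => c0; move: hc; rewrite c0 scale0r subr0.
    exists c^-1; rewrite -[y]scale1r -(mulVf c0) -scalerA -scalerBr -opprB.
    exact/spannedZ/spannedN.
  elim: h => [|b x z hx _ [c hc]]; first by exists 0; rewrite scale0r subr0; apply: spanned_zero.
  have [hA|->] : (X x \/ A x) \/ x = y by case: hx => [|[]]; tauto.
    by exists c; rewrite -addrA; apply: spanned_cons.
  by exists (b + c); rewrite scalerDl opprD addrACA subrr add0r.
have uniq c c' y : S A (y - c *: v) -> S A (y - c' *: v) -> c = c'.
  move=> h1 h2; apply/eqP; rewrite -subr_eq0; apply/negPn/negP => n0; apply: PA.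
  apply: (spannedZE n0); rewrite scalerBl.
  by have := spannedB h2 h1; rewrite opprB addrC addrA subrK.
have phiP y := projT2 (cid (dec y)).
exists (fun y => projT1 (cid (dec y))); split=> [c x y||x Xx].
- apply: uniq (phiP _) _; rewrite scalerDl opprD addrACA -scalerA -scalerBr.
  by apply: spanned_lin; apply: phiP.
- by apply: uniq (phiP _) _; rewrite scale1r subrr; apply: spanned_zero.
- by apply: uniq (phiP _) _; rewrite scale0r subr0; apply: spanned_gen; left.
Qed.

(** * Independence of hard super-words *)

Lemma has_split (T : Type) (p : pred T) s : has p s ->
  exists s1 z s2, s = s1 ++ z :: s2 /\ p z.
Proof.
elim: s => //= z s IH; have [pz _|_ /= /IH[s1 [y [s2 [-> py]]]]] := boolP (p z).
  by exists [::], z, s.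
by exists (z :: s1), y, s2.
Qed.

(** Heights refer to [pcoef], the inverse of the scalar [q] that occurs in coproducts of powers. *)
Lemma primitive_rootV (k : fieldType) m (z : k) :
  m.-primitive_root z -> m.-primitive_root z^-1.
Proof.
case/andP=> m0 /forallP h; apply/andP; split=> //; apply/forallP => i.
by have := h i; rewrite !unity_rootE exprVn invr_eq1.
Qed.

Section Independence.
Variables (k : fieldType) (G : zmodType) (lam : G -> G -> k).
Hypothesis lamP : bicharacter lam.
Variables (H : algType k) (hopf : graded_hopf lam H).
Variables (n : nat) (a : 'I_n -> H) (g : 'I_n -> G) (d : 'I_n -> nat).
Hypotheses (a_homog : forall i, hopf (g i) (a i)) (a_prim : forall i, primitive hopf (a i)).
Hypothesis d_gt0 : forall i, (0 < d i)%N.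
Variables (N : nat) (X : 'I_N -> superletter n).
Hypothesis X_hard : forall t, hard lam a g d t -> exists i, X i = t.
Hypothesis X_mono : forall i j : 'I_N, (i < j)%N -> slt (X i) (X j).

Notation ev := (sl_eval lam a g).
Notation evw := (sw_eval lam a g).
Notation gr := (wgrade g).
Notation T := (tmul lam hopf).
Notation tspan := (tspan lam a g).
Notation hspan := (hspan lam a g d X).
Notation hard_word := (hard_word d X).

Definition hx (i : 'I_N) : H := ev (X i).
Definition hd (i : 'I_N) : nat := wdeg d (sword (X i)).

Notation xev := (xev hx).
Notation wd := (wd hd).
Notation klt := (klt hd).
Notation below := (below hx hd).
Implicit Types (w V : seq 'I_N) (W : superword n) (i j u : 'I_N).

Lemma xevE w : xev w = evw (map X w).
Proof. by rewrite /sw_eval big_map. Qed.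

Lemma wdE w : wd w = swdeg d (map X w).
Proof. by rewrite /swdeg big_map. Qed.

Lemma sword_gt0 (z : superletter n) : (0 < wdeg d (sword z))%N.
Proof.
apply: leq_trans (wdeg_size _ d_gt0); rewrite /sword.
by have := @erase_neq0 _ (sval z); case: (erase _).
Qed.

Lemma hd_gt0 i : (0 < hd i)%N. Proof. exact: sword_gt0. Qed.

Lemma letter_lt i j : wgt (sword (X j)) (sword (X i)) = (i < j)%N.
Proof.
case: (ltngtP i j) => [/X_mono //|/X_mono/wgtN //|/ord_inj->]; exact: wgtxx.
Qed.

Lemma letter_le i j : wge (sword (X j)) (sword (X i)) = (i <= j)%N.
Proof.
rewrite /wge letter_lt [RHS]leq_eqVlt; congr (_ || _); apply/eqP/eqP => [e|/ord_inj->//].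
by case: (ltngtP i j) => // /X_mono; rewrite /slt e wgtxx.
Qed.

Lemma hard_wordE m Q w :
  hard_word m Q w = (wd w == m) && all (fun i => Q (sword (X i))) w || (wd w < m)%N.
Proof. by rewrite /hard_word -wdE. Qed.

Lemma hard_word_le m Q w : hard_word m Q w ->
  (wd w <= m)%N /\ (wd w = m -> all (fun i => Q (sword (X i))) w).
Proof.
rewrite hard_wordE => /orP[/andP[/eqP-> //]|lt]; split; first exact: ltnW.
by move=> e; rewrite e ltnn in lt.
Qed.

(** All letters of the commutator are at most the concatenated word, hence below its proper
    beginning [X j]. So in top degree [j] no longer occurs and the key drops. *)
Lemma hard_swap i j : (i < j)%N ->
  exists2 p, p != 0 & below [:: j; i] (hx j * hx i - p *: (hx i * hx j)).
Proof.
move=> ij; exists (lam (gr (sword (X i))) (gr (sword (X j))))^-1.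
  by rewrite invr_eq0 bichar_neq0.
apply: spanned_trans (skew_comm_span lamP a g (_ : wgt (sword (X j)) (sword (X i)))); last first.
  by rewrite letter_lt.
move=> _ [W /andP[pW qW] ->].
have cl (v v' : word n) : wge (sword (X j) ++ sword (X i)) v -> wge v v' -> wge (sword (X j) ++ sword (X i)) v'.
  exact: wge_trans.
apply: sub_spanned (harden d_gt0 X_hard cl qW) => _ [w hw ->].
exists w; last by rewrite xevE.
have e : swdeg d W = wd [:: j; i].
  by rewrite swdeg_flat (wdeg_perm d pW) wdeg_cat /wd !big_cons big_nil addn0.
move: hw; rewrite hard_wordE e => /orP[/andP[/eqP ew lw]|]; last exact: klt_wd.
have lt : all (fun l : 'I_N => l < j)%N w.
  apply: sub_all lw => l h; rewrite -letter_lt; apply: wgt_ge_trans h.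
  by apply: wgt_prefix; apply: erase_neq0.
have c0 (l : 'I_N) : (j <= l)%N -> count_mem l w = 0%N.
  move=> jl; apply/count_memPn; apply/negP => /(allP lt).
  by rewrite ltnNge jl.
apply: (@klt_count _ _ _ _ j) => //; first by rewrite c0 //= eqxx.
move=> l jl; rewrite c0 1?ltnW //= -!val_eqE /= (ltn_eqF jl).
by rewrite (ltn_eqF (ltn_trans ij jl)).
Qed.

Lemma klt_maxP w1 w2 : klt w1 w2 -> wd w1 = wd w2 ->
  exists2 j, (count_mem j w1 < count_mem j w2)%N &
    forall i, (j < i)%N -> count_mem i w1 = count_mem i w2.
Proof.
move=> /lexnP[j /andP[]]; rewrite ltnS leq_eqVlt /key => /orP[/eqP->|jN].
  by rewrite eqxx => lt _ e; rewrite e ltnn in lt.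
rewrite (ltn_eqF jN) !(count_val (Ordinal jN)) => lt h _.
exists (Ordinal jN) => // i ji; have := h i; rewrite ji ltnW ?ltnS //=.
by move/(_ isT); rewrite ltn_eqF // !count_val.
Qed.

Lemma klt_letters b w1 w2 : klt w1 w2 -> wd w1 = wd w2 ->
  all (fun i : 'I_N => i < b)%N w2 -> all (fun i : 'I_N => i < b)%N w1.
Proof.
move=> h /(klt_maxP h)[j lt ej] /allP lb; apply/allP => i iw1; rewrite ltnNge; apply/negP => bi.
have c0 (l : 'I_N) : (b <= l)%N -> count_mem l w2 = 0%N.
  by move=> bl; apply/count_memPn; apply/negP => /lb; rewrite ltnNge bl.
have jb : (j < b)%N.
  by rewrite ltnNge; apply/negP => bj; rewrite (c0 j bj) in lt.
have := ej i (leq_trans jb bi); rewrite c0 // => /eqP.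
by rewrite -leqn0 leqNgt -has_count has_pred1 iw1.
Qed.

Lemma count_wd u w : (count_mem u w * hd u <= wd w ?= iff all (pred1 u) w)%N.
Proof.
elim: w => [|i w IH]; first by rewrite mul0n /wd big_nil; apply/leqif_refl.
rewrite /wd big_cons /= mulnDl; apply: leqif_add IH.
have [->|ne] := eqVneq i u; first by rewrite mul1n; apply/leqif_refl.
by rewrite mul0n; split; rewrite ?leq0n //= ltn_eqF // hd_gt0.
Qed.

Definition below_letters u w := [seq i : 'I_N <- w | (i < u)%N].
(** When [u] is the greatest letter this is the shape [V u^s] treated by [contract_top]; greater
    letters are put last to keep a permutation of [w]. *)
Definition topsort u w :=
  below_letters u w ++ nseq (count_mem u w) u ++ [seq i : 'I_N <- w | (u < i)%N].

Lemma topsort_perm u w : perm_eq (topsort u w) w.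
Proof.
elim: w => //= i w IH; rewrite /topsort /below_letters /=.
have [iu|ui|/ord_inj ->] := ltngtP i u.
- have -> /= : (i == u) = false by rewrite -val_eqE ltn_eqF.
  by rewrite perm_cons.
- have -> /= : (i == u) = false by rewrite -val_eqE gtn_eqF.
  by rewrite catA perm_catC /= perm_cons perm_catC -catA.
- rewrite eqxx /= -cat1s perm_catCA /= perm_cons; exact: IH.
Qed.

Lemma topsortE u w : all (fun i : 'I_N => i < u.+1)%N w ->
  topsort u w = below_letters u w ++ nseq (count_mem u w) u.
Proof.
move=> h; rewrite /topsort (_ : [seq i : 'I_N <- w | (u < i)%N] = [::]) ?cats0 //.
apply/eqP; rewrite -size_eq0 size_filter -leqn0 leqNgt -has_count.
by rewrite -all_predC; apply: sub_all h => i; rewrite ltnS /= -leqNgt.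
Qed.

Lemma below_letters_lt u w : all (fun i : 'I_N => i < u)%N (below_letters u w).
Proof. exact: filter_all. Qed.

(* [(phi (x) id) o Delta] for a functional [phi] that is 1 on [u^j] and kills
   everything below [u^j]. *)
Section Contraction.
Variables (u : 'I_N) (j : nat) (phi : H -> k).
Hypothesis phi_lin : forall c y z, phi (c *: y + z) = c * phi y + phi z.
Hypothesis phi_top : phi (xev (nseq j u)) = 1.
Hypothesis phi_below : forall w, klt w (nseq j u) -> phi (xev w) = 0.
Notation U := (X u).
Notation du := (hd u).

Definition tcontract (t : tensor H H) : H := tlift (fun y z => phi y *: z) t.
Definition contract (y : H) : H := tcontract (cop hopf y).

Let phi_bilinear : is_bilinear (fun y z : H => phi y *: z).
Proof.
split=> [z|y] c v w /=; first by rewrite phi_lin scalerDl scalerA.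
by rewrite scalerDr !scalerA mulrC.
Qed.

Lemma tcontract_tens y z : tcontract (tens y z) = phi y *: z.
Proof. exact: tlift_tens. Qed.

Lemma tcontract_linear : linear tcontract.
Proof. exact: tlift_linear. Qed.

Lemma contract_linear : linear contract.
Proof. by move=> c y z; rewrite /contract linearP tcontract_linear. Qed.

Lemma phi_below_span y : below (nseq j u) y -> phi y = 0.
Proof.
have phi0 : phi 0 = 0 by have := phi_lin (-1) 0 0; rewrite scaler0 addr0 mulN1r addNr.
by elim=> [|c _ z [w h ->] _ IH] //; rewrite phi_lin IH phi_below // mulr0 addr0.
Qed.

Lemma wd_nseq s : wd (nseq s u) = (s * du)%N.
Proof. by rewrite /wd big_nseq iter_addn_0 mulnC. Qed.

(** Contraction by [u^j] should lower the degree by [j * du]; these are the elements of even smaller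
    degree. *)
Definition short (m : nat) : H -> Prop := spanned (fun y => exists2 w, (wd w + j * du < m)%N & y = xev w).

Lemma short_superword m W : (swdeg d W + j * du < m)%N -> short m (evw W).
Proof.
move=> lt; have := harden d_gt0 X_hard (Q := xpredT) (fun _ _ _ _ => isT) (all_predT W).
apply: sub_spanned => _ [w hw ->]; exists w; last by rewrite xevE.
move: hw; rewrite hard_wordE => /orP[/andP[/eqP->//]|lt'].
by apply: leq_ltn_trans lt; rewrite leq_add2r ltnW.
Qed.

Lemma superword_below W : (swdeg d W < j * du)%N -> below (nseq j u) (evw W).
Proof.
move=> lt; have := harden d_gt0 X_hard (Q := xpredT) (fun _ _ _ _ => isT) (all_predT W).
apply: sub_spanned => _ [w hw ->]; exists w; last by rewrite xevE.
apply: klt_wd; rewrite wd_nseq; apply: leq_ltn_trans lt.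
by move: hw; rewrite hard_wordE => /orP[/andP[/eqP->]|/ltnW].
Qed.

Definition leU W := all (fun z => wge (sword U) (sword z)) W.
Definition hasltU W := has (fun z => wgt (sword U) (sword z)) W.

(** Hardening the letter below [U] separately keeps in top degree a letter smaller than [u]. All
    letters being at most [u], its multiplicity then stays under [j]. *)
Lemma mixed_below W : leU W -> hasltU W -> (swdeg d W <= j * du)%N ->
  below (nseq j u) (evw W).
Proof.
move=> lW /has_split[W1 [z [W2 [e ltz]]]] dW; move: lW; rewrite e.
rewrite /leU all_cat /= => /and3P[l1 _ l2].
have cle (v v' : word n) : wge (sword U) v -> wge v v' -> wge (sword U) v' by apply: wge_trans.
have clt (v v' : word n) : wgt (sword U) v -> wge v v' -> wgt (sword U) v' by apply: wgt_ge_trans.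
have lz : all (fun z => wgt (sword U) (sword z)) [:: z] by rewrite /= ltz.
have h1 := harden d_gt0 X_hard cle l1; have h2 := harden d_gt0 X_hard cle l2.
have hz := harden d_gt0 X_hard clt lz.
rewrite -cat1s !evw_cat; rewrite e -cat1s !swdeg_cat in dW.
apply: (spanned_bilinear (mul_bilinear H) _ h1 (Y := fun y => exists w2 w3,
  [/\ hard_word (swdeg d [:: z]) (wgt (sword U)) w2,
      hard_word (swdeg d W2) (wge (sword U)) w3 & y = evw (map X (w2 ++ w3))])); last first.
  apply: (spanned_bilinear (mul_bilinear H) _ hz h2) => _ _ [w2 hw2 ->] [w3 hw3 ->].
  by apply: spanned_gen; exists w2, w3; rewrite map_cat evw_cat.
move=> _ _ [w1 hw1 ->] [w2 [w3 [hw2 hw3 ->]]].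
apply: spanned_gen; exists (w1 ++ w2 ++ w3); last by rewrite -!xevE -xev_cat.
have [lt|ge] := ltnP (wd (w1 ++ w2 ++ w3)) (j * du).
  by apply: klt_wd; rewrite wd_nseq.
have [le1 q1] := hard_word_le hw1; have [le2 q2] := hard_word_le hw2.
have [le3 q3] := hard_word_le hw3.
have [e1 e2 e3 ew] : [/\ wd w1 = swdeg d W1, wd w2 = swdeg d [:: z], wd w3 = swdeg d W2
    & wd (w1 ++ w2 ++ w3) = (j * du)%N].
  by move: ge le1 le2 le3 dW; rewrite !wd_cat; clear; split; lia.
have lt2 : all (fun i : 'I_N => i < u)%N w2.
  by apply: sub_all (q2 e2) => i; rewrite letter_lt.
have lw : all (fun i : 'I_N => i <= u)%N (w1 ++ w2 ++ w3).
  rewrite !all_cat; apply/and3P; split.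
  - by apply: sub_all (q1 e1) => i; rewrite letter_le.
  - by apply: sub_all lt2 => i /ltnW.
  - by apply: sub_all (q3 e3) => i; rewrite letter_le.
have ne : ~~ all (pred1 u) (w1 ++ w2 ++ w3).
  rewrite !all_cat !negb_and; apply/orP; right; apply/orP; left.
  move: e2 lt2; rewrite /swdeg big_seq1; case: (w2) => [|i w2' _ /=].
    by rewrite /wd big_nil => e0; have := sword_gt0 z; rewrite -e0.
  by case/andP=> iu _; rewrite -val_eqE ltn_eqF.
have := ltn_leqif (count_wd u (w1 ++ w2 ++ w3)).
rewrite ne ew ltn_mul2r hd_gt0 /= => ltc.
apply: (@klt_count _ _ _ _ u); rewrite ?wd_nseq //.
  by rewrite count_nseq /= eqxx mul1n.
move=> i ui; rewrite count_nseq /= -val_eqE (ltn_eqF ui) mul0n.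
by apply/count_memPn; apply/negP => /(allP lw); rewrite leqNgt ui.
Qed.

(** Error terms, stable under products with [leftU] on either side: a left letter strictly below [U]
    persists. *)
Definition junk (m : nat) W1 W2 : bool :=
  [&& swdeg d W1 + swdeg d W2 == m, leU W1 & hasltU W1]%N.
Definition leftU (m : nat) W1 W2 : bool := (swdeg d W1 + swdeg d W2 == m)%N && leU W1.

Lemma junkMl m1 m2 x y : tspan (junk m1) x -> tspan (leftU m2) y ->
  tspan (junk (m1 + m2)) (T x y).
Proof.
apply: (tspanM a_homog) => W1 W2 W3 W4 /and3P[/eqP e1 l1 h1] /andP[/eqP e2 l2].
by rewrite /junk !swdeg_cat addnACA e1 e2 eqxx /leU /hasltU all_cat has_cat [all _ W1]l1 [all _ W3]l2 [has _ W1]h1.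
Qed.

Lemma junkMr m1 m2 x y : tspan (leftU m1) x -> tspan (junk m2) y ->
  tspan (junk (m1 + m2)) (T x y).
Proof.
apply: (tspanM a_homog) => W1 W2 W3 W4 /andP[/eqP e1 l1] /and3P[/eqP e2 l2 h2].
by rewrite /junk !swdeg_cat addnACA e1 e2 eqxx /leU /hasltU all_cat has_cat [all _ W1]l1 [all _ W3]l2 [has _ W3]h2 orbT.
Qed.

Lemma junk_leftU m x : tspan (junk m) x -> tspan (leftU m) x.
Proof. by apply: sub_tspan => W1 W2 /and3P[e l _]; apply/andP. Qed.

Lemma cop_pair_junk v Q W1 W2 : cop_pair v Q W1 W2 ->
  (forall v, Q v -> wgt (sword U) v) -> junk (wdeg d v) W1 W2.
Proof.
case/and4P=> p q n1 _ h; apply/and3P; split.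
- by rewrite !swdeg_flat -wdeg_cat (wdeg_perm d p).
- by apply: sub_all q => z /h/wgtW.
- by case: W1 q n1 {p} => //= z W1 /andP[/h->].
Qed.

Lemma tens_leftU W1 W2 : leU W1 -> tspan (leftU (swdeg d W1 + swdeg d W2)) (tens (evw W1) (evw W2)).
Proof. by move=> l; apply: tspan_gen; rewrite /leftU eqxx. Qed.

(** For a letter below [u] even [tens (hx i) 1] is an error term, in contrast to [cop_top]. *)
Lemma cop_lt_letter i : (i < u)%N ->
  tspan (junk (hd i)) (cop hopf (hx i) - tens 1 (hx i)).
Proof.
rewrite -letter_lt => iu; have := cop_superletter lamP a_homog a_prim (X i).
rewrite opprD addrA addrAC => h; apply: spannedBE.
  apply: sub_tspan h => W1 W2 /cop_pair_junk; apply => v.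
  exact: wgt_trans.
have -> : tens (ev (X i)) 1 = tens (evw [:: X i]) (evw [::]) by rewrite evw1 evw0.
apply: tspan_gen; rewrite /junk /leU /hasltU /= iu wgtW //.
by rewrite /swdeg big_seq1 big_nil addn0 eqxx.
Qed.

Lemma cop_top : tspan (junk du) (cop hopf (hx u) - (tens (hx u) 1 + tens 1 (hx u))).
Proof.
by apply: sub_tspan (cop_superletter lamP a_homog a_prim U) => W1 W2 /cop_pair_junk; apply.
Qed.

Let TDl t1 t2 t3 : T (t1 + t2) t3 = T t1 t3 + T t2 t3.
Proof. by have /= := (tmul_bilinear lam hopf).1 t3 1 t1 t2; rewrite !scale1r. Qed.
Let TDr t1 t2 t3 : T t3 (t1 + t2) = T t3 t1 + T t3 t2.
Proof. by have /= := (tmul_bilinear lam hopf).2 t3 1 t1 t2; rewrite !scale1r. Qed.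
Let TZl c t1 t2 : T (c *: t1) t2 = c *: T t1 t2.
Proof.
have /= := (tmul_bilinear lam hopf).1 t2 c t1 0; have := TDl 0 0 t2.
by rewrite !addr0 => /(canLR (addrK _)); rewrite subrr => <-; rewrite addr0.
Qed.
Let TZr c t1 t2 : T t2 (c *: t1) = c *: T t2 t1.
Proof.
have /= := (tmul_bilinear lam hopf).2 t2 c t1 0; have := TDr 0 0 t2.
by rewrite !addr0 => /(canLR (addrK _)); rewrite subrr => <-; rewrite addr0.
Qed.

Lemma cop_low w : all (fun i : 'I_N => i < u)%N w ->
  tspan (junk (wd w)) (cop hopf (xev w) - tens 1 (xev w)).
Proof.
elim: w => [_|i w IH /= /andP[iu /IH h2]].
  by rewrite /xev big_nil cop1 subrr; apply: spanned_zero.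
have h1 := cop_lt_letter iu.
have -> : xev (i :: w) = hx i * xev w by rewrite /xev big_cons.
have -> : wd (i :: w) = (hd i + wd w)%N by rewrite /wd big_cons.
have e0 v : tens 1 (xev v) = tens (evw [::]) (evw (map X v)) by rewrite evw0 -xevE.
have l0 v : tspan (leftU (wd v)) (tens 1 (xev v)).
  by rewrite e0 wdE; have := @tens_leftU [::] (map X v) isT; rewrite {1}/swdeg big_nil.
have l1 : tspan (leftU (hd i)) (tens 1 (hx i)).
  by have := l0 [:: i]; rewrite /xev /wd !big_seq1.
have e : T (tens 1 (hx i)) (tens 1 (xev w)) = tens 1 (hx i * xev w).
  have -> : tens 1 (hx i) = tens (evw [::]) (evw [:: X i]) by rewrite evw0 evw1.
  rewrite e0 (tmul_superword a_homog) {2}/wgrade big_nil (bichar0r lamP) scale1r evw0 /=.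
  by rewrite xevE /sw_eval big_cons.
rewrite copM; move: h1 h2; set j1 := _ - tens 1 (hx i); set j2 := _ - tens 1 (xev w) => h1 h2.
rewrite -[cop hopf (hx i)](subrK (tens 1 (hx i))) -[cop hopf (xev w)](subrK (tens 1 (xev w))).
rewrite -/j1 -/j2; clearbody j1 j2; rewrite TDl !TDr e addrA addrK.
apply: spannedD; last exact: junkMr.
by apply: spannedD; [apply: junkMl => //; apply: junk_leftU | apply: junkMl].
Qed.

Notation q := (lam (gr (sword U)) (gr (sword U))).

Lemma gr_nseq c : lam (gr (flat (nseq c U))) (gr (sword U)) = q ^+ c.
Proof.
elim: c => [|c IH]; first by rewrite /wgrade big_nil (bichar0l lamP).
by rewrite [flat _]/(sword U ++ flat (nseq c U)) wgrade_cat (bichar_Dl lamP) IH exprS.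
Qed.

Lemma evw_nseq c : evw (nseq c U) = hx u ^+ c.
Proof. by rewrite /sw_eval big_nseq iter_mulr_1. Qed.

Lemma leU_nseq c : leU (nseq c U).
Proof. by rewrite /leU all_nseq wge_refl orbT. Qed.

Lemma swdeg_nseq c : swdeg d (nseq c U) = (c * du)%N.
Proof. by rewrite /swdeg big_nseq iter_addn_0 mulnC. Qed.

(** The noncommutative binomial theorem for [tens U 1] and [tens 1 U], which commute up to the
    factor [q]. *)
Lemma cop_pow s : tspan (junk (s * du))
  (cop hopf (hx u ^+ s) -
   \sum_(r < s.+1) qbin q s r *: tens (hx u ^+ (s - r)) (hx u ^+ r)).
Proof.
elim: s => [|s IH].
  by rewrite cop1 big_ord1 scale1r subrr; apply: spanned_zero.
rewrite mulSnr exprSr copM; move: IH cop_top.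
set S := \sum_(_ < _) _; set j1 := _ - S; set j2 := _ - _ => h1 h2.
rewrite -[cop hopf (_ ^+ s)](subrK S) -/j1.
rewrite -[cop hopf (hx u)](subrK (tens (hx u) 1 + tens 1 (hx u))) -/j2; clearbody j1 j2.
have lt c c' : tspan (leftU ((c + c') * du)) (tens (hx u ^+ c) (hx u ^+ c')).
  rewrite -!evw_nseq mulnDl -!swdeg_nseq; exact/tens_leftU/leU_nseq.
have l1 : tspan (leftU du) (tens (hx u) 1 + tens 1 (hx u)).
  by apply: spannedD; [have := lt 1%N 0%N | have := lt 0%N 1%N]; rewrite mul1n.
have lS : tspan (leftU (s * du)) S.
  apply: spanned_sum => r _; apply: spannedZ.
  by have := lt (s - r)%N r; rewrite subnK // -ltnS.
have mulU c c' : T (tens (hx u ^+ c) (hx u ^+ c')) (tens (hx u) 1) =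
    q ^+ c' *: tens (hx u ^+ c.+1) (hx u ^+ c').
  have -> : tens (hx u) 1 = tens (evw [:: U]) (evw [::]) by rewrite evw1 evw0.
  rewrite -(evw_nseq c) -(evw_nseq c') (tmul_superword a_homog).
  by rewrite [flat [:: U]]cats0 gr_nseq !evw_cat evw1 evw0 mulr1 !evw_nseq -exprSr.
have mulU' c c' : T (tens (hx u ^+ c) (hx u ^+ c')) (tens 1 (hx u)) =
    tens (hx u ^+ c) (hx u ^+ c'.+1).
  have -> : tens 1 (hx u) = tens (evw [::]) (evw [:: U]) by rewrite evw1 evw0.
  rewrite -(evw_nseq c) -(evw_nseq c') (tmul_superword a_homog).
  rewrite [X in lam _ X]/wgrade big_nil (bichar0r lamP) scale1r.
  by rewrite !evw_cat evw1 evw0 mulr1 !evw_nseq -exprSr.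
set R := \sum_(r < s.+2) _.
have eS : T S (tens (hx u) 1 + tens 1 (hx u)) = R.
  rewrite TDr /S /R.
  have sumT (F : 'I_s.+1 -> tensor H H) t : T (\sum_(r < s.+1) F r) t = \sum_(r < s.+1) T (F r) t.
    elim/big_rec2: _ => [|r t1 t2 _ <-]; last by rewrite TDl.
    by rewrite -(scale0r (0 : tensor H H)) TZl !scale0r.
  rewrite !sumT [RHS]big_ord_recl /= subn0 expr0.
  under eq_bigr do rewrite TZl mulU scalerA.
  under [X in _ + X]eq_bigr do rewrite TZl mulU'.
  rewrite big_ord_recl /= qbin0 mulr1 scale1r subn0 expr0 -addrA; congr (_ + _).
    by rewrite scale1r.
  under [RHS]eq_bigr do rewrite subSS /bump /= add1n scalerDl.
  rewrite [RHS]big_split /= addrC; congr (_ + _).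
  rewrite [RHS]big_ord_recr /= (@qbin_small _ _ _ s.+1) // mulr0 scale0r addr0.
  apply: eq_bigr => r _; rewrite /bump /= add1n mulrC subnSK //.
rewrite TDl (TDr _ _ j1) (TDr j2 _ S) eS addrA addrK.
apply: spannedD; last exact: junkMr.
by apply: spannedD; apply: junkMl => //; apply: junk_leftU.
Qed.

Lemma tcontract0 y z : phi y = 0 -> tcontract (tens y z) = 0.
Proof. by rewrite tcontract_tens => ->; rewrite scale0r. Qed.

(** A left leg of degree at most that of [u^j] is killed by [phi]; a heavier one leaves too light a
    right leg. *)
Lemma contract_junk m t : tspan (junk m) t -> short m (tcontract t).
Proof.
apply: (spanned_map tcontract_linear) => _ [W1 [W2 [/and3P[/eqP e l h] ->]]].
have [le|gt] := leqP (swdeg d W1) (j * du).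
  rewrite tcontract0; first exact: spanned_zero.
  exact/phi_below_span/mixed_below.
rewrite tcontract_tens; apply: spannedZ; apply: short_superword.
by rewrite -e addnC ltn_add2r.
Qed.

Lemma cop_superword W : tspan (fun W1 W2 => swdeg d W1 + swdeg d W2 = swdeg d W)%N (cop hopf (evw W)).
Proof.
elim: W => [|z W IH].
  by rewrite evw0 cop1 -(evw0 lam a g); apply: tspan_gen; rewrite /swdeg big_nil.
rewrite -cat1s evw_cat evw1 copM swdeg_cat.
apply: (tspanM a_homog) (_ : tspan (fun W1 W2 => swdeg d W1 + swdeg d W2 = swdeg d [:: z])%N _) IH.
  by move=> W1 W2 W3 W4 e1 e2; rewrite !swdeg_cat addnACA e1 e2.
apply: spannedBE.
  apply: sub_tspan (cop_superletter lamP a_homog a_prim z) => W1 W2 /and4P[p _ _ _].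
  by rewrite !swdeg_flat -wdeg_cat (wdeg_perm d p) /flat /= cats0.
rewrite -(evw1 lam a g) -(evw0 lam a g); apply: spannedD; apply: tspan_gen.
  by rewrite [swdeg _ [::]]big_nil addn0.
by rewrite [swdeg _ [::]]big_nil.
Qed.

Lemma contract_low m w : (wd w < m)%N -> short m (contract (xev w)).
Proof.
move=> lt; rewrite xevE; apply: (spanned_map tcontract_linear _ (cop_superword (map X w))).
move=> _ [W1 [W2 [e ->]]]; rewrite -wdE in e.
have [lt1|ge] := ltnP (swdeg d W1) (j * du).
  rewrite tcontract0; first exact: spanned_zero.
  exact/phi_below_span/superword_below.
rewrite tcontract_tens; apply: spannedZ; apply: short_superword.
by apply: leq_ltn_trans lt; rewrite -e addnC leq_add2r.
Qed.

Lemma short_below m w : (m <= wd w + j * du)%N -> forall y, short m y -> below w y.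
Proof.
move=> le y; apply: sub_spanned => _ [w' lt ->]; exists w' => //.
by apply: klt_wd; rewrite -(ltn_add2r (j * du)); apply: leq_trans lt le.
Qed.

Lemma xev_pow c : xev (nseq c u) = hx u ^+ c.
Proof. by rewrite /xev big_nseq iter_mulr_1. Qed.

Let phi_pow c : (c < j)%N -> phi (hx u ^+ c) = 0.
Proof.
move=> lt; rewrite -xev_pow; apply: phi_below; apply: klt_wd.
by rewrite !wd_nseq ltn_mul2r hd_gt0.
Qed.

(** Of [cop_pow] only the term with left leg [u^j] counts: [phi] kills lower powers, and higher ones
    leave a short right leg. The scalar [c] comes from moving [u^j] past [V]. *)
Lemma contract_top V s : all (fun i : 'I_N => i < u)%N V ->
  exists2 c, c != 0 & short (wd V + s * du) (contract (xev (V ++ nseq s u)) -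
    (if (j <= s)%N then (c * qbin q s (s - j)) *: xev (V ++ nseq (s - j) u) else 0)).
Proof.
move=> hV; exists (lam (gr (flat (map X V))) (gr (flat (nseq j U)))).
  exact: bichar_neq0.
rewrite xev_cat xev_pow /contract copM; move: (cop_low hV) (cop_pow s).
set S := \sum_(_ < _) _; set j1 := _ - tens _ _; set j2 := _ - S => h1 h2.
rewrite -[cop hopf (xev V)](subrK (tens 1 (xev V))) -/j1.
rewrite -[cop hopf (hx u ^+ s)](subrK S) -/j2; clearbody j1 j2.
have l1 : tspan (leftU (wd V)) (tens 1 (xev V)).
  rewrite xevE -(evw0 lam a g) wdE; have := @tens_leftU [::] (map X V) isT.
  by rewrite {1}/swdeg big_nil.
have lS : tspan (leftU (s * du)) S.
  apply: spanned_sum => r _; apply: spannedZ; rewrite -!evw_nseq.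
  have := @tens_leftU (nseq (s - r) U) (nseq r U) (leU_nseq _).
  by rewrite !swdeg_nseq -mulnDl subnK // -ltnS.
have -> : T (j1 + tens 1 (xev V)) (j2 + S) =
    T (tens 1 (xev V)) S + (T j1 j2 + T j1 S + T (tens 1 (xev V)) j2).
  by rewrite TDl (TDr _ _ j1) (TDr _ _ (tens 1 _)) addrA addrC.
rewrite -[X in tcontract X]scale1r -[T (tens 1 _) S]scale1r.
have -> t1 t2 : tcontract (1 *: (1 *: t1 + t2)) = tcontract t1 + tcontract t2.
  by rewrite !scale1r -[t1]scale1r tcontract_linear !scale1r.
rewrite addrAC; apply: spannedD; last first.
  apply: contract_junk; apply: spannedD; last exact: junkMr.
  by apply: spannedD; apply: junkMl => //; apply: junk_leftU.
set cc := lam _ _; have mulV c c' : T (tens 1 (xev V)) (tens (hx u ^+ c) (hx u ^+ c')) =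
    lam (gr (flat (map X V))) (gr (flat (nseq c U))) *: tens (hx u ^+ c) (xev (V ++ nseq c' u)).
  rewrite -{1}(evw_nseq c) -(evw_nseq c') -{1}(evw0 lam a g) xevE (tmul_superword a_homog).
  by rewrite !evw_cat evw0 mul1r !evw_nseq -xevE xev_cat xev_pow.
have -> : tcontract (T (tens 1 (xev V)) S) = \sum_(r < s.+1)
    (qbin q s r * lam (gr (flat (map X V))) (gr (flat (nseq (s - r) U))) * phi (hx u ^+ (s - r)))
      *: xev (V ++ nseq r u).
  have t0 : tcontract 0 = 0.
    by have := tcontract_linear (-1) 0 0; rewrite scaler0 addr0 scaleN1r addNr.
  rewrite /S; elim/big_rec2: _ => [|r t1 t2 _ <-].
    by rewrite -(scale0r (0 : tensor H H)) TZr !scale0r t0.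
  by rewrite TDr TZr mulV scalerA tcontract_linear tcontract_tens scalerA.
have far r : (s - r < j)%N || (j < s - r)%N -> short (wd V + s * du)
    ((qbin q s r * lam (gr (flat (map X V))) (gr (flat (nseq (s - r) U))) * phi (hx u ^+ (s - r)))
      *: xev (V ++ nseq r u)).
  case/orP=> [lt|gt]; first by rewrite phi_pow // mulr0 scale0r; apply: spanned_zero.
  apply/spannedZ/spanned_gen; exists (V ++ nseq r u) => //.
  rewrite wd_cat wd_nseq -addnA ltn_add2l -mulnDl ltn_mul2r hd_gt0 /=.
  by move: gt; clear; lia.
have [js|sj] := leqP j s; last first.
  rewrite subr0; apply: spanned_sum => r _; apply: far.
  by rewrite (leq_ltn_trans (leq_subr _ _) sj).
have lt : (s - j < s.+1)%N by rewrite ltnS leq_subr.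
rewrite (bigD1 (Ordinal lt)) //= subKn // -xev_pow phi_top mulr1 [qbin _ _ _ * _]mulrC addrAC subrr add0r.
apply: spanned_sum => r; rewrite -val_eqE /= => ne; apply: far.
by move: ne js (ltn_ord r); clear; lia.
Qed.

(** On leading words contraction removes [u^j], which respects the order; [below_rep] first brings
    the smaller words into the shape required by [contract_top]. *)
Lemma contract_below w0 y : all (fun i : 'I_N => i < u.+1)%N w0 -> below w0 y ->
  (j <= count_mem u w0)%N ->
  below (below_letters u w0 ++ nseq (count_mem u w0 - j) u) (contract y).
Proof.
move=> h0 hy js.
have p0 : perm_eq (below_letters u w0 ++ nseq (count_mem u w0) u) w0.
  by rewrite -topsortE // topsort_perm.
have sh m z : (m <= wd w0)%N -> short m z ->
    below (below_letters u w0 ++ nseq (count_mem u w0 - j) u) z.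
  move=> le; apply: short_below; apply: leq_trans le _.
  by rewrite -(wd_perm hd p0) !wd_cat !wd_nseq -addnA -mulnDl subnK.
have := below_rep hard_swap (topsort_perm u) hy.
apply: (spanned_map contract_linear) => _ [w lt ->].
have le := klt_le_wd lt.
have [lw|] := ltnP (wd w) (wd w0).
  apply: (sh (wd w0)) => //; apply: contract_low.
  by rewrite (wd_perm hd (topsort_perm u w)).
move=> ge; have e : wd w = wd w0 by apply/eqP; rewrite eqn_leq le ge.
have hw := klt_letters lt e h0; rewrite topsortE //.
have p : perm_eq (below_letters u w ++ nseq (count_mem u w) u) w.
  by rewrite -topsortE // topsort_perm.
have [c _ hc] := contract_top (count_mem u w) (below_letters_lt u w).
have ew : (wd (below_letters u w) + count_mem u w * du)%N = wd w0.
  by rewrite -e -(wd_perm hd p) wd_cat wd_nseq.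
rewrite ew in hc; apply: (spannedBE (sh _ _ (leqnn _) hc)).
case: ifP => jw; last exact: spanned_zero.
(* Appending [u^j] to both words restores [w] and [w0] up to permutation. *)
apply/spannedZ/below_gen; rewrite -(klt_cat2r _ (nseq j u)) -!catA -!nseqD !subnK //.
by rewrite (klt_perml _ _ p) (klt_permr _ _ p0).
Qed.

End Contraction.

Hypothesis X_sound : forall i, hard lam a g d (X i).
Hypothesis hard_inf : forall t, hard lam a g d t -> height lam a g d t = None.

Lemma below_nil y : below [::] y -> y = 0.
Proof.
elim=> // c x z [w lt _] _ _; case/lexnP: lt => j /andP[_].
by rewrite /key /wd big_nil; case: ifP.
Qed.

Lemma max_letter w : w != [::] -> exists2 u, u \in w & all (fun i : 'I_N => i < u.+1)%N w.
Proof.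
elim: w => // i w IH _; have [->|/IH[u uw hu]] := eqVneq w [::].
  by exists i; rewrite ?mem_head //= ltnSn.
have [iu|ui] := leqP i u; first by exists u; rewrite ?in_cons ?uw ?orbT //= ltnS iu.
exists i; rewrite ?mem_head //= ltnSn; apply: sub_all hu => l; rewrite !ltnS => lu.
exact: leq_trans lu (ltnW ui).
Qed.

Lemma height_None t h : height lam a g d t = None -> ~ height_cond lam a g d t h.
Proof.
rewrite /height; case: pselect => // nex _ hc; apply: nex; exists h.
exact/asboolP.
Qed.

(* The pure-power case: all contractions of [u^s] vanish, so every [qbin q s r]
   does, and the leading terms divisible by [u] can be removed one at a time. *)
Lemma pow_indep u s : (0 < s)%N ->
  (forall w, (wd w < s * hd u)%N -> ~ below w (xev w)) -> ~ below (nseq s u) (xev (nseq s u)).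
Proof.
set q := lam (gr (sword (X u))) (gr (sword (X u))).
move=> s0 IH hb; set y := xev _ in hb.
have hu c : all (fun i : 'I_N => i < u.+1)%N (nseq c u) by rewrite all_nseq /= ltnSn orbT.
have wn c : wd (nseq c u) = (c * hd u)%N by rewrite /wd big_nseq iter_addn_0 mulnC.
(* For [j < s] the power [u^j] has smaller degree and is independent by [IH], so its functional
   exists. *)
have fn (j : nat) : (0 < j < s)%N -> exists phi : H -> k, [/\ forall c y z, phi (c *: y + z) = c * phi y + phi z,
    phi (xev (nseq j u)) = 1 & forall w, klt w (nseq j u) -> phi (xev w) = 0].
  case/andP=> j0 js; have := IH (nseq j u); rewrite wn ltn_mul2r hd_gt0 js => /(_ isT).
  case/separating_functional=> phi [p1 p2 p3]; exists phi; split=> // w lt.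
  by apply: p3; exists w.
have cn c : count_mem u (nseq c u) = c by rewrite count_nseq /= eqxx mul1n.
have bn c : below_letters u (nseq c u) = [::] by rewrite /below_letters filter_nseq ltnn.
(* Contraction by [u^(s - r)] yields a multiple of [qbin q s r] times [u^r], up to shorter terms,
   and by [hb] the result is below [u^r]; a nonzero binomial would make [u^r] dependent. *)
have vanish r : (0 < r < s)%N -> qbin q s r = 0.
  case/andP=> r0 rs; have js : (0 < s - r < s)%N by move: r0 rs; clear; lia.
  have [phi [p1 p2 p3]] := fn _ js.
  have [c c0 hc] := contract_top p1 p2 p3 s (isT : all (fun i : 'I_N => i < u)%N [::]).
  have := contract_below p1 p2 p3 (hu s) hb; rewrite cn bn leq_subr subKn ?(ltnW rs) // => /(_ isT) h2.
  rewrite leq_subr subKn ?(ltnW rs) // in hc; apply/eqP/negPn/negP => nz.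
  apply: (IH (nseq r u)); first by rewrite wn ltn_mul2r hd_gt0 rs.
  apply: (@spannedZE _ _ _ (c * qbin q s r)); first by rewrite mulf_neq0.
  rewrite -[X in spanned _ X]opprK -[- (_ *: _)](addKr (contract phi y)).
  apply: spannedN; apply: spannedD; first exact: spannedN.
  apply: short_below hc; rewrite wn -mulnDl /wd big_nil add0n subnKC // ltnW //.
have low : swspan lam a g (lower_superword d (X u) (s * wdeg d (sword (X u)))%N) (hx u ^+ s).
  have toP w : (wd w < s * hd u)%N || (wd w == s * hd u)%N && all (fun i : 'I_N => i < u)%N w ->
      swspan lam a g (lower_superword d (X u) (s * wdeg d (sword (X u)))%N) (xev w).
    move=> h; rewrite xevE; apply: swspan_gen; rewrite /lower_superword -wdE.
    case/orP: h => [|/andP[/eqP e l]]; [by right|left; split=> //].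
    by rewrite all_map; apply: sub_all l => i; apply: X_mono.
  rewrite -xev_pow -/y.
  (* The leading word [w1] suffices: if it has smaller degree or avoids [u], then every smaller word
     is admissible in [low] too. *)
  case: (below_leading hard_swap hb) => [->|[w1 [c [lt c0 h1]]]]; first exact: spanned_zero.
  have le : (wd w1 <= s * hd u)%N by rewrite -wn; apply: klt_le_wd lt.
  have [lw|ge] := ltnP (wd w1) (s * hd u).
    apply: (spannedBE (y := c *: xev w1)); last by apply: spannedZ; apply: toP; rewrite lw.
    apply: spanned_trans h1 => _ [w' lt' ->]; apply: toP.
    by rewrite (leq_ltn_trans (klt_le_wd lt') lw).
  have ew : wd w1 = (s * hd u)%N by apply/eqP; rewrite eqn_leq le ge.
  have hw1 : all (fun i : 'I_N => i < u.+1)%N w1 by apply: klt_letters lt _ (hu s); rewrite wn.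
  have p1 : perm_eq (below_letters u w1 ++ nseq (count_mem u w1) u) w1.
    by rewrite -topsortE // topsort_perm.
  have [j0|jn0] := eqVneq (count_mem u w1) 0%N.
    have lw1 : all (fun i : 'I_N => i < u)%N w1.
      by rewrite -(perm_all _ p1) j0 cats0 below_letters_lt.
    apply: (spannedBE (y := c *: xev w1)); last by apply: spannedZ; apply: toP; rewrite ew eqxx lw1 orbT.
    apply: spanned_trans h1 => _ [w' lt' ->]; apply: toP.
    have := klt_le_wd lt'; rewrite leq_eqVlt ew => /orP[/eqP e'|->//].
    by rewrite e' eqxx (klt_letters lt' _ lw1) ?orbT // e' ew.
  have js : (count_mem u w1 < s)%N.
    have := ltn_leqif (count_wd u w1); rewrite ew ltn_mul2r hd_gt0 /= => ->.
    apply/negP => /all_pred1P e; move: lt ew; rewrite e wn => lt /eqP.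
    by rewrite eqn_mul2r gtn_eqF ?hd_gt0 //= => /eqP es; rewrite es klt_irr in lt.
  (* A leading word [V u^j] with [0 < j < s] is impossible: contraction by [u^j] sends [u^s] to
     shorter terms, the binomial being 0, which would put a nonzero multiple of [V] below [V]. *)
  set j := count_mem u w1 in p1 jn0 js; set V := below_letters u w1 in p1.
  have jj : (0 < j < s)%N by rewrite lt0n jn0.
  have [phi [q1 q2 q3]] := fn _ jj.
  have wV : (wd V + j * hd u)%N = wd w1 by rewrite -(wd_perm hd p1) wd_cat wn.
  case: (IH V); first by rewrite -ew -wV -[X in (X < _)%N]addn0 ltn_add2l muln_gt0 lt0n jn0 hd_gt0.
  have [b b0 hb1] : exists2 b, b != 0 & below w1 (xev w1 - b *: xev (V ++ nseq j u)).
    by apply: (xev_perm hard_swap); rewrite perm_sym.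
  have h2 : below w1 (y - (c * b) *: xev (V ++ nseq j u)).
    rewrite -[y](subrK (c *: xev w1)) -addrA -scalerA -scalerBr.
    by apply: spannedD => //; apply: spannedZ.
  have [c1 c10 hc1] := contract_top q1 q2 q3 s (isT : all (fun i : 'I_N => i < u)%N [::]).
  have [c2 c20 hc2] := contract_top q1 q2 q3 j (below_letters_lt u w1).
  have := contract_below q1 q2 q3 hw1 h2 (leqnn _); rewrite -/j subnn cats0 -/V => h3.
  rewrite leqnn subnn qbin0 mulr1 cats0 -/V in hc2.
  rewrite (ltnW js) vanish ?mulr0 ?scale0r ?subr0 in hc1; last by move: jj; clear; lia.
  apply: (@spannedZE _ _ _ (c * b * c2)); first by rewrite !mulf_neq0.
  have b1 : below V (contract phi y).
    by apply: short_below hc1; rewrite wV ew /wd big_nil.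
  have b2 : below V (contract phi (xev (V ++ nseq j u)) - c2 *: xev V).
    by apply: short_below hc2; rewrite -/V.
  have cl := contract_linear q1.
  have e3 : contract phi (y - (c * b) *: xev (V ++ nseq j u)) =
      contract phi y - (c * b) *: contract phi (xev (V ++ nseq j u)).
    by rewrite addrC -scaleNr cl scaleNr addrC.
  have b3 : below V ((c * b) *: contract phi (xev (V ++ nseq j u))).
    by have := spannedB b1 h3; rewrite e3 opprB addrC subrK.
  have := spannedB b3 (spannedZ (c * b) b2).
  by rewrite scalerBr scalerA opprB addrC subrK.
(* For [s = 1], [low] contradicts hardness; for [s > 1] it makes [s] satisfy the height
   condition. *)
have [s1|s1] := ltnP 1 s; last first.
  have es : s = 1%N by apply/eqP; rewrite eqn_leq s1.
  apply: (X_sound (i := u)); apply/lin_comb_swspan.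
  by rewrite es expr1 mul1n in low.
have [m [pm hm]] := qbin_vanish s1 vanish.
have /(_ s)[] := height_None (hard_inf (@X_sound u)); split; last exact/lin_comb_swspan.
by exists m; split=> //; apply: primitive_rootV.
Qed.

(** With [u] the greatest letter, [w] rearranges to [V u^s]. If [V] is nonempty, [u^s] has smaller
    degree, and contraction by it turns the relation into one with leading word [V]; otherwise
    [pow_indep] applies. *)
Lemma hard_indep w : ~ below w (xev w).
Proof.
have [m] := ubnP (wd w); elim: m w => // m IH w; rewrite ltnS => wm hb.
have [w0|/max_letter[u uw hu]] := eqVneq w [::].
  by move: hb; rewrite w0 => /below_nil; rewrite /xev big_nil => /eqP; rewrite oner_eq0.
have p : perm_eq (below_letters u w ++ nseq (count_mem u w) u) w.
  by rewrite -topsortE // topsort_perm.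
have s0 : (0 < count_mem u w)%N by rewrite -has_count has_pred1.
set s := count_mem u w in p s0; set V := below_letters u w in p.
have hy : below w (xev (V ++ nseq s u)).
  have [c c0 hc] : exists2 c, c != 0 & below w (xev w - c *: xev (V ++ nseq s u)).
    by apply: (xev_perm hard_swap); rewrite perm_sym.
  apply: (spannedZE c0).
  by have := spannedB hb hc; rewrite opprB addrC subrK.
have wn c : wd (nseq c u) = (c * hd u)%N by rewrite /wd big_nseq iter_addn_0 mulnC.
have wV : (wd V + s * hd u)%N = wd w by rewrite -(wd_perm hd p) wd_cat wn.
have [V0|Vn] := eqVneq V [::].
  rewrite V0 /= in hy p; apply: (pow_indep s0 _ (below_perm _ hy)); last by rewrite perm_sym.
  by move=> v lt; apply: IH; apply: leq_trans lt (leq_trans _ wm); rewrite -wV leq_addl.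
have V1 : (0 < wd V)%N.
  by case: (V) Vn => // i V' _; rewrite /wd big_cons ltn_addr // hd_gt0.
have sm : (wd (nseq s u) < m)%N.
  by apply: leq_trans wm; rewrite wn -wV -[X in (X < _)%N]add0n ltn_add2r.
have [phi [p1 p2 p3]] := separating_functional (IH _ sm).
have p3' v : klt v (nseq s u) -> phi (xev v) = 0 by move=> lt; apply: p3; exists v.
have [c c0 hc] := contract_top p1 p2 p3' s (below_letters_lt u w).
have := contract_below p1 p2 p3' hu hy (leqnn _); rewrite -/s subnn cats0 -/V => h3.
rewrite leqnn subnn qbin0 mulr1 cats0 -/V in hc.
apply: (IH V); first by apply: leq_trans wm; rewrite -wV -[X in (X < _)%N]addn0 ltn_add2l muln_gt0 s0 hd_gt0.
apply: (spannedZE c0); have b2 := short_below (leqnn _) hc.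
by have := spannedB h3 b2; rewrite opprB addrC subrK.
Qed.

End Independence.

(** * Ore condition from polynomial growth *)

Lemma poly_lt_exp c N : exists m, ((c * m).+1 ^ N < 2 ^ m)%N.
Proof.
(* With [m = N.+1 * p] the product [c * m] is [A * p], and [A * p + 1] stays under [(2A + 2)^2],
   itself at most [2^p]; raising to the power [N.+1] gives [2^m]. *)
pose A := (c * N.+1)%N; pose p := (2 * (2 * A).+1)%N.
exists (N.+1 * p)%N; have -> : (2 ^ (N.+1 * p) = (2 ^ p) ^ N.+1)%N by rewrite -expnM mulnC.
have lt : ((c * (N.+1 * p)).+1 < 2 ^ p)%N.
  rewrite mulnA -/A {2}/p mulnC [(2 * (2 * A).+1)%N]mulnC expnM.
  have h : ((2 * A).+1 < 2 ^ (2 * A).+1)%N by apply: ltn_expl.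
  apply: (@leq_trans ((2 * A).+2 ^ 2)); last by rewrite leq_exp2r.
  by rewrite /p; nia.
apply: (@leq_ltn_trans ((c * (N.+1 * p)).+1 ^ N.+1)); last by rewrite ltn_exp2r.
exact: leq_pexp2l.
Qed.

Section LinearDependence.
Variables (k : fieldType) (V : lmodType k) (E T : finType) (f : E -> V) (v : T -> V).

Lemma spanned_fin y : spanned (fun y => exists e, y = f e) y ->
  exists c : E -> k, y = \sum_e c e *: f e.
Proof.
elim=> [|b _ z [e ->] _ [c ->]].
  by exists (fun=> 0); rewrite big1 // => e _; rewrite scale0r.
exists (fun e' => (if e' == e then b else 0) + c e').
under [RHS]eq_bigr do rewrite scalerDl.
rewrite big_split; congr (_ + _); rewrite (bigD1 e) //= eqxx big1 ?addr0 //.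
by move=> e' /negPf ->; rewrite scale0r.
Qed.

Lemma linear_dependence : (#|E| < #|T|)%N ->
  (forall t, spanned (fun y => exists e, y = f e) (v t)) ->
  exists r : T -> k, \sum_t r t *: v t = 0 /\ exists t, r t != 0.
Proof.
move=> lt /(_ _)/spanned_fin sp; pose c t := projT1 (cid (sp t)).
have vE t : v t = \sum_e c t e *: f e := projT2 (cid (sp t)).
pose A := \matrix_(i < #|T|, j < #|E|) c (enum_val i) (enum_val j).
have /rowV0Pn[r /sub_kermxP rA r0] : kermx A != 0.
  by rewrite -mxrank_eq0 mxrank_ker subn_eq0 -ltnNge (leq_ltn_trans (rank_leq_col A)).
exists (fun t => r 0 (enum_rank t)); split.
  under eq_bigr do rewrite vE scaler_sumr.
  rewrite exchange_big big1 // => e _ /=.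
  under eq_bigr do rewrite scalerA.
  rewrite -scaler_suml (_ : \sum_t _ = (r *m A) 0 (enum_rank e)).
    by rewrite rA mxE scale0r.
  rewrite mxE (reindex (@enum_val T T)) /=; last by apply: onW_bij; apply: enum_val_bij.
  by apply: eq_bigr => i _; rewrite mxE enum_valK enum_rankK.
have /rV0Pn[i ri] := r0; exists (enum_val i); by rewrite enum_valK.
Qed.

End LinearDependence.

Section Growth.
Variables (k : fieldType) (H : algType k) (N : nat) (x : 'I_N -> H) (dg : 'I_N -> nat).
Hypothesis dg_gt0 : forall i, (0 < dg i)%N.
Hypothesis x_swap : forall i j : 'I_N, (i < j)%N ->
  exists2 p, p != 0 & below x dg [:: j; i] (x j * x i - p *: (x i * x j)).
Notation xev := (xev x).
Notation wd := (wd dg).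

Definition deg_le (m : nat) : H -> Prop := spanned (fun y => exists2 w, (wd w <= m)%N & y = xev w).

Definition monomial (e : 'I_N -> nat) : seq 'I_N := flatten [seq nseq (e i) i | i <- enum 'I_N].

Lemma monomial_perm w : perm_eq (monomial (fun i => count_mem i w)) w.
Proof.
apply/allP => i _ /=; apply/eqP; rewrite /monomial count_flatten -map_comp sumnE big_map.
rewrite (eq_bigr (fun l => if l == i then count_mem i w else 0%N)) => [|l _ /=].
  by rewrite -big_mkcond big_enum_cond /= big_pred1_eq.
by rewrite count_nseq /=; case: eqP => [->|_]; rewrite ?mul1n.
Qed.

Lemma size_wd w : (size w <= wd w)%N.
Proof.
elim: w => // i w IH; rewrite /wd big_cons /= -add1n leq_add //; exact: dg_gt0.
Qed.

(** Ordered monomials suffice by [below_rep], and the degree bounds each exponent, so the dimension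
    is at most [m.+1 ^ N]. *)
Lemma deg_le_monomials m y : deg_le m y ->
  spanned (fun y => exists e : {ffun 'I_N -> 'I_m.+1}, y = xev (monomial (fun i => e i))) y.
Proof.
have mon w : (wd w <= m)%N -> exists e : {ffun 'I_N -> 'I_m.+1},
    xev (monomial (fun i => count_mem i w)) = xev (monomial (fun i => e i)).
  move=> wm; exists [ffun i => inord (count_mem i w)]; congr (xev (flatten _)).
  apply: eq_map => i; rewrite ffunE inordK // ltnS.
  exact: leq_trans (count_size _ _) (leq_trans (size_wd w) wm).
apply: spanned_trans => _ [w wm ->].
have [c c0 h] : exists2 c, c != 0 & below x dg w (xev w -
    c *: xev (monomial (fun i => count_mem i w))).
  by apply: (xev_perm x_swap); rewrite perm_sym monomial_perm.
apply: (spannedBE (y := c *: xev (monomial (fun i => count_mem i w)))); last first.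
  by apply/spannedZ/spanned_gen; apply: mon.
apply: sub_spanned (below_rep x_swap monomial_perm h) => _ [w' lt ->].
by apply: mon; apply: leq_trans (klt_le_wd lt) wm.
Qed.

Lemma deg_leM m1 m2 y z : deg_le m1 y -> deg_le m2 z -> deg_le (m1 + m2) (y * z).
Proof.
apply: (spanned_bilinear (mul_bilinear H)) => _ _ [w1 h1 ->] [w2 h2 ->].
rewrite -xev_cat; apply: spanned_gen; exists (w1 ++ w2) => //.
by rewrite wd_cat leq_add.
Qed.

(** Abstract maps in place of multiplications: left and right multiplications give the two Ore
    conditions. *)
Section TwoMaps.
Variables (L : bool -> H -> H) (c : nat).
Hypothesis L_lin : forall b, linear (L b).
Hypothesis L_inj : forall b, injective (L b).
Hypothesis L_deg : forall b m y, deg_le m y -> deg_le (c + m) (L b y).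

Let L0 b : L b 0 = 0.
Proof. by have := L_lin b (-1) 0 0; rewrite scaler0 addr0 scaleN1r addNr. Qed.

Let iterL (t : seq bool) : H := foldr (fun b y => L b y) 1 t.

Let iterL_deg t : deg_le (c * size t) (iterL t).
Proof.
elim: t => [|b t IH] /=; last by rewrite mulnS; apply: L_deg.
apply: spanned_gen; exists [::]; first by rewrite /wd big_nil.
by rewrite /xev big_nil.
Qed.

Let sum_cons m (F : m.+1.-tuple bool -> H) :
  \sum_t F t = \sum_(b : bool) \sum_(t : m.-tuple bool) F (cons_tuple b t).
Proof.
rewrite pair_bigA /=.
rewrite (reindex (fun p : bool * m.-tuple bool => cons_tuple p.1 p.2)) //=.
exists (fun t => (thead t, [tuple of behead t])) => [[b t] _|t _] /=.
  by congr pair; apply: val_inj.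
by rewrite [RHS]tuple_eta; apply: val_inj.
Qed.

(* If the two images met only in 0, the [2^m] products of length [m] would be
   independent inside a space whose dimension is polynomial in [m]. *)
Lemma images_meet : exists y z, L true y = L false z /\ L true y != 0.
Proof.
apply: contrapT => nex.
have meet y z : L true y = L false z -> y = 0 /\ z = 0.
  move=> e; have y0 : L true y = 0 by apply: contrapT => /eqP nz; apply: nex; exists y, z.
  by split; [apply: (L_inj (b := true)) | apply: (L_inj (b := false))]; rewrite L0 // -e.
(* Splitting by the first letter puts the two halves of a relation in the two images; both halves
   vanish by [meet], and induction applies to their preimages. *)
have free m (r : m.-tuple bool -> k) :
    \sum_t r t *: iterL t = 0 -> forall t, r t = 0.
  elim: m r => [|m IH] r.
    rewrite (big_pred1 [tuple]) => [|t]; last by rewrite /= [t]tuple0; apply/esym/eqP.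
    by move=> /eqP; rewrite scaler_eq0 oner_eq0 orbF => /eqP r0 t; rewrite [t]tuple0.
  rewrite sum_cons big_bool /=.
  have lin b : \sum_(t : m.-tuple bool) r (cons_tuple b t) *: L b (iterL t) =
      L b (\sum_(t : m.-tuple bool) r (cons_tuple b t) *: iterL t).
    by elim/big_rec2: _ => [|t y1 y2 _ ->]; rewrite ?L0 ?L_lin.
  rewrite !lin => /eqP; rewrite addr_eq0 -scaleN1r -[_ *: _]addr0 -[X in _ + X](L0 false) -L_lin addr0 scaleN1r => /eqP/meet[/IH h1 /eqP].
  rewrite oppr_eq0 => /eqP/IH h2 t; rewrite (tuple_eta t).
  by case: (thead t); [rewrite -(h1 [tuple of behead t]) | rewrite -(h2 [tuple of behead t])];
    congr (r _); apply: val_inj.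
have [m ltm] := poly_lt_exp c N.
have [||r [r0 [t rt]]] := @linear_dependence _ _ {ffun 'I_N -> 'I_(c * m).+1} (m.-tuple bool)
  (fun e => xev (monomial (fun i => e i))) iterL.
- by rewrite card_ffun !card_ord card_tuple card_bool.
- move=> t; apply: deg_le_monomials; rewrite -{1}(size_tuple t); exact: iterL_deg.
by rewrite (free m r r0 t) eqxx in rt.
Qed.

End TwoMaps.
End Growth.

(** * Ore localization *)

Record ore_domain := OreDomain {
  ore_ring :> nzRingType;
  ore_dom : no_zero_divisors ore_ring;
  ore_right : forall x y : ore_ring, x != 0 -> y != 0 ->
    exists z t, x * z = y * t /\ x * z != 0 }.

Section OreFractions.
Variable R : ore_domain.
Implicit Types x y z b c r s : R.

(* The fraction [q] is encoded by the graph of its left multiplication,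
   [q x y <-> y = q x], on those [x] in [R] for which [q x] lies in [R]. *)
Record fraction_graph (q : R -> R -> Prop) : Prop := FractionGraph {
  graphD : forall x y x' y', q x y -> q x' y' -> q (x + x') (y + y');
  graphM : forall x y r, q x y -> q (x * r) (y * r);
  graph_fun : forall y, q 0 y -> y = 0;
  graph_dom : exists b a, b != 0 /\ q b a;
  graph_sat : forall x y r, r != 0 -> q (x * r) (y * r) -> q x y }.

Lemma ore_mulf_neq0 x y : x != 0 -> y != 0 -> x * y != 0.
Proof.
move=> x0 y0; apply/eqP => /(@ore_dom R)[] /eqP; first by rewrite (negPf x0).
by rewrite (negPf y0).
Qed.

Lemma ore_mulf_eq0l x r : r != 0 -> x * r = 0 -> x = 0.
Proof. by move=> r0 /(@ore_dom R)[] // /eqP; rewrite (negPf r0). Qed.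

Lemma ore_rightW x y : x != 0 -> y != 0 -> exists z t, [/\ x * z = y * t, z != 0 & t != 0].
Proof.
move=> x0 y0; have [z [t [e n]]] := ore_right x0 y0; exists z, t; split=> //.
  by apply/eqP => z0; rewrite z0 mulr0 eqxx in n.
by apply/eqP => t0; rewrite e t0 mulr0 eqxx in n.
Qed.

Section Graph.
Variable q : R -> R -> Prop.
Hypothesis qP : fraction_graph q.

Lemma graphN x y : q x y -> q (- x) (- y).
Proof. by move=> h; rewrite -mulrN1 -[- y]mulrN1; apply: (graphM qP). Qed.

Lemma graph0 : q 0 0.
Proof. by have [b [a [_ /(graphM qP 0)]]] := graph_dom qP; rewrite !mulr0. Qed.

Lemma graph_unique x y y' : q x y -> q x y' -> y = y'.
Proof.
move=> h h'; apply/eqP; rewrite -subr_eq0; apply/eqP/(graph_fun qP).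
by rewrite -(subrr x); apply: (graphD qP) => //; apply: graphN.
Qed.

Lemma graph_extend z : exists r w, r != 0 /\ q (z * r) w.
Proof.
have [b [a [b0 h]]] := graph_dom qP; have [->|z0] := eqVneq z 0.
  by exists 1, 0; rewrite oner_eq0 mul0r; split=> //; apply: graph0.
have [r [s [e r0 _]]] := ore_rightW z0 b0; exists r, (a * s).
by rewrite e; split=> //; apply: (graphM qP).
Qed.

End Graph.

(** The graph of [a b^-1]: [x = b s r^-1] and [y = a s r^-1], with [r] cleared. *)
Definition ratio_graph a b x y := exists r s, [/\ r != 0, x * r = b * s & y * r = a * s].

Lemma ratio_graphP a b : b != 0 -> fraction_graph (ratio_graph a b).
Proof.
move=> b0; split.
- move=> x y x' y' [r [s [r0 e1 e2]]] [r' [s' [r0' e1' e2']]].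
  have [z [t [e z0 _]]] := ore_rightW r0 r0'.
  exists (r * z), (s * z + s' * t); split; first exact: ore_mulf_neq0.
    by rewrite mulrDl {2}e !mulrA e1 e1' mulrDr !mulrA.
  by rewrite mulrDl {2}e !mulrA e2 e2' mulrDr !mulrA.
- move=> x y c [r [s [r0 e1 e2]]]; have [->|c0] := eqVneq c 0.
    by exists 1, 0; rewrite oner_eq0 !mulr0 !mul0r.
  have [z [t [e z0 _]]] := ore_rightW c0 r0; exists z, (s * t); split=> //.
    by rewrite -mulrA e mulrA e1 mulrA.
  by rewrite -mulrA e mulrA e2 mulrA.
- move=> y [r [s [r0]]]; rewrite mul0r => /esym/(@ore_dom R)[/eqP|s0].
    by rewrite (negPf b0).
  by rewrite s0 mulr0; apply: ore_mulf_eq0l.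
- by exists b, a; split=> //; exists 1, 1; rewrite oner_eq0.
- move=> x y c c0 [r [s [r0 e1 e2]]]; exists (c * r), s; rewrite !mulrA; split=> //.
  exact: ore_mulf_neq0.
Qed.

Lemma ratio_graph_id a b : ratio_graph a b b a.
Proof. by exists 1, 1; rewrite oner_eq0. Qed.

Definition fraction := {q : R -> R -> Prop | fraction_graph q}.
Definition graph_of (q : fraction) : R -> R -> Prop := sval q.
Local Coercion graph_of : fraction >-> Funclass.
Implicit Types q : fraction.

Lemma graph_ofP q : fraction_graph q. Proof. exact: svalP. Qed.
Hint Resolve graph_ofP : core.

(** Saturation makes a graph as large as possible, so one point with nonzero first coordinate
    determines it; the ring laws are then checked at one common denominator. *)
Lemma fraction_eq b a q q' : b != 0 -> q b a -> q' b a -> q = q'.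
Proof.
suff sub (p p' : fraction) x y : b != 0 -> p b a -> p' b a -> p x y -> p' x y.
  move=> b0 h h'; have e : graph_of q = graph_of q'.
    apply/funext => x; apply/funext => y; apply/propext; split; exact: sub.
  case: q q' e {h h'} => [q qP] [q' q'P] /= e; move: q'P; rewrite -e => q'P.
  by congr exist; apply: Prop_irrelevance.
move=> b0 h h' hx; have [e|x0] := eqVneq x 0.
  rewrite e in hx *; rewrite (graph_fun (graph_ofP p) hx); exact: graph0.
have [r [s [e r0 s0]]] := ore_rightW x0 b0.
apply: (graph_sat (graph_ofP p') r0); have hr := graphM (graph_ofP p) r hx.
rewrite e in hr *; rewrite (graph_unique (graph_ofP p) hr (graphM (graph_ofP p) s h)).
exact: graphM.
Qed.

Definition ratio a b (b0 : b != 0) : fraction := exist _ _ (ratio_graphP a b0).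

Lemma ratio_id a b (b0 : b != 0) : ratio a b0 b a.
Proof. exact: ratio_graph_id. Qed.

HB.instance Definition _ := gen_eqMixin fraction.
HB.instance Definition _ := gen_choiceMixin fraction.

Lemma common2 q1 q2 : exists b a1 a2, [/\ b != 0, q1 b a1 & q2 b a2].
Proof.
have [b [a [b0 h]]] := graph_dom (graph_ofP q1).
have [r [w [r0 h2]]] := graph_extend (graph_ofP q2) b.
by exists (b * r), (a * r), w; split=> //; [apply: ore_mulf_neq0 | apply: graphM].
Qed.

Lemma common3 q1 q2 q3 : exists b a1 a2 a3, [/\ b != 0, q1 b a1, q2 b a2 & q3 b a3].
Proof.
have [b [a1 [a2 [b0 h1 h2]]]] := common2 q1 q2.
have [r [w [r0 h3]]] := graph_extend (graph_ofP q3) b.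
by exists (b * r), (a1 * r), (a2 * r), w; split; rewrite ?ore_mulf_neq0 //; apply: graphM.
Qed.

Lemma chain2 q1 q2 : exists b a c, [/\ b != 0, q2 b a & q1 a c].
Proof.
have [b [a [b0 h]]] := graph_dom (graph_ofP q2).
have [r [w [r0 h2]]] := graph_extend (graph_ofP q1) a.
by exists (b * r), (a * r), w; split; rewrite ?ore_mulf_neq0 //; apply: graphM.
Qed.

(** The sum is built at one common denominator [d]; the Ore condition compares any other one with
    [d]. *)
Definition addq_ex q1 q2 : exists q, forall b a1 a2, b != 0 -> q1 b a1 -> q2 b a2 ->
  graph_of q b (a1 + a2).
Proof.
have [d [c1 [c2 [d0 k1 k2]]]] := common2 q1 q2; exists (ratio (c1 + c2) d0).
move=> b a1 a2 b0 h1 h2; have [r [s [e r0 _]]] := ore_rightW b0 d0; exists r, s; split=> //.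
rewrite !mulrDl; congr (_ + _).
  by apply: (graph_unique (graph_ofP q1) (x := b * r)); [|rewrite e]; apply: graphM.
by apply: (graph_unique (graph_ofP q2) (x := b * r)); [|rewrite e]; apply: graphM.
Qed.

Definition mulq_ex q1 q2 : exists q, forall b a c, b != 0 -> q2 b a -> q1 a c ->
  graph_of q b c.
Proof.
have [d [a' [c' [d0 k2 k1]]]] := chain2 q1 q2; exists (ratio c' d0).
move=> b a c b0 h2 h1; have [r [s [e r0 _]]] := ore_rightW b0 d0; exists r, s; split=> //.
have ea : a * r = a' * s.
  by apply: (graph_unique (graph_ofP q2) (x := b * r)); [|rewrite e]; apply: graphM.
by apply: (graph_unique (graph_ofP q1) (x := a * r)); [|rewrite ea]; apply: graphM.
Qed.

Definition addq q1 q2 := projT1 (cid (addq_ex q1 q2)).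
Definition mulq q1 q2 := projT1 (cid (mulq_ex q1 q2)).
Definition embed x : fraction := ratio x (oner_neq0 R).

Lemma addqP q1 q2 b a1 a2 : b != 0 -> q1 b a1 -> q2 b a2 -> addq q1 q2 b (a1 + a2).
Proof. exact: (projT2 (cid (addq_ex q1 q2))). Qed.

Lemma mulqP q1 q2 b a c : b != 0 -> q2 b a -> q1 a c -> mulq q1 q2 b c.
Proof. exact: (projT2 (cid (mulq_ex q1 q2))). Qed.

Lemma embedP x z : embed x z (x * z).
Proof. by exists 1, z; rewrite oner_eq0 !mulr1 mul1r. Qed.

Lemma embed_at1 x : embed x 1 x.
Proof. exact: ratio_id. Qed.

Lemma embed0P z : embed 0 z 0.
Proof. by rewrite -{2}(mul0r z); apply: embedP. Qed.

Lemma embed1P z : embed 1 z z.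
Proof. by rewrite -{2}(mul1r z); apply: embedP. Qed.

Definition oppq q := mulq (embed (-1)) q.

Lemma oppqP q b a : b != 0 -> q b a -> oppq q b (- a).
Proof. by move=> b0 h; apply: mulqP h _ => //; rewrite -[- a]mulN1r; apply: embedP. Qed.

Lemma addqA : associative addq.
Proof.
move=> q1 q2 q3; have [b [a1 [a2 [a3 [b0 h1 h2 h3]]]]] := common3 q1 q2 q3.
apply: (@fraction_eq b (a1 + (a2 + a3)) _ _ b0); first by do 2?apply: addqP.
by rewrite addrA; do 2?apply: addqP.
Qed.

Lemma addqC : commutative addq.
Proof.
move=> q1 q2; have [b [a1 [a2 [b0 h1 h2]]]] := common2 q1 q2.
apply: (@fraction_eq b (a1 + a2) _ _ b0); first exact: addqP.
by rewrite addrC; apply: addqP.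
Qed.

Lemma add0q : left_id (embed 0) addq.
Proof.
move=> q; have [b [a [b0 h]]] := graph_dom (graph_ofP q).
by apply: (@fraction_eq b a _ _ b0) => //; rewrite -[a]add0r; apply: addqP => //; apply: embed0P.
Qed.

Lemma addNq : left_inverse (embed 0) oppq addq.
Proof.
move=> q; have [b [a [b0 h]]] := graph_dom (graph_ofP q).
apply: (@fraction_eq b 0 _ _ b0); last exact: embed0P.
by rewrite -(addNr a); apply: addqP => //; apply: oppqP.
Qed.

HB.instance Definition _ := GRing.isZmodule.Build fraction addqA addqC add0q addNq.

Lemma mulqA : associative mulq.
Proof.
move=> q1 q2 q3; have [b [a [c [b0 h3 h2]]]] := chain2 q2 q3.
have [r [w [r0 h1]]] := graph_extend (graph_ofP q1) c.
have br0 := ore_mulf_neq0 b0 r0.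
have h3' := graphM (graph_ofP q3) r h3; have h2' := graphM (graph_ofP q2) r h2.
(* [mulqP] evaluates only at nonzero arguments, so the value 0 of [q3] is treated apart. *)
have [a0|ar0] := eqVneq (a * r) 0.
  have c0 : c * r = 0 by apply: (graph_fun (graph_ofP q2)); rewrite -a0.
  have w0 : w = 0 by apply: (graph_fun (graph_ofP q1)); rewrite -c0.
  apply: (@fraction_eq (b * r) w _ _ br0).
    by apply: (mulqP br0 _ h1); apply: mulqP h3' h2'.
  apply: (mulqP br0 h3'); rewrite a0 w0; exact: graph0.
apply: (@fraction_eq (b * r) w _ _ br0).
  by apply: (mulqP br0 _ h1); apply: mulqP h3' h2'.
by apply: (mulqP br0 h3'); apply: mulqP h2' h1.
Qed.

Lemma mul1q : left_id (embed 1) mulq.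
Proof.
move=> q; have [b [a [b0 h]]] := graph_dom (graph_ofP q).
by apply: (@fraction_eq b a _ _ b0) => //; apply: mulqP h _ => //; apply: embed1P.
Qed.

Lemma mulq1 : right_id (embed 1) mulq.
Proof.
move=> q; have [b [a [b0 h]]] := graph_dom (graph_ofP q).
by apply: (@fraction_eq b a _ _ b0) => //; apply: mulqP h => //; apply: embed1P.
Qed.

Lemma addq_graph q1 q2 b a1 a2 : q1 b a1 -> q2 b a2 -> addq q1 q2 b (a1 + a2).
Proof.
have [->|b0] := eqVneq b 0; last exact: addqP.
by move=> /(graph_fun (graph_ofP q1))-> /(graph_fun (graph_ofP q2))->; rewrite addr0; apply: graph0.
Qed.

Lemma mulqDl : left_distributive mulq addq.
Proof.
move=> q1 q2 q3; have [b [a [c1 [b0 h3 h1]]]] := chain2 q1 q3.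
have [r [c2 [r0 h2]]] := graph_extend (graph_ofP q2) a.
have br0 := ore_mulf_neq0 b0 r0; have h3' := graphM (graph_ofP q3) r h3.
have h1' := graphM (graph_ofP q1) r h1.
apply: (@fraction_eq (b * r) (c1 * r + c2) _ _ br0).
  by apply: (mulqP br0 h3'); apply: addq_graph.
by apply: addq_graph; apply: (mulqP br0 h3').
Qed.

Lemma mulqDr : right_distributive mulq addq.
Proof.
move=> q1 q2 q3; have [b [a2 [a3 [b0 h2 h3]]]] := common2 q2 q3.
have [r [c2 [r0 h12]]] := graph_extend (graph_ofP q1) a2.
have [s [c3 [s0 h13]]] := graph_extend (graph_ofP q1) (a3 * r).
have b0' : b * r * s != 0 by rewrite !ore_mulf_neq0.
have k2 := graphM (graph_ofP q2) s (graphM (graph_ofP q2) r h2).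
have k3 := graphM (graph_ofP q3) s (graphM (graph_ofP q3) r h3).
have k12 := graphM (graph_ofP q1) s h12.
apply: (@fraction_eq (b * r * s) (c2 * s + c3) _ _ b0').
  by apply: (mulqP b0' (addq_graph k2 k3)); apply: graphD.
by apply: addq_graph; [apply: (mulqP b0' k2) | apply: (mulqP b0' k3)].
Qed.

Lemma oneq_neq0 : embed 1 != 0.
Proof.
apply/eqP => e; have := embed0P 1; rewrite -[embed 0]/(0 : fraction) -e => h.
have /eqP := graph_unique (graph_ofP _) (embed1P 1) h; by rewrite oner_eq0.
Qed.

HB.instance Definition _ := GRing.Zmodule_isNzRing.Build fraction
  mulqA mul1q mulq1 mulqDl mulqDr oneq_neq0.

Lemma fraction_neq0 q b a : q != 0 -> b != 0 -> q b a -> a != 0.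
Proof.
move=> q0 b0 h; apply/eqP => a0; case/eqP: q0; rewrite a0 in h.
by apply: (@fraction_eq b 0 _ _ b0) => //; apply: embed0P.
Qed.

(** The inverse swaps the coordinates of the graph; the clause for 0 provides the convention that
    inversion fixes non-units. *)
Lemma invq_ex q : exists q', (q = 0 -> q' = 0) /\
  forall b a, a != 0 -> q b a -> graph_of q' a b.
Proof.
have [->|q0] := eqVneq q 0.
  exists 0; split=> // b a a0 h; case/eqP: a0; exact: graph_unique h (embed0P b).
have [d [c [d0 k1]]] := graph_dom (graph_ofP q); have c0 := fraction_neq0 q0 d0 k1.
exists (ratio d c0); split=> [e|b a a0 h]; first by rewrite e eqxx in q0.
have [r [s [e r0 s0]]] := ore_rightW a0 c0; exists r, s; split=> //.
have hb : q (b * r - d * s) 0.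
  rewrite -(subrr (a * r)) {2}e; apply: graphD => //; first exact: graphM.
  by apply: graphN => //; apply: graphM.
apply/eqP; rewrite -subr_eq0; apply/negPn/negP => n0.
by have := fraction_neq0 q0 n0 hb; rewrite eqxx.
Qed.

Definition invq q := projT1 (cid (invq_ex q)).

Lemma invqP q b a : a != 0 -> q b a -> invq q a b.
Proof. exact: (projT2 (cid (invq_ex q))).2. Qed.

Lemma mulVq : {in [pred q | q != 0], left_inverse 1 invq *%R}.
Proof.
move=> q q0; have [b [a [b0 h]]] := graph_dom (graph_ofP q).
apply: (@fraction_eq b b _ _ b0); last exact: embed1P.
by apply: (mulqP b0 h); apply: invqP => //; apply: fraction_neq0 h.
Qed.

Lemma mulqV : {in [pred q | q != 0], right_inverse 1 invq *%R}.
Proof.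
move=> q q0; have [b [a [b0 h]]] := graph_dom (graph_ofP q).
have a0 := fraction_neq0 q0 b0 h.
apply: (@fraction_eq a a _ _ a0); last exact: embed1P.
by apply: (mulqP a0 _ h); apply: invqP.
Qed.

Lemma unitqP q q' : q' * q = 1 /\ q * q' = 1 -> q \in [pred q | q != 0].
Proof.
by case=> e _; apply/eqP => q0; move/eqP: e; rewrite q0 mulr0 eq_sym oner_eq0.
Qed.

Lemma invq_out : {in [predC [pred q | q != 0]], invq =1 id}.
Proof.
by move=> q; rewrite !inE negbK => /eqP q0; rewrite {2}q0; apply: (projT2 (cid (invq_ex q))).1.
Qed.

HB.instance Definition _ := GRing.NzRing_hasMulInverse.Build fraction
  mulVq mulqV unitqP invq_out.

Lemma embed_zmod_morphism : zmod_morphism embed.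
Proof.
move=> x y; apply: (@fraction_eq 1 (x - y)); rewrite ?oner_eq0 //.
  exact: embed_at1.
apply: addq_graph; first exact: embed_at1.
by apply: oppqP; rewrite ?oner_eq0 //; apply: embed_at1.
Qed.

Lemma embed_monoid_morphism : monoid_morphism embed.
Proof.
split=> // x y; apply: (@fraction_eq 1 (x * y)); rewrite ?oner_eq0 //.
  exact: embed_at1.
apply: (@mulqP _ _ _ y); rewrite ?oner_eq0 //; last exact: embedP.
exact: embed_at1.
Qed.

HB.instance Definition _ := GRing.isZmodMorphism.Build R fraction embed embed_zmod_morphism.
HB.instance Definition _ := GRing.isMonoidMorphism.Build R fraction embed embed_monoid_morphism.

Lemma embed_inj : injective embed.
Proof.
move=> x y e; have := embedP x 1; rewrite e !mulr1 => h.
by have := embedP y 1; rewrite mulr1; apply: graph_unique.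
Qed.

End OreFractions.

Theorem ore_localization (R : nzRingType) : no_zero_divisors R ->
  (forall x y : R, x != 0 -> y != 0 -> exists z t, x * z = y * t /\ x * z != 0) ->
  (forall x y : R, x != 0 -> y != 0 -> exists z t, z * x = t * y /\ z * x != 0) ->
  has_classical_skew_field_of_quotients R.
Proof.
move=> dom rore; pose D := OreDomain dom rore; rewrite -[R]/(ore_ring D) => lore.
exists (fraction D), (GRing.RMorphism.clone _ _ (@embed D) _); split=> //.
- exact: (@embed_inj D).
- move=> q; have [b [a [b0 h]]] := graph_dom (graph_ofP q); exists a, b; split=> //.
  apply: (@fraction_eq D b a _ _ b0 h); apply: (@mulqP D _ _ b 1 a b0).
    by apply: invqP => //; rewrite -{2}[b]mulr1; apply: embedP.
  exact: embed_at1.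
- move=> q; have [b [a [b0 h]]] := graph_dom (graph_ofP q).
  have [a0|a0] := eqVneq a 0.
    exists 0, 1; rewrite oner_eq0; split=> //.
    rewrite a0 in h; rewrite rmorph0 mulr0.
    exact: (@fraction_eq D b 0 _ _ b0 h (embed0P b)).
  (* From [z a = t b] with [z] nonzero, [a b^-1 = z^-1 t]. *)
  have [z [t [e n]]] := lore a b a0 b0; exists t, z; split.
    by apply/eqP => z0; rewrite z0 mul0r eqxx in n.
  apply: (@fraction_eq D b a _ _ b0 h); apply: (@mulqP D _ _ b (t * b) a b0); first exact: embedP.
  by rewrite -e; apply: invqP => //; apply: embedP.
Qed.

(** * Enumeration of the hard super-letters and conclusion *)

Lemma finite_hard_enum (n : nat) (P : superletter n -> Prop) :
  finite_set [set t | P t] ->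
  exists N (X : 'I_N -> superletter n),
    [/\ forall t, P t -> exists i, X i = t, forall i, P (X i) &
        forall i j : 'I_N, (i < j)%N -> slt (X i) (X j)].
Proof.
move=> /(finite_image (@sword n))/finite_seqP[s es].
pose leT (u v : word n) := wge v u.
(* Words are sorted rather than super-letters; [sword_inj] carries the enumeration back. *)
pose s' := sort leT (undup s); exists (size s').
have leT_trans : transitive leT by move=> v u w h1 h2; apply: wge_trans h2 h1.
have leT_total : total leT.
  by move=> u v; rewrite /leT; have [//|/wgeN/wgtW ->] := boolP (wge v u); rewrite ?orbT.
have us' : uniq s' by rewrite sort_uniq undup_uniq.
have ss' : sorted leT s' by apply: sort_sorted.
have mem u : u \in s' <-> exists2 t, P t & sword t = u.
  rewrite mem_sort mem_undup; split=> [us|[t Pt <-]].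
    by have : (@sword n @` [set t | P t])%classic u by rewrite es.
  by have : (@sword n @` [set t | P t])%classic (sword t) by [exists t]; rewrite es.
have ex (i : 'I_(size s')) : exists t, P t /\ sword t = nth [::] s' i.
  have /mem[t Pt e] : nth [::] s' i \in s' by apply: mem_nth.
  by exists t.
pose X i := projT1 (cid (ex i)); have XP i : P (X i) /\ sword (X i) = nth [::] s' i := projT2 (cid (ex i)).
exists X; split=> [t Pt|i|i j ij].
- have ts : sword t \in s' by apply/mem; exists t.
  have lt : (index (sword t) s' < size s')%N by rewrite index_mem.
  exists (Ordinal lt); apply: sword_inj; rewrite (XP _).2 /=.
  exact: nth_index.
- by have [] := XP i.
- rewrite /slt !(XP _).2.
  have := sorted_ltn_nth leT_trans [::] ss' i j (ltn_ord i) (ltn_ord j) ij.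
  case/orP=> // /eqP e; move: ij; have /eqP := e.
  by rewrite nth_uniq // => /eqP ->; rewrite ltnn.
Qed.

Theorem corollary10 (k : fieldType) (G : zmodType) (lam : G -> G -> k)
    (lam_bichar : bicharacter lam)
    (H : algType k) (hopf : graded_hopf lam H)
    (n : nat) (a : 'I_n -> H) (g : 'I_n -> G) (d : 'I_n -> nat)
    (a_homog : forall i, hopf (g i) (a i))
    (a_prim : forall i, primitive hopf (a i))
    (a_gen : generates a)
    (d_gt0 : forall i, (0 < d i)%N)
    (hard_fin : finite_set [set t : superletter n | hard lam a g d t])
    (hard_inf : forall t : superletter n,
       hard lam a g d t -> height lam a g d t = None) :
  no_zero_divisors H /\ has_classical_skew_field_of_quotients H.
Proof.
have [N [X [X_hard X_sound X_mono]]] := finite_hard_enum hard_fin.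
pose x := hx lam a g X; pose dg := hd d X.
have dg0 : forall i, (0 < dg i)%N := hd_gt0 d_gt0 X.
have swap := hard_swap lam_bichar d_gt0 X_hard X_mono.
have indep := hard_indep lam_bichar a_homog a_prim d_gt0 X_hard X_mono X_sound hard_inf.
have span_all y : spanned (fun y => exists w, y = xev x w) y.
  pose S : {pred H} := [pred y | `[< spanned (fun y => exists w, y = xev x w) y >]].
  have SE v : (v \in S) = `[< spanned (fun y => exists w, y = xev x w) v >] by [].
  suff : y \in S by rewrite SE => /asboolP.
  apply: a_gen => [|i].
    split=> [|c u v|u v].
    - rewrite SE; apply/asboolP/spanned_gen; exists [::].
      by rewrite /xev big_nil.
    - by rewrite !SE => /asboolP hu /asboolP hv; apply/asboolP/spanned_lin.
    - rewrite !SE => /asboolP hu /asboolP hv; apply/asboolP.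
      apply: (spanned_bilinear (mul_bilinear H) _ hu hv) => _ _ [w1 ->] [w2 ->].
      by rewrite -xev_cat; apply: spanned_gen; exists (w1 ++ w2).
  rewrite SE; apply/asboolP.
  (* A generator is the super-letter of a one-letter word, which [harden_letter] expands even if it
     is not hard. *)
  have st : standard_na (NALeaf i) by apply/andP; split=> //; apply/forallP => -[[]].
  apply: sub_spanned (harden_letter d_gt0 X_hard (exist _ (NALeaf i) st)).
  by move=> _ [w _ ->]; exists w; rewrite -xevE.
have dom : no_zero_divisors H := leading_domain swap indep span_all.
split=> //.
have deg y : exists m, deg_le x dg m y.
  elim: (span_all y) => [|c _ z [w ->] _ [m hm]]; first by exists 0%N; apply: spanned_zero.
  exists (maxn (wd dg w) m); apply: spanned_cons.
    by exists w => //; apply: leq_maxl.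
  by apply: sub_spanned hm => _ [w' le ->]; exists w' => //; rewrite leq_max le orbT.
have mul_neq0 (y z : H) : y != 0 -> z != 0 -> y * z != 0.
  by move=> y0 z0; apply/eqP => /dom[] /eqP; rewrite ?(negPf y0) ?(negPf z0).
have deg2 (y z : H) : exists c, deg_le x dg c y /\ deg_le x dg c z.
  have [[m1 h1] [m2 h2]] := (deg y, deg z); exists (maxn m1 m2).
  split; [apply: sub_spanned h1|apply: sub_spanned h2] => _ [w le ->]; exists w => //;
    by rewrite leq_max le ?orbT.
apply: ore_localization => // y z y0 z0; have [c [hy hz]] := deg2 y z.
(* Left multiplications by [y] and [z] give the right Ore condition, right multiplications the left
   one; injectivity is the absence of zero divisors. *)
- have [|||z1 [z2 [e n0]]] := @images_meet k H N x dg dg0 swap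
      (fun b => if b then *%R y else *%R z) c.
  + by case=> e u v; rewrite mulrDr scalerAr.
  + by case=> u v /eqP; rewrite -subr_eq0 -mulrBr => /eqP/dom[] /eqP;
      rewrite ?(negPf y0) ?(negPf z0) // subr_eq0 => /eqP.
  + by case=> m u hu; apply: deg_leM.
  by exists z1, z2.
- have [|||z1 [z2 [e n0]]] := @images_meet k H N x dg dg0 swap
      (fun b => if b then *%R^~ y else *%R^~ z) c.
  + by case=> e u v /=; rewrite mulrDl scalerAl.
  + by case=> u v /= /eqP; rewrite -subr_eq0 -mulrBl => /eqP/dom[] /eqP;
      rewrite ?(negPf y0) ?(negPf z0) // subr_eq0 => /eqP.
  + by case=> m u hu /=; rewrite addnC; apply: deg_leM.
  by exists z1, z2.
Qed.
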